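(* Let $n\ge2$, let $0\le i<j\le n-1$ with $(i^2-j^2,n)=1$, and let $p=-e^{\pi\sqrt{-1}/n}=e^{(n+1)\pi\sqrt{-1}/n}$. Let $H=H_{2n^2}$ act (inner-faithfully) by $\pi_{i,j}(u,v)$ on $A=A^+=\Bbbk\langle u,v\rangle/(p^{i^2-j^2}uv+vu)$. Then: (1) when $n$ is even, the invariant ring is the commutative polynomial ring $A^H=\Bbbk[u^n+(-1)^{ij}v^n,\,u^nv^n]$, and $H_{2n^2}$ is a reflection Hopf algebra for $A$; (2) when $n$ is odd, the invariant ring is the subalgebra $A^H=\Bbbk\langle u^n+v^n,\ u^nv^n(u^n-v^n)\rangle$ of $A$ generated by the two displayed elements, and it is not AS regular.
   Context: Ground field $\Bbbk=\mathbb{C}$. A connected graded algebra $A$ is AS regular of dimension $d$ if it has finite global dimension $d$, finite Gelfand–Kirillov dimension, and $\mathrm{Ext}^k_A(\Bbbk,A)=\delta_{k,d}\cdot\Bbbk(l)$ for some $l\in\mathbb{Z}$. An action of $H$ on an $H$-module algebra $A$ is inner-faithful if the only Hopf ideal $I$ of $H$ with $I\cdot A=0$ is $0$. $A^H=\{a\in A: h\cdot a=\epsilon(h)a\ \forall h\in H\}$. A semisimple Hopf algebra $H$ acting inner-faithfully and preserving the grading on an AS regular $H$-module algebra $A$ is a reflection Hopf algebra for $A$ if $A^H$ is AS regular. ''$H$ acts by $V$ on $A$'' means that $A$ is generated in degree 1, $A_1=V$ as an $H$-module, and the action is extended to $A$ by $h\cdot(ab)=\sum(h_{(1)}\cdot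 a)(h_{(2)}\cdot b)$. $H_{2n^2}$ (Pansera), $n\ge2$: let $q=e^{2\pi\sqrt{-1}/n}$, $G=\langle x\rangle\times\langle y\rangle$ with $x,y$ of order $n$, $J=\frac1n\sum_{r,s=0}^{n-1}q^{-rs}x^r\otimes y^s$. $H_{2n^2}$ is generated by $\Bbbk G$ and $z$ with $zx=yz$, $zy=xz$, $z^2=\frac1n\sum_{r,s}q^{-rs}x^ry^s$; it has basis $x^ry^sz^k$ ($0\le r,s\le n-1$, $k=0,1$); $x,y$ are grouplike, $\Delta(z)=J(z\otimes z)$, $\epsilon(z)=1$, $S(z)=z$. $\pi_{i,j}(u,v)$ is the two-dimensional module with ordered basis $u,v$ and $xu=q^iu$, $xv=q^jv$, $yu=q^ju$, $yv=q^iv$, $zu=q^{ij}v$, $zv=u$. *)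

(* Defs.v *)
From HB Require Import structures.
From mathcomp Require Import all_boot all_order all_algebra.
From mathcomp Require Import generic_quotient ring_quotient.
From mathcomp Require Import boolp classical_sets reals ereal topology
  normedtype sequences exp trigo.
From mathcomp Require Import complex.
From mathcomp Require Import -(notations) mpoly.
From mathcomp Require Import -(notations) monalg.

Set Implicit Arguments.
Unset Strict Implicit.
Unset Printing Implicit Defensive.

Import Order.TTheory GRing.Theory Num.Theory.
Local Open Scope ring_scope.

Definition projective (A : nzRingType) (P : lmodType A) : Prop :=
  forall (M N : lmodType A) (g : {linear M -> N}) (f : {linear P -> N}),
    (forall y, exists x, g x = y) ->
    exists h : {linear P -> M}, forall x, g (h x) = f x.

Record resolution (A : nzRingType) (M : lmodType A) := Resolution {
  res_mod :> nat -> lmodType A;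
  res_d : forall k, {linear res_mod k.+1 -> res_mod k};
  res_aug : {linear res_mod 0 -> M};
  res_projective : forall k, projective (res_mod k);
  res_aug_surj : forall m, exists x, res_aug x = m;
  res_exact0 : forall x, res_aug x = 0 <-> exists y, x = res_d 0 y;
  res_exact : forall k (x : res_mod k.+1),
    res_d k x = 0 <-> exists y, x = res_d k.+1 y
}.

Definition pdim_le (A : nzRingType) (M : lmodType A) (d : nat) : Prop :=
  exists P : resolution M, forall k, (d < k)%N -> forall x : P k, x = 0.

Definition gldim_le (A : nzRingType) (d : nat) : Prop :=
  forall M : lmodType A, pdim_le M d.

Definition gldim (A : nzRingType) (d : nat) : Prop :=
  gldim_le A d /\ forall d', gldim_le A d' -> (d <= d')%N.

(* Every submodule of every module is a direct summand. *)
Definition semisimple (A : nzRingType) : Prop :=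
  forall (M N : lmodType A) (f : {linear N -> M}), injective f ->
    exists r : {linear M -> N}, cancel f r.

Record direct_decomposition (I : eqType) (V : zmodType) (G : I -> set V) :
    Prop := DirectDecomposition {
  decomp_zmod : forall t, G t 0 /\ forall x y, G t x -> G t y -> G t (x - y);
  decomp_span : forall x, exists (s : seq I) (f : I -> V),
    (forall t, G t (f t)) /\ x = \sum_(t <- s) f t;
  decomp_free : forall (s : seq I) (f : I -> V), uniq s ->
    (forall t, G t (f t)) -> \sum_(t <- s) f t = 0 ->
    forall t, t \in s -> f t = 0
}.

Section IdealQuotient.

Variables (K : comNzRingType) (F : algType K) (r : F).

Definition gen_ideal : {pred F} :=
  fun f => `[< exists s : seq (F * F), f = \sum_(p <- s) p.1 * r * p.2 >].

Lemma gen_idealMl f g : g \in gen_ideal -> f * g \in gen_ideal.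
Proof.
move=> /asboolP[s ->]; apply/asboolP; exists [seq (f * p.1, p.2) | p <- s].
by rewrite big_map mulr_sumr; apply: eq_bigr => p _; rewrite /= !mulrA.
Qed.

Lemma gen_idealMr f g : g \in gen_ideal -> g * f \in gen_ideal.
Proof.
move=> /asboolP[s ->]; apply/asboolP; exists [seq (p.1, p.2 * f) | p <- s].
by rewrite big_map mulr_suml; apply: eq_bigr => p _; rewrite /= !mulrA.
Qed.

Lemma gen_ideal_zmod_closed : zmod_closed gen_ideal.
Proof.
split; first by apply/asboolP; exists [::]; rewrite big_nil.
move=> f g /asboolP[s ->] /asboolP[t ->]; apply/asboolP.
exists (s ++ [seq (- p.1, p.2) | p <- t]).
rewrite big_cat big_map -sumrN; congr (_ + _).
by apply: eq_bigr => p _; rewrite /= !mulNr.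
Qed.

HB.instance Definition _ :=
  GRing.isZmodClosed.Build F gen_ideal gen_ideal_zmod_closed.

Hypothesis gen_ideal1 : 1 \notin gen_ideal.

(* The parameter is only used to make the quotient a nonzero ring. *)
Definition quot_alg (_ : 1 \notin gen_ideal) : Type := Quotient.quot gen_ideal.

Local Notation Q := (quot_alg gen_ideal1).
Local Notation rep x := (repr (x : Quotient.quot gen_ideal)).

HB.instance Definition _ := GRing.Zmodule.copy Q (Quotient.quot gen_ideal).

Definition quot_proj (f : F) : Q := \pi_(Quotient.quot gen_ideal)%qT f.

Lemma quot_projK (x : Q) : quot_proj (rep x) = x.
Proof. exact: reprK. Qed.

Lemma quot_projP f g : quot_proj f = quot_proj g <-> f - g \in gen_ideal.
Proof. by rewrite Quotient.idealrBE; split=> [fg|/eqP //]; apply/eqP. Qed.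

Lemma quot_projD : {morph quot_proj : f g / f + g}.
Proof. exact: (raddfD (\pi_(Quotient.quot gen_ideal)%qT)). Qed.

Definition quot_mul (x y : Q) : Q := quot_proj (rep x * rep y).

Definition quot_scale (d : K) (x : Q) : Q := quot_proj (d *: rep x).

Lemma quot_repP f : rep (quot_proj f) - f \in gen_ideal.
Proof. by apply/quot_projP; rewrite quot_projK. Qed.

Lemma quot_projM f g : quot_proj (f * g) = quot_mul (quot_proj f) (quot_proj g).
Proof.
apply/esym/quot_projP.
have -> : rep (quot_proj f) * rep (quot_proj g) - f * g =
    (rep (quot_proj f) - f) * rep (quot_proj g) + f * (rep (quot_proj g) - g).
  by rewrite mulrBl mulrBr addrA subrK.
apply: rpredD; [exact/gen_idealMr/quot_repP | exact/gen_idealMl/quot_repP].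
Qed.

Lemma quot_projZ d f : quot_proj (d *: f) = quot_scale d (quot_proj f).
Proof.
apply/esym/quot_projP; rewrite -scalerBr -[X in d *: X]mul1r scalerAl.
exact/gen_idealMl/quot_repP.
Qed.

Lemma quot_ind (P : Q -> Prop) : (forall f, P (quot_proj f)) -> forall x, P x.
Proof. by move=> Pf x; rewrite -(quot_projK x). Qed.

Lemma quot_mulA : associative quot_mul.
Proof.
elim/quot_ind => f; elim/quot_ind => g; elim/quot_ind => h.
by rewrite -!quot_projM mulrA.
Qed.

Lemma quot_mul1 : left_id (quot_proj 1) quot_mul.
Proof. by elim/quot_ind => f; rewrite -quot_projM mul1r. Qed.

Lemma quot_mulr1 : right_id (quot_proj 1) quot_mul.
Proof. by elim/quot_ind => f; rewrite -quot_projM mulr1. Qed.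

Lemma quot_mulDl : left_distributive quot_mul +%R.
Proof.
elim/quot_ind => f; elim/quot_ind => g; elim/quot_ind => h.
by rewrite -quot_projD -!quot_projM -quot_projD mulrDl.
Qed.

Lemma quot_mulDr : right_distributive quot_mul +%R.
Proof.
elim/quot_ind => f; elim/quot_ind => g; elim/quot_ind => h.
by rewrite -quot_projD -!quot_projM -quot_projD mulrDr.
Qed.

Lemma quot_1_neq0 : quot_proj 1 != 0.
Proof.
apply/eqP => e; have := gen_ideal1; rewrite -[1]subr0 => /negP; apply.
apply/quot_projP; rewrite e; apply: (addrI (quot_proj 0)).
by rewrite -quot_projD !addr0.
Qed.

HB.instance Definition _ := GRing.Zmodule_isNzRing.Build Q
  quot_mulA quot_mul1 quot_mulr1 quot_mulDl quot_mulDr quot_1_neq0.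

Lemma quot_scaleA d e x : quot_scale d (quot_scale e x) = quot_scale (d * e) x.
Proof. by elim/quot_ind: x => f; rewrite -!quot_projZ scalerA. Qed.

Lemma quot_scale1 : left_id 1 quot_scale.
Proof. by elim/quot_ind => f; rewrite -quot_projZ scale1r. Qed.

Lemma quot_scaleDr : right_distributive quot_scale +%R.
Proof.
move=> d; elim/quot_ind => f; elim/quot_ind => g.
by rewrite -quot_projD -!quot_projZ -quot_projD scalerDr.
Qed.

Lemma quot_scaleDl x : {morph quot_scale^~ x : d e / d + e}.
Proof.
by elim/quot_ind: x => f d e; rewrite -!quot_projZ -quot_projD scalerDl.
Qed.

HB.instance Definition _ := GRing.Zmodule_isLmodule.Build K Q
  quot_scaleA quot_scale1 quot_scaleDr quot_scaleDl.

Lemma quot_scaleAl d (x y : Q) : d *: (x * y) = (d *: x) * y.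
Proof.
elim/quot_ind: x => f; elim/quot_ind: y => g; rewrite /GRing.scale /=.
by rewrite -[_ * _]quot_projM -!quot_projZ -[RHS]quot_projM scalerAl.
Qed.

Lemma quot_scaleAr d (x y : Q) : d *: (x * y) = x * (d *: y).
Proof.
elim/quot_ind: x => f; elim/quot_ind: y => g; rewrite /GRing.scale /=.
by rewrite -[_ * _]quot_projM -!quot_projZ -[RHS]quot_projM scalerAr.
Qed.

HB.instance Definition _ := GRing.Lmodule_isLalgebra.Build K Q quot_scaleAl.
HB.instance Definition _ := GRing.Lalgebra_isAlgebra.Build K Q quot_scaleAr.

End IdealQuotient.

Definition free_alg (K : comNzRingType) : Type := malg (fmonom 'I_2) K.

Section FreeAlgebra.

Variable K : comNzRingType.

HB.instance Definition _ := GRing.Lalgebra.copy (free_alg K)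
  (malg (fmonom 'I_2) K).

Lemma free_scaleAr (d : K) (f g : free_alg K) : d *: (f * g) = f * (d *: g).
Proof.
apply/malgP => w; rewrite mcoeffZ.
rewrite [RHS](mcoeffMlw w (finmap.fsubset_refl (msupp f)) (msuppZ_le d g)).
rewrite (mcoeffMl f g) mulr_sumr; apply: eq_bigr => a _; rewrite mulr_sumr.
by apply: eq_bigr => b _; rewrite mcoeffZ mulrnAr mulrCA.
Qed.

HB.instance Definition _ :=
  GRing.Lalgebra_isAlgebra.Build K (free_alg K) free_scaleAr.

Definition free_gen (k : 'I_2) : free_alg K := mkmalgU (fmu k) 1.

Definition free_homogeneous (m : nat) (f : free_alg K) : Prop :=
  forall w : fmonom 'I_2, mcoeff w f != 0 -> size (fmonom_val w) = m.

Variable c : K.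

Definition skew_relator : free_alg K :=
  c *: (free_gen ord0 * free_gen ord_max) + free_gen ord_max * free_gen ord0.

Lemma skew_ideal1 : 1 \notin gen_ideal skew_relator.
Proof.
have [e [eD eZ eM e1 eU]] : exists e : free_alg K -> K,
    [/\ {morph e : f g / f + g}, forall d f, e (d *: f) = d * e f,
        {morph e : f g / f * g}, e 1 = 1 & forall k, e (free_gen k) = 0].
  have [m1M m1] := mcoeff1g_is_multiplicative (fmonom 'I_2) K.
  exists (mcoeff mone); split=> //; first exact: raddfD.
    by move=> d f; exact: mcoeffZ.
  move=> k; rewrite /free_gen mcoeffU.
  by case: eqP => // /(congr1 (@fmonom_val _)); rewrite fm1 fmU.
have r0 : e skew_relator = 0.
  rewrite [LHS]eD [X in X + _]eZ [X in _ * X]eM [X in _ + X]eM.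
  by rewrite [e _]eU mul0r !mulr0 addr0.
have e0 : e 0 = 0 by apply: (addrI (e 0)); rewrite -eD !addr0.
apply/negP => /asboolP[s] /(congr1 e).
rewrite e1 (big_morph e eD e0) big1 => [|p _]; last by rewrite !eM r0 mulr0 mul0r.
by move/eqP; rewrite oner_eq0.
Qed.

Definition skew_plane : algType K := quot_alg skew_ideal1.

Definition skew_proj (f : free_alg K) : skew_plane := quot_proj skew_ideal1 f.
Definition skew_u : skew_plane := skew_proj (free_gen ord0).
Definition skew_v : skew_plane := skew_proj (free_gen ord_max).

Definition skew_grading (m : nat) : set skew_plane :=
  (skew_proj @` free_homogeneous m)%classic.

End FreeAlgebra.

Section Algebras.

Variable R : realType.
Local Notation C := R[i].

Record connected_graded (A : algType C) (G : nat -> set A) : Prop :=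
  ConnectedGraded {
  grad_direct : direct_decomposition G;
  grad_scale : forall m (c : C) a, G m a -> G m (c *: a);
  grad_mul : forall m1 m2 a b, G m1 a -> G m2 b -> G (m1 + m2)%N (a * b);
  grad_connected : forall a, G 0%N a <-> exists c : C, a = c%:A
}.

Definition int_grading (A : algType C) (G : nat -> set A) (t : int) : set A :=
  match t with Posz m => G m | Negz _ => [set 0]%classic end.

Record graded_module (A : algType C) (G : nat -> set A) (M : lmodType A)
    (GM : int -> set M) : Prop := GradedModule {
  gmod_direct : direct_decomposition GM;
  gmod_scale : forall m t a x, G m a -> GM t x -> GM (m%:Z + t) (a *: x)
}.

(* [T] is the trivial module $\Bbbk = A/A_{\ge 1}$, spanned by [e]. *)
Definition is_trivial_module (A : algType C) (G : nat -> set A)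
    (T : lmodType A) (e : T) : Prop :=
  [/\ e != 0,
      forall x : T, exists c : C, x = c%:A *: e
    & forall m a, (0 < m)%N -> G m a -> a *: e = 0].

(* A projective resolution of the trivial module by graded modules and maps of
   degree 0, the trivial module being placed in degree 0. *)
Record graded_resolution (A : algType C) (G : nat -> set A)
    (T : lmodType A) := GradedResolution {
  gres :> resolution T;
  gres_grading : forall k, int -> set (gres k);
  gres_graded : forall k, graded_module G (@gres_grading k);
  gres_d : forall k t (x : gres k.+1),
    gres_grading t x -> gres_grading t (res_d gres k x);
  gres_aug : forall t (x : gres 0%N),
    gres_grading t x -> t != 0 -> res_aug gres x = 0
}.

(* Graded Ext: degree [t] of $\mathrm{Ext}^k_A(\Bbbk,A)$ is the cohomology at
   [k] of the complex of left-module maps $P_k\to A$ of degree [t]. *)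
Section Ext.

Variables (A : algType C) (G : nat -> set A) (T : lmodType A).
Variable P : graded_resolution G T.

Definition hom_degree (t : int) k (f : P k -> A) : Prop :=
  linear (f : P k -> A^o) /\
  forall s x, @gres_grading _ _ _ P k s x -> int_grading G (s + t) (f x).

Definition ext_cocycle (t : int) k (f : P k -> A) : Prop :=
  hom_degree t f /\ forall x : P k.+1, f (res_d P k x) = 0.

Definition ext_coboundary (t : int) k : (P k -> A) -> Prop :=
  match k with
  | 0%N => fun f => forall x, f x = 0
  | k'.+1 => fun f => exists g : P k' -> A,
      hom_degree t g /\ forall x, f x = g (res_d P k' x)
  end.

Definition ext_zero (t : int) k : Prop :=
  forall f, @ext_cocycle t k f -> ext_coboundary t f.

Definition ext_line (t : int) k : Prop :=
  exists f0, [/\ @ext_cocycle t k f0, ~ ext_coboundary t f0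
    & forall f, @ext_cocycle t k f ->
        exists c : C, ext_coboundary t (fun x => f x - c *: f0 x)].

(* $\mathrm{Ext}^k_A(\Bbbk,A)=\delta_{k,d}\cdot\Bbbk(l)$, where $\Bbbk(l)$ is
   the line in degree $-l$.  The right action of $A$ needs no separate mention:
   on a line in a single degree $A_{\ge 1}$ acts by zero. *)
Definition ext_is_shifted_line (d : nat) (l : int) : Prop :=
  forall (k : nat) (t : int),
    if (k == d) && (t == - l) then ext_line t k else ext_zero t k.

End Ext.

Definition AS_gorenstein (A : algType C) (G : nat -> set A) (d : nat) : Prop :=
  exists l : int, exists (T : lmodType A) (e : T), is_trivial_module G e /\
    exists P : graded_resolution G T, ext_is_shifted_line P d l.

Definition lin_free (V : lmodType C) (s : seq V) : Prop :=
  forall c : 'I_(size s) -> C,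
    \sum_(k < size s) c k *: s`_k = 0 -> forall k, c k = 0.

Definition span_dim (V : lmodType C) (s : seq V) : nat :=
  \max_(b : (size s).-tuple bool | `[< lin_free (mask b s) >])
    size (mask b s).

(* If [s] spans $V$ then [words s m] spans $\sum_{k\le m}V^k$. *)
Fixpoint words (A : algType C) (s : seq A) (m : nat) : seq A :=
  if m is m'.+1 then 1 :: [seq a * w | a <- s, w <- words s m'] else [:: 1].

Definition GKdim (A : algType C) : \bar R :=
  ereal_sup (range (fun s : seq A =>
    limn_esup (fun m : nat =>
      (ln (span_dim (words s m))%:R / ln m%:R : R)%:E))).

Definition AS_regular_dim (A : algType C) (G : nat -> set A) (d : nat) : Prop :=
  [/\ connected_graded G, gldim A d, (GKdim A < +oo)%E & AS_gorenstein G d].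

Definition AS_regular (A : algType C) (G : nat -> set A) : Prop :=
  exists d, AS_regular_dim G d.

(* An element of $H\otimes H$ is represented by a list of pairs, read as the
    sum of the corresponding pure tensors; two lists represent the same tensor
    iff every bilinear map takes the same value on both.  Likewise for
    $H\otimes H\otimes H$. *)

Definition bilinear_map (U V W : lmodType C) (f : U -> V -> W) : Prop :=
  (forall b, linear (f^~ b)) /\ (forall a, linear (f a)).

Definition trilinear_map (U V X W : lmodType C) (f : U -> V -> X -> W) : Prop :=
  [/\ forall b c, linear (fun a => f a b c),
      forall a c, linear (fun b => f a b c)
    & forall a b, linear (f a b)].

Definition tensor_eq (U V : lmodType C) (s t : seq (U * V)) : Prop :=
  forall (W : lmodType C) (f : U -> V -> W), bilinear_map f ->
    \sum_(p <- s) f p.1 p.2 = \sum_(p <- t) f p.1 p.2.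

Definition tensor3_eq (U V X : lmodType C) (s t : seq (U * V * X)) : Prop :=
  forall (W : lmodType C) (f : U -> V -> X -> W), trilinear_map f ->
    \sum_(p <- s) f p.1.1 p.1.2 p.2 = \sum_(p <- t) f p.1.1 p.1.2 p.2.

Record hopf_algebra (H : algType C) := HopfAlgebra {
  comul : H -> seq (H * H);
  counit : H -> C;
  antipode : H -> H;
  comul_linear : forall (c : C) g h,
    tensor_eq (comul (c *: g + h))
      ([seq (c *: p.1, p.2) | p <- comul g] ++ comul h);
  comul_one : tensor_eq (comul 1) [:: (1, 1)];
  comul_mul : forall g h,
    tensor_eq (comul (g * h))
      [seq (p.1 * r.1, p.2 * r.2) | p <- comul g, r <- comul h];
  comul_coassoc : forall h,
    tensor3_eq [seq (r.1, r.2, p.2) | p <- comul h, r <- comul p.1]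
               [seq (p.1, r.1, r.2) | p <- comul h, r <- comul p.2];
  counit_linear : linear (counit : H -> C^o);
  counit_one : counit 1 = 1;
  counit_mul : forall g h, counit (g * h) = counit g * counit h;
  counitl : forall h, \sum_(p <- comul h) counit p.1 *: p.2 = h;
  counitr : forall h, \sum_(p <- comul h) counit p.2 *: p.1 = h;
  antipode_linear : linear antipode;
  antipodel : forall h, \sum_(p <- comul h) antipode p.1 * p.2 = (counit h)%:A;
  antipoder : forall h, \sum_(p <- comul h) p.1 * antipode p.2 = (counit h)%:A
}.

Record hopf_ideal (H : algType C) (S : hopf_algebra H) (I : set H) : Prop :=
  HopfIdeal {
  hopf_ideal0 : I 0;
  hopf_idealD : forall g h, I g -> I h -> I (g + h);
  hopf_idealMl : forall g h, I h -> I (g * h);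
  hopf_idealMr : forall g h, I h -> I (h * g);
  hopf_ideal_comul : forall h, I h -> exists s t : seq (H * H),
    [/\ forall p, p \in s -> I p.1, forall p, p \in t -> I p.2
      & tensor_eq (comul S h) (s ++ t)];
  hopf_ideal_counit : forall h, I h -> counit S h = 0;
  hopf_ideal_antipode : forall h, I h -> I (antipode S h)
}.

Record module_algebra (H : algType C) (S : hopf_algebra H) (A : algType C) :=
  ModuleAlgebra {
  act :> H -> A -> A;
  act_bilinear : bilinear_map act;
  act1 : forall a, act 1 a = a;
  actM : forall g h a, act (g * h) a = act g (act h a);
  act_one : forall h, act h 1 = (counit S h)%:A;
  act_mul : forall h a b,
    act h (a * b) = \sum_(p <- comul S h) act p.1 a * act p.2 b
}.

Section Invariants.

Variables (H : algType C) (S : hopf_algebra H) (A : algType C).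
Variable M : module_algebra S A.

Definition invariants : {pred A} :=
  fun a => `[< forall h, M h a = counit S h *: a >].

Lemma invariant_subalg_closed : GRing.subalg_closed invariants.
Proof.
have [actl actr] := act_bilinear M.
have actD h a b : M h (a + b) = M h a + M h b.
  by have := actr h 1 a b; rewrite !scale1r.
have act0 h : M h 0 = 0 by apply: (addrI (M h 0)); rewrite -actD !addr0.
have actZ h c a : M h (c *: a) = c *: M h a.
  by have := actr h c a 0; rewrite !addr0 act0 addr0.
split.
- by apply/asboolP => h; rewrite act_one.
- move=> c a b /asboolP ia /asboolP ib; apply/asboolP => h.
  by rewrite actD actZ ia ib scalerDr !scalerA mulrC.
- move=> a b /asboolP ia /asboolP ib; apply/asboolP => h.
  rewrite act_mul.
  under eq_bigr => p _ do rewrite ia ib -scalerAl -scalerAr.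
  rewrite -[in RHS](counitl S h).
  have eD g k : counit S (g + k) = counit S g + counit S k.
    by have := counit_linear S 1 g k; rewrite !scale1r.
  have e0 : counit S 0 = 0 by apply: (addrI (counit S 0)); rewrite -eD !addr0.
  have eZ c g : counit S (c *: g) = c * counit S g.
    by have := counit_linear S c g 0; rewrite !addr0 e0 addr0.
  rewrite (big_morph (counit S) eD e0) scaler_suml.
  by apply: eq_bigr => p _; rewrite eZ scalerA.
Qed.

HB.instance Definition _ :=
  GRing.isSubalgClosed.Build C A invariants
    (GRing.subalg_closed_semi invariant_subalg_closed).

Record invariant_ring : predArgType :=
  InvariantRing { inv_val :> A; _ : inv_val \in invariants }.

HB.instance Definition _ := [isSub for inv_val].
HB.instance Definition _ := [Choice of invariant_ring by <:].
HB.instance Definition _ := [SubChoice_isSubAlgebra of invariant_ring by <:].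

Definition inv_grading (G : nat -> set A) (m : nat) : set invariant_ring :=
  fun a => G m (inv_val a).

Definition inner_faithful : Prop :=
  forall I : set H, hopf_ideal S I ->
    (forall h a, I h -> M h a = 0) -> forall h, I h -> h = 0.

Definition preserves_grading (G : nat -> set A) : Prop :=
  forall h m a, G m a -> G m (M h a).

Definition reflection_hopf_algebra (G : nat -> set A) : Prop :=
  [/\ semisimple H, AS_regular G, inner_faithful, preserves_grading G
    & AS_regular (inv_grading G)].

End Invariants.

Definition generated_subalg (A : algType C) (X : set A) : set A :=
  fun a => forall B : {pred A}, GRing.subalg_closed B ->
    (forall b, X b -> b \in B) -> a \in B.

(* $e^{\sqrt{-1}\,t}$ *)
Definition cis (t : R) : C := Complex (cos t) (sin t).

Definition unity_root (n : nat) : C := cis (2 * pi / n%:R).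

(* $p=-e^{\pi\sqrt{-1}/n}$, a square root of [unity_root n]. *)
Definition neg_half_root (n : nat) : C := - cis (pi / n%:R).

Record is_H2n2 (n : nat) (H : algType C) (S : hopf_algebra H) (x y z : H) :
    Prop := IsH2n2 {
  H2n2_xn : x ^+ n = 1;
  H2n2_yn : y ^+ n = 1;
  H2n2_xy : x * y = y * x;
  H2n2_zx : z * x = y * z;
  H2n2_zy : z * y = x * z;
  H2n2_zz : z ^+ 2 = n%:R^-1 *: \sum_(r < n) \sum_(s < n)
              (unity_root n ^- (r * s)) *: (x ^+ r * y ^+ s);
  H2n2_basis : forall h : H, exists! c : {ffun 'I_n * 'I_n * 'I_2 -> C},
    h = \sum_(t : 'I_n * 'I_n * 'I_2)
          c t *: (x ^+ t.1.1 * y ^+ t.1.2 * z ^+ t.2);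
  H2n2_comul_x : tensor_eq (comul S x) [:: (x, x)];
  H2n2_comul_y : tensor_eq (comul S y) [:: (y, y)];
  H2n2_comul_z : tensor_eq (comul S z)
    [seq ((n%:R^-1 * unity_root n ^- (nat_of_ord t.1 * nat_of_ord t.2)) *: (x ^+ t.1 * z),
          y ^+ t.2 * z) | t <- enum {: 'I_n * 'I_n}];
  H2n2_counit_x : counit S x = 1;
  H2n2_counit_y : counit S y = 1;
  H2n2_counit_z : counit S z = 1;
  H2n2_antipode_z : antipode S z = z
}.

(* The span of [u], [v] is the module $\pi_{i,j}(u,v)$. *)
Record acts_by_pi (n i j : nat) (H : algType C) (x y z : H) (A : algType C)
    (op : H -> A -> A) (u v : A) : Prop := ActsByPi {
  pi_xu : op x u = unity_root n ^+ i *: u;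
  pi_xv : op x v = unity_root n ^+ j *: v;
  pi_yu : op y u = unity_root n ^+ j *: u;
  pi_yv : op y v = unity_root n ^+ i *: v;
  pi_zu : op z u = unity_root n ^+ (i * j) *: v;
  pi_zv : op z v = u
}.

Definition is_polynomial_ring2 (A : algType C) (a b : A) : Prop :=
  exists phi : {lrmorphism mpoly 2 C -> A},
    [/\ bijective phi, phi (mpolyX C (mnm1 ord0)) = a
      & phi (mpolyX C (mnm1 ord_max)) = b].

Definition Aplus (n i j : nat) : algType C :=
  skew_plane (neg_half_root n ^ (i%:Z ^+ 2 - j%:Z ^+ 2)).
Definition Aplus_u (n i j : nat) : Aplus n i j := skew_u _.
Definition Aplus_v (n i j : nat) : Aplus n i j := skew_v _.
Definition Aplus_grading (n i j : nat) : nat -> set (Aplus n i j) :=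
  @skew_grading _ _.

End Algebras.

(* Main.v *)
Require Import Defs.
From HB Require Import structures.
From mathcomp Require Import all_boot all_order all_algebra.
From mathcomp Require Import boolp classical_sets reals ereal topology
  normedtype sequences exp trigo.
From mathcomp Require Import complex.
From mathcomp Require Import ring zify.

Set Implicit Arguments.
Unset Strict Implicit.
Unset Printing Implicit Defensive.

Import Order.TTheory GRing.Theory Num.Theory.
Local Open Scope ring_scope.

(** Write $X=u^n$ and $Y=v^n$.  The grouplike elements $x$ and $y$ scale each
    monomial $u^rv^s$ by roots of unity, and coprimality of $i^2-j^2$ and $n$
    makes the two weights determine $r$ and $s$ modulo $n$
    ([torus_fixed_ind]).  Hence the elements fixed by $x$ and $y$ are the span
    of the $X^rY^s$.  On these the twist in the coproduct of $z$ is invisible, so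
    $z$ acts by an algebra automorphism, which exchanges $X$ and $Y$
    ([act_z_X], [act_z_Y]), and $A^H$ is its fixed ring ([invariantsP]).  From
    $vu=-p^{i^2-j^2}uv$ one computes $YX=(-1)^nXY$ ([XY_skew_comm]).

    For $n$ even, $A^H$ is therefore the ring of symmetric polynomials in two
    commuting variables, a polynomial ring on $X+Y$ and $XY$
    ([invariants_polynomial]); the sign $(-1)^{ij}$ is $1$ because $i$ and $j$
    are not both odd.

    For $n$ odd, $X$ and $Y$ anticommute.  With $s=X+Y$ and $D=X-Y$ one has
    $D^2=s^2$ and $zD=-D$, and every product of $s$ and $D$ lies in
    $B_0+B_0D+B_0Ds$, where $B_0$ is generated by $s$ and $XYD$.  The
    automorphism $z$ is $1$ on $B_0$ and $-1$ on the other two summands, so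
    $A^H=B_0$ ([invariants_generated]).  Put $\sigma=s^2$ and $\tau=DsD$.  The
    endomorphism $(a,b)\mapsto(a\tau+b\sigma^2,-a\sigma-b\tau)$ of the free
    module of rank two has its kernel equal to its image, which gives a minimal
    periodic resolution that never ends.  So the global dimension of $A^H$ is
    infinite ([invariant_ring_inf_gldim]) and $A^H$ is not AS regular.

    Regularity of $A$ and of the polynomial ring is one theorem
    ([skew_AS_regular]) about a skew polynomial algebra $\Bbbk_c[u,v]$ with
    positive weights.  Its global dimension is at most two because any module $M$
    has a resolution of length two by the modules induced from its underlying
    vector space ([skew_pdim_le2]), and at least two because the Koszul resolution
    of the trivial module is minimal ([skew_gldim]).  Dualizing the Koszul
    resolution gives the Gorenstein condition.  Minimality is exploited twice in
    the same way: a resolution is compared with one that vanishes in some degree,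
    so the identity is null-homotopic there ([null_homotopy]), which is absurd when
    all entries of the differentials lie in the augmentation ideal. *)

(** * Submodules and linear maps *)

Section Submodule.

Variables (A : nzRingType) (V : lmodType A) (S : {pred V}).

Record submodule (S_closed : submod_closed S) : predArgType :=
  Submodule { submodule_val :> V; _ : submodule_val \in S }.

Hypothesis S_closed : submod_closed S.

HB.instance Definition _ := GRing.isSubmodClosed.Build A V S
  (GRing.submod_closed_semi S_closed).

Local Notation sub := (submodule S_closed).
HB.instance Definition _ := [isSub for @submodule_val S_closed].
HB.instance Definition _ := [Choice of sub by <:].
HB.instance Definition _ := [SubChoice_isSubLmodule of sub by <:].

End Submodule.

Section LinearOf.

Variables (A : nzRingType) (V W : lmodType A) (f : V -> W).
Hypothesis f_lin : linear f.

Definition linear_of : {linear V -> W} :=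
  HB.pack f (GRing.isLinear.Build A V W *:%R f f_lin).

Lemma linear_ofP : exists g : {linear V -> W}, forall x, g x = f x.
Proof. by exists linear_of. Qed.

End LinearOf.

Section LinearCombinations.

Variables (A : nzRingType) (V W X : lmodType A).

Lemma linear_null : linear (fun _ : V => 0 : W).
Proof. by move=> a x y; rewrite scaler0 addr0. Qed.

Lemma linear_add (f g : V -> W) :
  linear f -> linear g -> linear (fun x => f x + g x).
Proof. by move=> fL gL a x y; rewrite fL gL scalerDr addrACA. Qed.

Lemma linear_sub (f g : V -> W) :
  linear f -> linear g -> linear (fun x => f x - g x).
Proof. by move=> fL gL a x y; rewrite fL gL scalerBr opprD addrACA. Qed.

Lemma linear_comp (f : {linear W -> X}) (g : V -> W) :
  linear g -> linear (fun x => f (g x)).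
Proof. by move=> gL a x y; rewrite gL linearP. Qed.

Lemma linear_pair (f : V -> W) (g : V -> X) :
  linear f -> linear g -> linear (fun x => (f x, g x) : W * X).
Proof. by move=> fL gL a x y; rewrite fL gL. Qed.

End LinearCombinations.

(** * Comparison of projective resolutions *)

(** Projectivity is applied to the corestriction of [d] to its image, a
    submodule that contains the values of [f]. *)
Lemma projective_lift (A : nzRingType) (Q V W : lmodType A) (f : {linear Q -> W})
    (d : {linear V -> W}) :
  projective Q -> (forall x, exists y, f x = d y) ->
  exists h : {linear Q -> V}, forall x, d (h x) = f x.
Proof.
move=> projQ im_f.
pose S : {pred W} := fun w => `[< exists y, w = d y >].
have S_closed : submod_closed S.
  split; first by apply/asboolP; exists 0; rewrite linear0.
  move=> a x y /asboolP[x' ->] /asboolP[y' ->]; apply/asboolP.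
  by exists (a *: x' + y'); rewrite linearP.
have in_S q : f q \in S by apply/asboolP; have [y ->] := im_f q; exists y.
have d_S y : d y \in S by apply/asboolP; exists y.
have f_lin : linear (fun q => Submodule S_closed (in_S q)).
  by move=> a x y; apply/val_inj; rewrite /= linearP.
have d_lin : linear (fun y => Submodule S_closed (d_S y)).
  by move=> a x y; apply/val_inj; rewrite /= linearP.
have [f' f'E] := linear_ofP f_lin; have [d' d'E] := linear_ofP d_lin.
have [|h hE] := projQ _ _ d' f'.
  move=> [w w_S]; move/asboolP: (w_S) => [y wE]; exists y.
  by rewrite d'E; apply/val_inj; rewrite /= wE.
by exists h => x; have /(congr1 val) := hE x; rewrite d'E f'E.
Qed.

Section Comparison.

Variables (A : nzRingType) (M : lmodType A).

(** The augmentation takes the place of the differential in degree [0], so that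
    exactness has the same form in all degrees. *)
Definition cycle (P : resolution M) k : P k -> Prop :=
  match k with
  | 0%N => fun x => res_aug P x = 0
  | k'.+1 => fun x => res_d P k' x = 0
  end.

Lemma cycleP (P : resolution M) k (x : P k) :
  cycle x <-> exists y, x = res_d P k y.
Proof. by case: k x => [|k] x; [apply: res_exact0 | apply: res_exact]. Qed.

Lemma cycle_d (P : resolution M) k (x : P k.+1) : cycle (res_d P k x).
Proof. by apply/cycleP; exists x. Qed.

Lemma lift_to_chains (P : resolution M) (Q : lmodType A) k (f : {linear Q -> P k}) :
  projective Q -> (forall x, cycle (f x)) ->
  exists h : {linear Q -> P k.+1}, forall x, res_d P k (h x) = f x.
Proof. by move=> projQ fZ; apply: projective_lift => // x; apply/cycleP. Qed.

(** A comparison of two resolutions in degree [k]: chain maps [g] and [e] in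
    both directions, and a homotopy [s] from their composite to the identity.
    The conditions only concern degree [k], so that a comparison is extended
    degree by degree without choosing whole chain maps. *)
Definition comparable_in (F P : resolution M) k : Prop :=
  exists (g : {linear F k -> P k}) (e : {linear P k -> F k})
         (s : {linear F k -> F k.+1}),
    [/\ forall x, cycle x -> cycle (g x), forall x, cycle x -> cycle (e x)
      & forall x, cycle x -> e (g x) - x = res_d F k (s x)].

Lemma comparable_in0 (F P : resolution M) : comparable_in F P 0.
Proof.
have augP (X Y : resolution M) : exists g : {linear X 0%N -> Y 0%N},
    forall x, res_aug Y (g x) = res_aug X x.
  apply: projective_lift; first exact: res_projective.
  by move=> x; have [y <-] := res_aug_surj Y (res_aug X x); exists y.
have [g gE] := augP F P; have [e eE] := augP P F.
have h_lin : linear (fun x => e (g x) - x).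
  by apply: linear_sub => //; apply: linear_comp; apply: linearP.
have [h hE] := linear_ofP h_lin.
have [|x|s sE] := @lift_to_chains F (F 0%N) 0 h; first exact: res_projective.
  by rewrite hE /= linearB /= eE gE subrr.
exists g, e, s; split=> x /=; rewrite ?gE ?eE //.
by rewrite sE hE.
Qed.

(** The map $e'g'-1-s\,d$ takes its values in the cycles, so it lifts along the
    next differential. *)
Lemma comparison_homotopy (F P : resolution M) k
    (g : {linear F k -> P k}) (e : {linear P k -> F k})
    (s : {linear F k -> F k.+1})
    (g' : {linear F k.+1 -> P k.+1}) (e' : {linear P k.+1 -> F k.+1}) :
  (forall x, cycle x -> e (g x) - x = res_d F k (s x)) ->
  (forall x, res_d P k (g' x) = g (res_d F k x)) ->
  (forall x, res_d F k (e' x) = e (res_d P k x)) ->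
  exists s' : {linear F k.+1 -> F k.+2}, forall x,
    e' (g' x) - x = res_d F k.+1 (s' x) + s (res_d F k x).
Proof.
move=> sE g'E e'E.
have h_lin : linear (fun x => e' (g' x) - x - s (res_d F k x)).
  by apply: linear_sub; first apply: linear_sub => //;
     apply: linear_comp; apply: linearP.
have [h hE] := linear_ofP h_lin.
have [|x|s' s'E] := @lift_to_chains F _ k.+1 h; first exact: res_projective.
  rewrite hE /= !linearB /= e'E g'E -sE ?subrr //; exact: cycle_d.
by exists s' => x; rewrite s'E hE subrK.
Qed.

Lemma comparable_inS (F P : resolution M) k :
  comparable_in F P k -> comparable_in F P k.+1.
Proof.
move=> [g [e [s [gZ eZ sE]]]].
have step (X Y : resolution M) (f : {linear X k -> Y k}) :
    (forall x, cycle x -> cycle (f x)) ->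
    exists f' : {linear X k.+1 -> Y k.+1},
      forall x, res_d Y k (f' x) = f (res_d X k x).
  move=> fZ.
  have fd_lin : linear (fun x => f (res_d X k x)).
    by move=> a x y; rewrite !linearP.
  have [fd fdE] := linear_ofP fd_lin.
  have [|x|f' f'E] := @lift_to_chains Y _ k fd; first exact: res_projective.
    by rewrite fdE; apply/fZ/cycle_d.
  by exists f' => x; rewrite f'E fdE.
have [g' g'E] := step _ _ g gZ; have [e' e'E] := step _ _ e eZ.
have [s' s'E] := comparison_homotopy sE g'E e'E.
exists g', e', s'; split=> x /= x0; rewrite ?g'E ?e'E ?x0 ?linear0 //.
by rewrite s'E x0 linear0 addr0.
Qed.

Lemma comparable_all (F P : resolution M) k : comparable_in F P k.
Proof. by elim: k => [|k]; [apply: comparable_in0 | apply: comparable_inS]. Qed.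

(** If some resolution vanishes in degree [k.+1], then the identity of any other
    one is null-homotopic there, being homotopic to a composite through [0]. *)
Theorem null_homotopy (F P : resolution M) k : (forall x : P k.+1, x = 0) ->
  exists (s' : {linear F k.+1 -> F k.+2}) (s : {linear F k -> F k.+1}),
    forall x, x = res_d F k.+1 (s' x) + s (res_d F k x).
Proof.
move=> P0; have [g [e [s [gZ eZ sE]]]] := comparable_all F P k.
have [g' g'E] := linear_ofP (@linear_null A (F k.+1) (P k.+1)).
have [e' e'E] := linear_ofP (@linear_null A (P k.+1) (F k.+1)).
have fdE x : g (res_d F k x) = 0.
  have /cycleP[y ->] := gZ _ (cycle_d x); by rewrite [y]P0 linear0.
have [x|y|s' s'E] := comparison_homotopy (g' := g') (e' := e') sE.
  by rewrite g'E linear0 fdE.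
  by rewrite [y]P0 !linear0.
exists (GRing.opp \o s'), (GRing.opp \o s) => x /=.
by rewrite linearN -opprD -s'E e'E sub0r opprK.
Qed.

End Comparison.

(** * Linear selections and projective modules *)

Section LinearSelection.

Variables (K : fieldType) (V W : lmodType K).

Definition subspace (E : set (V * W)) : Prop :=
  E 0 /\ forall a p q, E p -> E q -> E (a *: p + q).

(** Zorn's lemma on the partial linear maps whose graph lies between [E0] and
    [E]: a maximal one is total, because a vector outside its domain can be sent
    to any value that [E] allows.  Sections of surjections and retractions of
    injections are both instances. *)
Lemma linear_selection (E E0 : set (V * W)) :
  subspace E -> (forall v, exists w, E (v, w)) ->
  subspace E0 -> (E0 `<=` E)%classic -> (forall w, E0 (0, w) -> w = 0) ->
  exists h : {linear V -> W},
    (forall v, E (v, h v)) /\ forall v w, E0 (v, w) -> h v = w.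
Proof.
move=> E_sub E_tot E0_sub E0E E0_fun.
pose good (Y : set (V * W)) :=
  [/\ subspace Y, (Y `<=` E)%classic & forall w, Y (0, w) -> w = 0].
pose P (X : set (V * W)) := good (X `|` E0)%classic.
have [F FP F_tot|A [[[Y0 Y_lin] Y_E Y_fun] A_max]] := @Zorn_bigcup _ P.
  have common p q : (\bigcup_(X in F) X `|` E0)%classic p ->
      (\bigcup_(X in F) X `|` E0)%classic q -> exists Y,
      [/\ good Y, Y p, Y q & (Y `<=` \bigcup_(X in F) X `|` E0)%classic].
    have sub X : F X -> (X `|` E0 `<=` \bigcup_(X in F) X `|` E0)%classic.
      by move=> FX r [Xr|?]; [left; exists X | right].
    move=> [[X FX Xp]|p0] [[X' FX' X'q]|q0].
    - have [XX'|X'X] := F_tot X X' FX FX'.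
        exists (X' `|` E0)%classic; split; [exact: FP | | by left | exact: sub].
        by left; apply: XX'.
      exists (X `|` E0)%classic; split; [exact: FP | by left | | exact: sub].
      by left; apply: X'X.
    - by exists (X `|` E0)%classic; split;
        [exact: FP | left | right | exact: sub].
    - by exists (X' `|` E0)%classic; split;
        [exact: FP | right | left | exact: sub].
    - by exists E0; split=> // r; right.
  split.
  - split=> [|a p q Fp Fq]; first by right; case: E0_sub.
    by have [Y [[[_ Y_lin] _ _] Yp Yq sub]] := common p q Fp Fq;
      apply/sub/Y_lin.
  - by move=> p Fp; have [Y [[_ YE _] Yp _ _]] := common p p Fp Fp; apply: YE.
  - move=> w Fw; have [Y [[_ _ Yf] Yp _ _]] := common _ _ Fw Fw.
    exact: Yf.
have YZ a p : (A `|` E0)%classic p -> (A `|` E0)%classic (a *: p).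
  by move=> Yp; rewrite -[_ *: _]addr0; apply: Y_lin.
have dom v : exists w, (A `|` E0)%classic (v, w).
  apply: contrapT => v_out; have [w Evw] := E_tot v.
  pose Y' (p : V * W) := exists a q,
    (A `|` E0)%classic q /\ p = a *: (v, w) + q.
  have Y_Y' p : (A `|` E0)%classic p -> Y' p.
    by move=> Yp; exists 0, p; rewrite scale0r add0r.
  have Y'_E0 : (Y' `|` E0 = Y')%classic.
    by apply/seteqP; split=> p; [case=> // ?; apply: Y_Y'; right | left].
  apply: (A_max Y').
    rewrite properEneq; split; last by move=> p Ap; apply: Y_Y'; left.
    apply/eqP => AY'; apply: v_out; exists w; left; rewrite AY'.
    by exists 1, 0; rewrite scale1r addr0.
  rewrite /P Y'_E0; split.
  - split=> [|a p q [b [p' [Yp ->]]] [b' [q' [Yq ->]]]]; first exact: Y_Y'.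
    exists (a * b + b'), (a *: p' + q'); split; first exact: Y_lin.
    by rewrite scalerDr scalerA addrACA -scalerDl.
  - move=> p [a [q [Yq ->]]]; case: E_sub => _; apply => //; exact: Y_E.
  - move=> w' [a [[x y] [Yq [e ->]]]]; have [a0|a0] := eqVneq a 0.
      move: e Yq; rewrite a0 !scale0r !add0r => <-; exact: Y_fun.
    case: v_out; exists (- a^-1 *: y).
    have -> : v = - a^-1 *: x.
      apply: (scalerI a0); apply/eqP; rewrite scalerA mulrN divff // scaleN1r.
      by rewrite -addr_eq0 -e.
    exact: YZ Yq.
have [h hP] := choice dom.
have Y_uniq v w w' : (A `|` E0)%classic (v, w) -> (A `|` E0)%classic (v, w') ->
    w = w'.
  move=> Yw Yw'; apply/eqP; rewrite -subr_eq0; apply/eqP/Y_fun.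
  have -> : (0, w - w') = (-1) *: (v, w') + (v, w).
    by congr pair; rewrite /= scaleN1r ?addNr // addrC.
  exact: Y_lin.
have h_lin : linear h.
  move=> a x y; apply: (Y_uniq (a *: x + y)); first exact: hP.
  by apply: (Y_lin a (x, h x) (y, h y)); exact: hP.
have [g gE] := linear_ofP h_lin; exists g; split=> [v|v w E0vw].
  by rewrite gE; apply/Y_E/hP.
by rewrite gE; apply: (Y_uniq v) => //; right.
Qed.

End LinearSelection.

(** The linear selection from the inverse of [g], seen as a relation. *)
Lemma linear_section (K : fieldType) (V W : lmodType K) (g : {linear V -> W}) :
  (forall w, exists v, g v = w) -> exists s : {linear W -> V}, cancel s g.
Proof.
move=> g_surj.
have [|w|||v|s [sE _]] := @linear_selection K W V
    [set p | g p.2 = p.1]%classic [set 0]%classic.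
- split=> [|a p q /= pE qE]; first by rewrite /= linear0.
  by rewrite linearP pE qE.
- by have [v vE] := g_surj w; exists v.
- by split=> // a p q /= -> ->; rewrite scaler0 addr0.
- by move=> p /= ->; rewrite linear0.
- by move=> [].
- by exists s.
Qed.

(** The total relation allows every value, and the inverse of [f] on its image is
    the part that is prescribed. *)
Lemma linear_retraction (K : fieldType) (V W : lmodType K)
    (f : {linear V -> W}) :
  injective f -> exists r : {linear W -> V}, cancel f r.
Proof.
move=> f_inj.
have [|w|||v|r [_ rE]] := @linear_selection K W V
    setT [set p | p.1 = f p.2]%classic.
- by split.
- by exists 0.
- split=> [|a p q /= pE qE]; first by rewrite /= linear0.
  by rewrite linearP pE qE.
- by [].
- by move=> /= /esym; rewrite -{1}(linear0 f) => /f_inj.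
- by exists r => v; apply: rE.
Qed.

Section Projective.

Variable A : nzRingType.

Lemma projective_free1 : projective (A^o : lmodType A).
Proof.
move=> V W g f g_surj; have [x xE] := g_surj (f 1).
have h_lin : linear (fun a : A^o => a *: x).
  by move=> a b c; rewrite scalerDl scalerA.
have [h hE] := linear_ofP h_lin; exists h => a.
by rewrite hE linearZ /= xE -linearZ /= [_ *: _]mulr1.
Qed.

Lemma projective_prod (P Q : lmodType A) :
  projective P -> projective Q -> projective (P * Q)%type.
Proof.
move=> projP projQ V W g f g_surj.
have f1_lin : linear (fun x : P => f (x, 0)).
  move=> a x y; rewrite -linearP; congr (f _).
  by congr pair; rewrite /= scaler0 addr0.
have f2_lin : linear (fun y : Q => f (0, y)).
  move=> a x y; rewrite -linearP; congr (f _).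
  by congr pair; rewrite /= scaler0 addr0.
have [f1 f1E] := linear_ofP f1_lin; have [f2 f2E] := linear_ofP f2_lin.
have [h1 h1E] := projP _ _ g f1 g_surj; have [h2 h2E] := projQ _ _ g f2 g_surj.
have h_lin : linear (fun p : P * Q => h1 p.1 + h2 p.2).
  by move=> a p q; rewrite !linearP scalerDr addrACA.
have [h hE] := linear_ofP h_lin; exists h => -[x y].
rewrite hE linearD h1E h2E f1E f2E -linearD; congr (f _).
by congr pair; rewrite /= ?addr0 ?add0r.
Qed.

Lemma projective_trivial (P : lmodType A) : (forall x : P, x = 0) -> projective P.
Proof.
move=> P0 V W g f _; have [h hE] := linear_ofP (@linear_null A P V).
by exists h => x; rewrite [x]P0 !linear0.
Qed.

End Projective.

(** * Skew polynomial algebras in two variables *)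

Section SkewPolynomials.

Variables (K : fieldType) (A : algType K) (c : K) (u v : A).

Definition mon r s : A := u ^+ r * v ^+ s.

(** The algebra [A] is the skew polynomial ring $\Bbbk_c[u,v]$: the ordered
    monomials are a basis, and [cf a r s] is the coefficient of [mon r s].  The
    expansion holds for every large cutoff [L], so that two elements can be
    expanded with the same one. *)
Record skew_polynomial (cf : A -> nat -> nat -> K) : Prop := SkewPolynomial {
  skew_c_neq0 : c != 0;
  skew_comm : v * u = c *: (u * v);
  skew_cf_linear : forall r s, linear (fun a => cf a r s : K^o);
  skew_cf_mon : forall r s r' s', cf (mon r s) r' s' = ((r == r') && (s == s'))%:R;
  skew_cf_span : forall a, exists N, forall L, (N <= L)%N ->
    a = \sum_(r < L) \sum_(s < L) cf a r s *: mon r s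
}.

Variable cf : A -> nat -> nat -> K.
Hypothesis Acf : skew_polynomial cf.

Let c0 := skew_c_neq0 Acf.

Lemma cf0 r s : cf 0 r s = 0.
Proof.
have [f fE] := linear_ofP (skew_cf_linear Acf r s).
by rewrite -fE linear0.
Qed.

Lemma cfD a b r s : cf (a + b) r s = cf a r s + cf b r s.
Proof.
have [f fE] := linear_ofP (skew_cf_linear Acf r s).
by rewrite -!fE linearD.
Qed.

Lemma cfN a r s : cf (- a) r s = - cf a r s.
Proof.
have [f fE] := linear_ofP (skew_cf_linear Acf r s).
by rewrite -!fE linearN.
Qed.

Lemma cfB a b r s : cf (a - b) r s = cf a r s - cf b r s.
Proof. by rewrite cfD cfN. Qed.

Lemma cfZ d a r s : cf (d *: a) r s = d * cf a r s.
Proof.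
have [f fE] := linear_ofP (skew_cf_linear Acf r s).
by rewrite -!fE linearZ.
Qed.

Lemma cf_sum (I : Type) (l : seq I) (P : pred I) (F : I -> A) r s :
  cf (\sum_(i <- l | P i) F i) r s = \sum_(i <- l | P i) cf (F i) r s.
Proof.
have [f fE] := linear_ofP (skew_cf_linear Acf r s).
by rewrite -fE linear_sum; apply: eq_bigr => i _; rewrite fE.
Qed.

Lemma cf_double_sum L (g : nat -> nat -> K) r s :
  cf (\sum_(r' < L) \sum_(s' < L) g r' s' *: mon r' s') r s =
  if (r < L)%N && (s < L)%N then g r s else 0.
Proof.
rewrite cf_sum; have [rL|Lr] := ltnP r L; last first.
  rewrite big1 // => r' _; rewrite cf_sum big1 // => s' _.
  rewrite cfZ (skew_cf_mon Acf) [_ == r]ltn_eqF ?mulr0 //.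
  exact: leq_trans Lr.
rewrite (bigD1 (Ordinal rL)) //= [X in _ + X]big1 ?addr0 => [|r' rr']; last first.
  rewrite cf_sum big1 // => s' _; rewrite cfZ (skew_cf_mon Acf).
  by rewrite (_ : (r' == r :> nat) = false) ?mulr0 //; apply: negbTE.
rewrite cf_sum; have [sL|Ls] := ltnP s L; last first.
  rewrite big1 // => s' _.
  rewrite cfZ (skew_cf_mon Acf) [_ == s]ltn_eqF ?andbF ?mulr0 //.
  exact: leq_trans Ls.
rewrite (bigD1 (Ordinal sL)) //= [X in _ + X]big1 ?addr0 => [|s' ss']; last first.
  rewrite cfZ (skew_cf_mon Acf).
  by rewrite (_ : (s' == s :> nat) = false) ?andbF ?mulr0 //; apply: negbTE.
by rewrite cfZ (skew_cf_mon Acf) !eqxx mulr1.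
Qed.

Lemma cf_bound a : exists N, forall r s, (N <= r)%N || (N <= s)%N -> cf a r s = 0.
Proof.
have [N aE] := skew_cf_span Acf a; exists N => r s Nrs.
by rewrite (aE N (leqnn N)) cf_double_sum !ltnNge -negb_or Nrs.
Qed.

Lemma cf_inj a b : (forall r s, cf a r s = cf b r s) -> a = b.
Proof.
move=> ab; have [N aE] := skew_cf_span Acf a; have [N' bE] := skew_cf_span Acf b.
rewrite (aE (maxn N N')) ?leq_maxl // (bE (maxn N N')) ?leq_maxr //.
by apply: eq_bigr => r _; apply: eq_bigr => s _; rewrite ab.
Qed.

Lemma cf_build N (g : nat -> nat -> K) :
  (forall r s, (N <= r)%N || (N <= s)%N -> g r s = 0) ->
  exists a, forall r s, cf a r s = g r s.
Proof.
move=> g0; exists (\sum_(r < N) \sum_(s < N) g r s *: mon r s) => r s.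
rewrite cf_double_sum; case: ifP => // /negbT.
by rewrite negb_and -!leqNgt => /g0.
Qed.

(** Induction over the support of [a], for properties that only some monomials
    share, such as homogeneity or invariance. *)
Lemma support_ind a (P : A -> Prop) : P 0 ->
  (forall d a b, P a -> P b -> P (d *: a + b)) ->
  (forall r s, cf a r s != 0 -> P (mon r s)) -> P a.
Proof.
move=> P0 Plin Pmon; have [N /(_ N (leqnn N)) ->] := skew_cf_span Acf a.
have PD x y : P x -> P y -> P (x + y).
  by move=> Px Py; rewrite -[x]scale1r; apply: Plin.
elim/big_ind: _ => // r _; elim/big_ind: _ => // s _.
have [->|/Pmon rs] := eqVneq (cf a r s) 0; first by rewrite scale0r.
by rewrite -[_ *: _]addr0; apply: Plin.
Qed.

Lemma skew_ind (P : A -> Prop) : P 0 ->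
  (forall d a b, P a -> P b -> P (d *: a + b)) -> (forall r s, P (mon r s)) ->
  forall a, P a.
Proof. by move=> P0 Plin Pmon a; apply: support_ind. Qed.

Lemma skew_comm_exp r s : v ^+ s * u ^+ r = c ^+ (s * r) *: (u ^+ r * v ^+ s).
Proof.
have vur k : v * u ^+ k = c ^+ k *: (u ^+ k * v).
  elim: k => [|k IHk]; first by rewrite !expr0 mulr1 mul1r scale1r.
  rewrite exprS mulrA (skew_comm Acf) -scalerAl -[u * v * _]mulrA IHk.
  by rewrite -scalerAr scalerA mulrA -!exprS.
elim: s => [|s IHs]; first by rewrite mul0n !expr0 mulr1 mul1r scale1r.
rewrite exprSr -[LHS]mulrA vur -scalerAr [X in _ *: X = _]mulrA IHs -scalerAl.
by rewrite scalerA -exprD -mulrA -exprSr mulSn.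
Qed.

Lemma monM r s r' s' :
  mon r s * mon r' s' = c ^+ (s * r') *: mon (r + r') (s + s').
Proof.
rewrite /mon mulrA -[_ * u ^+ r']mulrA skew_comm_exp -scalerAr -scalerAl.
by rewrite !exprD !mulrA.
Qed.

Lemma cf1 r s : cf 1 r s = ((0%N == r) && (0%N == s))%:R.
Proof. by rewrite -(skew_cf_mon Acf) /mon !expr0 mulr1. Qed.

Lemma cfMv a l r s :
  cf (a * v ^+ l) r s = if (l <= s)%N then cf a r (s - l) else 0.
Proof.
elim/skew_ind: a => [|d a b IHa IHb|r' s'].
- by rewrite mul0r !cf0 if_same.
- rewrite mulrDl -scalerAl !cfD !cfZ IHa IHb; case: ifP => // _.
  by rewrite mulr0 addr0.
rewrite /mon -mulrA -exprD !(skew_cf_mon Acf); case: leqP => ls.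
  by rewrite -(eqn_add2r l s') subnK.
by rewrite (gtn_eqF (leq_trans ls (leq_addl _ _))) andbF.
Qed.

Lemma cfMu a k r s :
  cf (a * u ^+ k) r s = if (k <= r)%N then c ^+ (s * k) * cf a (r - k) s else 0.
Proof.
elim/skew_ind: a => [|d a b IHa IHb|r' s'].
- by rewrite mul0r !cf0 mulr0 if_same.
- rewrite mulrDl -scalerAl !cfD !cfZ IHa IHb; case: ifP => // _.
    by rewrite mulrDr mulrCA.
  by rewrite mulr0 addr0.
rewrite /mon -mulrA skew_comm_exp -scalerAr mulrA -exprD cfZ !(skew_cf_mon Acf).
case: leqP => kr; last by rewrite (gtn_eqF (leq_trans kr (leq_addl _ _))) mulr0.
rewrite -(eqn_add2r k r') subnK //; case: (s' =P s) => [->//|_].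
by rewrite andbF !mulr0.
Qed.

Lemma cf_uM a k r s :
  cf (u ^+ k * a) r s = if (k <= r)%N then cf a (r - k) s else 0.
Proof.
elim/skew_ind: a => [|d a b IHa IHb|r' s'].
- by rewrite mulr0 !cf0 if_same.
- rewrite mulrDr -scalerAr !cfD !cfZ IHa IHb; case: ifP => // _.
  by rewrite mulr0 addr0.
rewrite /mon mulrA -exprD !(skew_cf_mon Acf); case: leqP => kr.
  by rewrite -(eqn_add2l k r') subnKC.
by rewrite (gtn_eqF (leq_trans kr (leq_addr _ _))).
Qed.

Lemma cf_vM a l r s :
  cf (v ^+ l * a) r s = if (l <= s)%N then c ^+ (l * r) * cf a r (s - l) else 0.
Proof.
elim/skew_ind: a => [|d a b IHa IHb|r' s'].
- by rewrite mulr0 !cf0 mulr0 if_same.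
- rewrite mulrDr -scalerAr !cfD !cfZ IHa IHb; case: ifP => // _.
    by rewrite mulrDr mulrCA.
  by rewrite mulr0 addr0.
rewrite /mon mulrA skew_comm_exp -scalerAl -mulrA -exprD cfZ !(skew_cf_mon Acf).
case: leqP => ls; last first.
  by rewrite (gtn_eqF (leq_trans ls (leq_addr _ _))) andbF mulr0.
rewrite -(eqn_add2l l s') subnKC //; case: (r' =P r) => [->//|_].
by rewrite !mulr0.
Qed.

(** The constant coefficient is the augmentation of the algebra. *)
Lemma cfM00 a b : cf (a * b) 0 0 = cf a 0 0 * cf b 0 0.
Proof.
elim/skew_ind: a => [|d a a' IHa IHb|r s].
- by rewrite mul0r !cf0 mul0r.
- by rewrite mulrDl -scalerAl !cfD !cfZ IHa IHb mulrDl mulrA.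
rewrite /mon -mulrA cf_uM (skew_cf_mon Acf); case: r => [|r] /=; last first.
  by rewrite mul0r.
by rewrite cf_vM; case: s => [|s] /=; rewrite ?mul0r // subn0 mul0n.
Qed.

Lemma divr_v a l : (forall r s, (s < l)%N -> cf a r s = 0) ->
  exists b, a = b * v ^+ l.
Proof.
move=> a0; have [N aN] := cf_bound a.
have [|b bE] := @cf_build N (fun r s => cf a r (s + l)).
  move=> r s /orP[?|?]; apply: aN; first by apply/orP; left.
  by rewrite (leq_trans _ (leq_addr _ _)) ?orbT.
exists b; apply: cf_inj => r s; rewrite cfMv bE; case: leqP => [ls|/a0 //].
by rewrite subnK.
Qed.

Lemma divl_u a k : (forall r s, (r < k)%N -> cf a r s = 0) ->
  exists b, a = u ^+ k * b.
Proof.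
move=> a0; have [N aN] := cf_bound a.
have [|b bE] := @cf_build N (fun r s => cf a (r + k) s).
  move=> r s /orP[?|?]; apply: aN; last by apply/orP; right.
  by rewrite (leq_trans _ (leq_addr _ _)).
exists b; apply: cf_inj => r s; rewrite cf_uM bE; case: leqP => [kr|/a0 //].
by rewrite subnK.
Qed.

Lemma mulIv l : injective (fun a => a * v ^+ l).
Proof.
move=> a b ab; apply: cf_inj => r s; have := congr1 (fun a => cf a r (s + l)) ab.
by rewrite /= !cfMv leq_addl addnK.
Qed.

Lemma muluI k : injective (fun a => u ^+ k * a).
Proof.
move=> a b ab; apply: cf_inj => r s; have := congr1 (fun a => cf a (r + k) s) ab.
by rewrite /= !cf_uM leq_addl addnK.
Qed.

(** The only left syzygies of [u ^+ k] and [v ^+ l] come from their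
    commutation relation: the first coefficient is divisible by [v ^+ l],
    because its monomials with a smaller power of [v] have nothing to cancel
    against. *)
Lemma left_syzygy k l a b : a * u ^+ k + b * v ^+ l = 0 ->
  exists g, a = g * v ^+ l /\ b = - (c ^+ (l * k) *: (g * u ^+ k)).
Proof.
move=> ab0; have [r s sl|g aE] := @divr_v a l.
  have := congr1 (fun a => cf a (r + k) s) ab0.
  rewrite /= cf0 cfD cfMu cfMv leq_addl addnK leqNgt sl addr0 => /eqP.
  by rewrite mulf_eq0 expf_eq0 (negbTE c0) andbF => /eqP.
exists g; split=> //; apply: (@mulIv l); apply: (addrI (a * u ^+ k)).
rewrite ab0 aE -mulrA skew_comm_exp -scalerAr mulNr -scalerAl.
by rewrite mulrA subrr.
Qed.

(** The mirror image of [left_syzygy] in degree one, which is what the vanishing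
    of $\mathrm{Ext}^1$ comes down to. *)
Lemma right_syzygy a b : v * a = c *: (u * b) ->
  exists g, a = u * g /\ b = v * g.
Proof.
move=> ab; have [r s|g aE] := @divl_u a 1.
  case: r => // _; have := congr1 (fun a => cf a 0 s.+1) ab.
  rewrite /= cfZ -[u]expr1 -[v]expr1 cf_uM mulr0 cf_vM /= subn1 muln0 expr0.
  by rewrite mul1r.
rewrite expr1 in aE; exists g; split=> //.
apply: (@muluI 1); apply: (scalerI c0).
by rewrite expr1 -ab aE !mulrA (skew_comm Acf) -scalerAl.
Qed.

(** Up to a scalar the coefficient of [a] at $(r,s)$ equals the one at
    $(r-k,s+l)$, and the first exponent cannot decrease forever. *)
Lemma mulI_add d k l a : (0 < k)%N ->
  a * (d *: u ^+ k + v ^+ l) = 0 -> a = 0.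
Proof.
move=> k0; rewrite mulrDr -scalerAr => a0; apply: cf_inj => r s; rewrite cf0.
elim/ltn_ind: r s => r IHr s.
have := congr1 (fun a => cf a r (s + l)) a0.
rewrite /= cf0 cfD cfZ cfMu cfMv leq_addl addnK; case: leqP => [kr|_].
  by rewrite IHr ?mulr0 ?add0r // ltn_subrL k0 (leq_trans k0 kr).
by rewrite mulr0 add0r.
Qed.

End SkewPolynomials.

(** Existence of the expansion follows from an induction principle: the set of
    elements that have one is a subspace containing the ordered monomials. *)
Lemma skew_polynomial_of_ind (K : fieldType) (A : algType K) (c : K) (u v : A)
    (cf : A -> nat -> nat -> K) :
  c != 0 -> v * u = c *: (u * v) -> (forall r s, linear (fun a => cf a r s : K^o)) ->
  (forall r s r' s', cf (mon u v r s) r' s' = ((r == r') && (s == s'))%:R) ->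
  (forall P : A -> Prop, P 0 -> (forall d a b, P a -> P b -> P (d *: a + b)) ->
    (forall r s, P (mon u v r s)) -> forall a, P a) ->
  skew_polynomial c u v cf.
Proof.
move=> c0 vu cf_lin cf_mon ind; split=> //.
have cfD a b r s : cf (a + b) r s = cf a r s + cf b r s.
  by have := cf_lin r s 1 a b; rewrite !scale1r.
have cf0 r s : cf 0 r s = 0 by apply: (addrI (cf 0 r s)); rewrite -cfD !addr0.
have cfZ d a r s : cf (d *: a) r s = d * cf a r s.
  by have := cf_lin r s d a 0; rewrite !addr0 cf0 addr0.
elim/ind => [|d a b [N IHa] [N' IHb]|p q].
- exists 0%N => L _; rewrite big1 => [|r _] //.
  by rewrite big1 // => s _; rewrite cf0 scale0r.
- exists (maxn N N') => L; rewrite geq_max => /andP[/IHa aE /IHb bE].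
  rewrite {1}aE {1}bE scaler_sumr -big_split; apply: eq_bigr => r _.
  rewrite /= scaler_sumr -big_split; apply: eq_bigr => s _.
  by rewrite /= cfD cfZ scalerDl scalerA.
exists (maxn p q).+1 => L; rewrite gtn_max => /andP[pL qL].
rewrite (bigD1 (Ordinal pL)) //= (bigD1 (Ordinal qL)) //= cf_mon !eqxx scale1r.
rewrite [X in _ + X + _]big1 ?[X in _ + X]big1 ?addr0 // => [r rp|s sq].
  rewrite big1 // => s _; rewrite cf_mon [p == r]eq_sym.
  by rewrite (_ : (r == p :> nat) = false) ?scale0r //; apply: negbTE.
rewrite cf_mon [q == s]eq_sym.
by rewrite (_ : (s == q :> nat) = false) ?andbF ?scale0r //; apply: negbTE.
Qed.

(** * Global dimension of a skew polynomial algebra *)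

Section ShortResolution.

Variables (A : nzRingType) (M W0 W1 W2 : lmodType A).
Variables (aug : {linear W0 -> M}) (d0 : {linear W1 -> W0}) (d1 : {linear W2 -> W1}).
Hypotheses (proj0 : projective W0) (proj1 : projective W1) (proj2 : projective W2).
Hypothesis aug_surj : forall m, exists x, aug x = m.
Hypothesis exact0 : forall x, aug x = 0 <-> exists y, x = d0 y.
Hypothesis exact1 : forall x, d0 x = 0 <-> exists y, x = d1 y.
Hypothesis d1_inj : forall x, d1 x = 0 -> x = 0.

(* ['rV[A]_0] is the zero module. *)
Definition short_mod (k : nat) : lmodType A :=
  match k with 0 => W0 | 1 => W1 | 2 => W2 | _ => 'rV[A]_0 end%N.

Lemma short_mod0 k (x : short_mod k.+3) : x = 0.
Proof. exact: thinmx0. Qed.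

Definition short_d (k : nat) : {linear short_mod k.+1 -> short_mod k} :=
  match k return {linear short_mod k.+1 -> short_mod k} with
  | 0 => d0 | 1 => d1 | k'.+2 => \0 : {linear short_mod k'.+3 -> short_mod k'.+2}
  end%N.

Lemma short_projective k : projective (short_mod k).
Proof.
by move: k => [|[|[|k]]] //; apply: projective_trivial; apply: short_mod0.
Qed.

Lemma short_exact k (x : short_mod k.+1) :
  short_d k x = 0 <-> exists y, x = short_d k.+1 y.
Proof.
move: k x => [|[|k]] x; first exact: exact1.
  by split=> [/d1_inj ->|[y ->]]; [exists 0 | rewrite linear0].
by rewrite [x]short_mod0; split=> _; [exists 0; rewrite linear0 | rewrite linear0].
Qed.

Definition short_resolution : resolution M :=
  @Resolution A M short_mod short_d aug short_projective aug_surj exact0 short_exact.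

End ShortResolution.

Section Induced.

Variables (K : fieldType) (A : algType K) (c : K) (u v : A).
Variable cf : A -> nat -> nat -> K.
Hypothesis Acf : skew_polynomial c u v cf.
Variable M : lmodType A.

Local Notation mon := (mon u v).

Lemma linear_generators (X Y : lmodType A) (f : X -> Y) :
  (forall x y, f (x + y) = f x + f y) -> (forall d x, f (d%:A *: x) = d%:A *: f x) ->
  (forall x, f (u *: x) = u *: f x) -> (forall x, f (v *: x) = v *: f x) ->
  linear f.
Proof.
move=> fD fK fu fv a x y; rewrite fD; congr (_ + _).
have f0 : f 0 = 0 by rewrite -(scale0r 0) -(scale0r 1) fK !scale0r.
elim/(skew_ind Acf): a x => [|d a b IHa IHb|r s] x.
- by rewrite !scale0r f0.
- rewrite scalerDl fD IHb -mulr_algl -!scalerA fK IHa.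
  by rewrite scalerA -scalerDl mulr_algl.
rewrite /mon -!scalerA; have fvs z : f (v ^+ s *: z) = v ^+ s *: f z.
  elim: s z => [|s IHs] z; first by rewrite !scale1r.
  by rewrite exprS -!scalerA fv IHs.
elim: r => [|r IHr]; first by rewrite !scale1r fvs.
by rewrite exprS -!scalerA fu IHr.
Qed.

(** The module $A\otimes_\Bbbk M$, an element of which is recorded by its
    coefficients in $M$ along the ordered monomials.  The structure of [A] is a
    parameter of the type because the scaling depends on it. *)
Definition fin_supp : {pred nat -> nat -> M} :=
  fun f => `[< exists N, forall r s, (N <= r + s)%N -> f r s = 0 >].

Record induced_module (p : skew_polynomial c u v cf) : predArgType :=
  Induced { induced_val :> nat -> nat -> M; _ : induced_val \in fin_supp }.

Local Notation W := (induced_module Acf).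
HB.instance Definition _ := [isSub for @induced_val Acf].
HB.instance Definition _ := [Choice of W by <:].

Lemma induced_supp (w : W) : exists N, forall r s, (N <= r + s)%N -> w r s = 0.
Proof. by case: w => f fP; apply/asboolP. Qed.

Lemma inducedP (w w' : W) : (forall r s, w r s = w' r s) -> w = w'.
Proof. by move=> ww'; apply/val_inj/funext => r; apply/funext => s; apply: ww'. Qed.

Lemma induced0_subproof : (fun _ _ => 0) \in fin_supp.
Proof. by apply/asboolP; exists 0%N. Qed.

Lemma inducedN_subproof (w : W) : (fun r s => - w r s) \in fin_supp.
Proof.
have [N wN] := induced_supp w; apply/asboolP.
by exists N => r s Nrs; rewrite wN ?oppr0.
Qed.

Lemma inducedD_subproof (w w' : W) : (fun r s => w r s + w' r s) \in fin_supp.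
Proof.
have [N wN] := induced_supp w; have [N' wN'] := induced_supp w'.
apply/asboolP; exists (maxn N N') => r s; rewrite geq_max => /andP[? ?].
by rewrite wN // wN' // addr0.
Qed.

Definition induced_zero : W := Induced Acf induced0_subproof.
Definition induced_opp (w : W) : W := Induced Acf (inducedN_subproof w).
Definition induced_add (w w' : W) : W := Induced Acf (inducedD_subproof w w').

Lemma induced_addA : associative induced_add.
Proof. by move=> w w' w''; apply: inducedP => r s; rewrite /= addrA. Qed.

Lemma induced_addC : commutative induced_add.
Proof. by move=> w w'; apply: inducedP => r s; rewrite /= addrC. Qed.

Lemma induced_add0 : left_id induced_zero induced_add.
Proof. by move=> w; apply: inducedP => r s; rewrite /= add0r. Qed.

Lemma induced_addN : left_inverse induced_zero induced_opp induced_add.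
Proof. by move=> w; apply: inducedP => r s; rewrite /= addNr. Qed.

HB.instance Definition _ := GRing.isZmodule.Build W
  induced_addA induced_addC induced_add0 induced_addN.

Lemma inducedD (w w' : W) r s : (w + w') r s = w r s + w' r s.
Proof. by []. Qed.

Lemma inducedB (w w' : W) r s : (w - w') r s = w r s - w' r s.
Proof. by []. Qed.

Lemma induced_build (f : nat -> nat -> M) N :
  (forall r s, (N <= r + s)%N -> f r s = 0) ->
  exists w : W, forall r s, w r s = f r s.
Proof.
by move=> f0; have fP : f \in fin_supp; [apply/asboolP; exists N | exists (Induced Acf fP)].
Qed.

(** The factor [c ^+ (s' * (r - r'))] comes from moving $v^{s'}$ to the right of
    $u^{r-r'}$. *)
Definition induced_act (a : A) (f : nat -> nat -> M) r s : M :=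
  \sum_(r' < r.+1) \sum_(s' < s.+1)
    (cf a r' s' * c ^+ (s' * (r - r')))%:A *: f (r - r')%N (s - s')%N.

Lemma induced_actDl d a b f r s :
  induced_act (d *: a + b) f r s = d%:A *: induced_act a f r s + induced_act b f r s.
Proof.
rewrite /induced_act scaler_sumr -big_split; apply: eq_bigr => r' _ /=.
rewrite scaler_sumr -big_split; apply: eq_bigr => s' _ /=.
rewrite (cfD Acf) (cfZ Acf) scalerA -scalerDl mulr_algl scalerA -scalerDl.
by rewrite mulrDl mulrA.
Qed.

Lemma induced_act0l f r s : induced_act 0 f r s = 0.
Proof.
rewrite /induced_act big1 // => r' _; rewrite big1 // => s' _.
by rewrite (cf0 Acf) mul0r !scale0r.
Qed.

Lemma induced_actZ d a f r s :
  induced_act (d *: a) f r s = d%:A *: induced_act a f r s.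
Proof. by rewrite -[d *: a]addr0 induced_actDl induced_act0l addr0. Qed.

Lemma induced_act_mon r0 s0 f r s : induced_act (mon r0 s0) f r s =
  if (r0 <= r)%N && (s0 <= s)%N
  then (c ^+ (s0 * (r - r0)))%:A *: f (r - r0)%N (s - s0)%N else 0.
Proof.
rewrite /induced_act; case: (leqP r0 r) => [r0r|r_r0] /=; last first.
  rewrite big1 // => r' _; rewrite big1 // => s' _; rewrite (skew_cf_mon Acf).
  rewrite (gtn_eqF (leq_trans (ltn_ord r') r_r0)) mul0r !scale0r //.
have r0r' : (r0 < r.+1)%N by [].
rewrite (bigD1 (Ordinal r0r')) //= [X in _ + X]big1 ?addr0 => [|r' rr']; last first.
  rewrite big1 // => s' _; rewrite (skew_cf_mon Acf) [r0 == r']eq_sym.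
  by rewrite (_ : (r' == r0 :> nat) = false) ?mul0r ?scale0r //; apply: negbTE.
case: (leqP s0 s) => [s0s|s_s0] /=; last first.
  rewrite big1 // => s' _; rewrite (skew_cf_mon Acf).
  by rewrite (gtn_eqF (leq_trans (ltn_ord s') s_s0)) andbF mul0r !scale0r.
have s0s' : (s0 < s.+1)%N by [].
rewrite (bigD1 (Ordinal s0s')) //= [X in _ + X]big1 ?addr0 => [|s' ss']; last first.
  rewrite (skew_cf_mon Acf) [s0 == s']eq_sym.
  rewrite (_ : (s' == s0 :> nat) = false) ?andbF ?mul0r ?scale0r //.
  exact: negbTE.
by rewrite (skew_cf_mon Acf) !eqxx mul1r.
Qed.

Lemma induced_act_supp a f : f \in fin_supp -> induced_act a f \in fin_supp.
Proof.
move=> fP; elim/(skew_ind Acf): a => [|d a b IHa IHb|r0 s0].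
- by apply/asboolP; exists 0%N => r s _; rewrite induced_act0l.
- move: IHa IHb => /asboolP[N aN] /asboolP[N' bN'].
  apply/asboolP; exists (maxn N N') => r s; rewrite geq_max => /andP[? ?].
  by rewrite induced_actDl aN // bN' // scaler0 addr0.
move/asboolP: fP => [N fN]; apply/asboolP; exists (N + r0 + s0)%N => r s Nrs.
rewrite induced_act_mon; case: ifP => // /andP[r0r s0s].
by rewrite fN ?scaler0 // -(leq_add2r (r0 + s0)) addnACA !subnK // addnA.
Qed.

Definition induced_scale (a : A) (w : W) : W :=
  Induced Acf (induced_act_supp a (valP w)).

Lemma induced_scaleA a b w :
  induced_scale a (induced_scale b w) = induced_scale (a * b) w.
Proof.
apply: inducedP => r s /=; elim/(skew_ind Acf): a => [|d a a' IHa IHa'|r0 s0].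
- by rewrite mul0r !induced_act0l.
- by rewrite mulrDl -scalerAl !induced_actDl IHa IHa'.
rewrite induced_act_mon.
elim/(skew_ind Acf): b => [|d b b' IHb IHb'|r1 s1].
- by rewrite mulr0 !induced_act0l scaler0 if_same.
- rewrite mulrDr -scalerAr !induced_actDl -IHb -IHb'; case: ifP => // _.
    rewrite scalerDr; congr (_ + _).
    by rewrite !scalerA mulr_algl mulr_algr.
  by rewrite scaler0 addr0.
rewrite (monM Acf) induced_actZ.
rewrite !induced_act_mon; case: leqP => r0r /=; last first.
  by rewrite leqNgt (leq_trans r0r) ?leq_addr //= scaler0.
case: leqP => s0s /=; last first.
  by rewrite [X in _ && X]leqNgt (leq_trans s0s) ?leq_addr ?andbF //= scaler0.
rewrite -(leq_add2l r0 r1) -(leq_add2l s0 s1) !subnKC //.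
case: ifP => [/andP[le_r le_s]|_]; last by rewrite !scaler0.
rewrite !subnDA !scalerA !mulr_algl !scalerA -!exprD; congr ((_ ^+ _)%:A *: _).
rewrite mulnDl addnA -mulnDr; congr (s0 * _ + _)%N.
by rewrite subnKC // -(leq_add2l r0) subnKC.
Qed.

Lemma induced_scale1 : left_id 1 induced_scale.
Proof.
move=> w; apply: inducedP => r s /=.
have -> : 1 = mon 0 0 :> A by rewrite /mon !expr0 mulr1.
by rewrite induced_act_mon /= mul0n expr0 !scale1r !subn0.
Qed.

Lemma induced_scaleDr : right_distributive induced_scale +%R.
Proof.
move=> a w w'; apply: inducedP => r s /=.
rewrite /induced_act -big_split; apply: eq_bigr => r' _ /=.
by rewrite -big_split; apply: eq_bigr => s' _ /=; rewrite -scalerDr.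
Qed.

Lemma induced_scaleDl w : {morph induced_scale^~ w : a b / a + b}.
Proof.
move=> a b; apply: inducedP => r s /=.
by rewrite -{1}[a]scale1r induced_actDl scale1r scale1r.
Qed.

HB.instance Definition _ := GRing.Zmodule_isLmodule.Build A W
  induced_scaleA induced_scale1 induced_scaleDr induced_scaleDl.

Lemma induced_uE w r s : ((u *: w : W) r s) = if r is r'.+1 then w r' s else 0.
Proof.
have -> : u = mon 1 0 by rewrite /mon expr1 expr0 mulr1.
rewrite [LHS]induced_act_mon; case: r => [|r] //=.
by rewrite mul0n expr0 !scale1r subn1 subn0.
Qed.

Lemma induced_vE w r s :
  ((v *: w : W) r s) = if s is s'.+1 then (c ^+ r)%:A *: w r s' else 0.
Proof.
have -> : v = mon 0 1 by rewrite /mon expr1 expr0 mul1r.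
rewrite [LHS]induced_act_mon; case: s => [|s] //=.
by rewrite mul1n subn0 subn1.
Qed.

Lemma induced_KE d w r s : ((d%:A *: w : W) r s) = d%:A *: w r s.
Proof.
rewrite [LHS]induced_actZ; congr (_ *: _).
have -> : 1 = mon 0 0 :> A by rewrite /mon !expr0 mulr1.
by rewrite induced_act_mon /= mul0n expr0 !scale1r !subn0.
Qed.

Lemma induced_linear (f : (nat -> nat -> M) -> nat -> nat -> M) :
  (forall w : W, exists N, forall r s, (N <= r + s)%N -> f w r s = 0) ->
  (forall (w w' : W) r s, f (w + w') r s = f w r s + f w' r s) ->
  (forall d (w : W) r s, f (d%:A *: w) r s = d%:A *: f w r s) ->
  (forall (w : W) r s, f (u *: w) r s = if r is r'.+1 then f w r' s else 0) ->
  (forall (w : W) r s,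
    f (v *: w) r s = if s is s'.+1 then (c ^+ r)%:A *: f w r s' else 0) ->
  exists g : {linear W -> W}, forall w r s, g w r s = f w r s.
Proof.
move=> f_supp fD fK fu fv.
have ex (w : W) : exists w' : W, forall r s, w' r s = f w r s.
  by have [N fN] := f_supp w; apply: induced_build fN.
have [g gE] := choice ex.
have g_lin : linear g.
  apply: linear_generators => [w w'|d w|w|w]; apply: inducedP => r s.
  - by rewrite inducedD !gE fD.
  - by rewrite induced_KE !gE fK.
  - by rewrite induced_uE gE fu; case: r => // r; rewrite gE.
  - by rewrite induced_vE gE fv; case: s => // s; rewrite gE.
by have [h hE] := linear_ofP g_lin; exists h => w r s; rewrite hE gE.
Qed.

Lemma scalar_comm d (a : A) (m : M) : a *: (d%:A *: m) = d%:A *: (a *: m).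
Proof. by rewrite !scalerA mulr_algl mulr_algr. Qed.

(** Right multiplication by [u] on the first tensor factor, where [u] moves past
    $v^s$. *)
Lemma induced_push_u : exists g : {linear W -> W}, forall w r s,
  g w r s = if r is r'.+1 then (c ^+ s)%:A *: w r' s else 0.
Proof.
apply: (@induced_linear
  (fun w r s => if r is r'.+1 then (c ^+ s)%:A *: w r' s else 0)).
- move=> w; have [N wN] := induced_supp w; exists N.+1 => -[|r] s // Nrs.
  by rewrite wN ?scaler0.
- by move=> w w' [|r] s; rewrite ?addr0 //= scalerDr.
- by move=> d w [|r] s; rewrite ?scaler0 // induced_KE scalar_comm.
- by move=> w [|r] s //; rewrite induced_uE; case: r => [|r]; rewrite ?scaler0.
- move=> w r [|s]; first by case: r => [|r] //; rewrite induced_vE scaler0.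
  case: r => [|r]; first by rewrite scaler0.
  by rewrite induced_vE !scalerA !mulr_algl !scalerA -!exprD addSn addnC.
Qed.

(** Right multiplication by [v] on the first tensor factor. *)
Lemma induced_push_v : exists g : {linear W -> W}, forall w r s,
  g w r s = if s is s'.+1 then w r s' else 0.
Proof.
apply: (@induced_linear (fun w r s => if s is s'.+1 then w r s' else 0)).
- move=> w; have [N wN] := induced_supp w; exists N.+1 => r [|s] // Nrs.
  by rewrite wN // -ltnS -addnS.
- by move=> w w' r [|s]; rewrite ?addr0.
- by move=> d w r [|s]; rewrite ?scaler0 // induced_KE.
- by move=> w r [|s]; rewrite ?induced_uE; case: r.
- by move=> w r [|s] //; rewrite induced_vE; case: s => [|s]; rewrite ?scaler0.
Qed.

(** [a] acts on the second tensor factor, and hence commutes with the action of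
    [A] on the first. *)
Lemma induced_inner (a : A) : exists g : {linear W -> W}, forall w r s,
  g w r s = a *: w r s.
Proof.
apply: (@induced_linear (fun w r s => a *: w r s)).
- move=> w; have [N wN] := induced_supp w; exists N => r s Nrs.
  by rewrite wN ?scaler0.
- by move=> w w' r s; rewrite inducedD scalerDr.
- by move=> d w r s; rewrite induced_KE scalar_comm.
- by move=> w [|r] s; rewrite induced_uE ?scaler0.
- by move=> w r [|s]; rewrite induced_vE ?scaler0 // scalar_comm.
Qed.

Lemma induced_unit_exists (m : M) : exists w : W, forall r s,
  w r s = if (r == 0%N) && (s == 0%N) then m else 0.
Proof.
apply: (@induced_build (fun r s => if (r == 0%N) && (s == 0%N) then m else 0) 1).
by move=> [|r] [|s].
Qed.

(** The element $1\otimes m$. *)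
Definition induced_unit (m : M) : W := projT1 (cid (induced_unit_exists m)).

Lemma induced_unitE m r s :
  induced_unit m r s = if (r == 0%N) && (s == 0%N) then m else 0.
Proof. by rewrite /induced_unit; case: cid. Qed.

Lemma induced_act_mon_unit r0 s0 m r s :
  induced_act (mon r0 s0) (induced_unit m) r s =
  if (r == r0) && (s == s0) then m else 0.
Proof.
rewrite induced_act_mon; case: (ltngtP r0 r) => [lt_r|//|<-{r}] /=.
  by rewrite induced_unitE subn_eq0 [(r <= r0)%N]leqNgt lt_r /= scaler0 if_same.
case: (ltngtP s0 s) => [lt_s|//|<-{s}] /=.
  by rewrite induced_unitE [X in _ && X]subn_eq0 [(s <= s0)%N]leqNgt lt_s andbF scaler0.
by rewrite !subnn muln0 expr0 !scale1r induced_unitE.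
Qed.

Lemma induced_sum (I : Type) (l : seq I) (P : pred I) (F : I -> W) r s :
  (\sum_(i <- l | P i) F i) r s = \sum_(i <- l | P i) F i r s.
Proof. by elim/big_rec2: _ => // i x y _ <-; rewrite inducedD. Qed.

Lemma induced_span (w : W) : exists N, forall L, (N <= L)%N ->
  w = \sum_(r < L) \sum_(s < L) mon r s *: induced_unit (w r s).
Proof.
have [N wN] := induced_supp w; exists N => L NL.
apply: inducedP => r s; rewrite induced_sum.
have [rL|Lr] := ltnP r L; last first.
  rewrite wN ?(leq_trans NL) ?(leq_trans Lr) ?leq_addr // big1 // => r' _.
  rewrite induced_sum big1 // => s' _; rewrite [LHS]induced_act_mon_unit.
  by rewrite gtn_eqF // (leq_trans _ Lr).
rewrite (bigD1 (Ordinal rL)) //= [X in _ + X]big1 ?addr0 => [|r' rr']; last first.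
  rewrite induced_sum big1 // => s' _; rewrite [LHS]induced_act_mon_unit eq_sym.
  by rewrite (_ : (r' == r :> nat) = false) //; apply: negbTE.
rewrite induced_sum; have [sL|Ls] := ltnP s L; last first.
  rewrite wN ?(leq_trans NL) ?(leq_trans Ls) ?leq_addl // big1 // => s' _.
  rewrite [LHS]induced_act_mon_unit; case: ifP => // /andP[_ /eqP ss'].
  by have := ltn_ord s'; rewrite -ss' ltnNge Ls.
rewrite (bigD1 (Ordinal sL)) //= [X in _ + X]big1 ?addr0 => [|s' ss']; last first.
  rewrite [LHS]induced_act_mon_unit [s == s']eq_sym.
  by rewrite (_ : (s' == s :> nat) = false) ?andbF //; apply: negbTE.
by rewrite induced_act_mon_unit !eqxx.
Qed.

Lemma induced_ext (X : lmodType A) (h h' : {linear W -> X}) :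
  (forall m, h (induced_unit m) = h' (induced_unit m)) -> forall w, h w = h' w.
Proof.
move=> hh' w; have [N /(_ N (leqnn N)) ->] := induced_span w.
rewrite !linear_sum; apply: eq_bigr => r _; rewrite !linear_sum.
by apply: eq_bigr => s _; rewrite !linearZ hh'.
Qed.

(** The universal property of $A\otimes_\Bbbk M$: the map sends $u^rv^s\otimes m$ to
    $u^rv^sf(m)$. *)
Lemma induced_universal (X : lmodType A) (f : M -> X) :
  (forall x y, f (x + y) = f x + f y) -> (forall d x, f (d%:A *: x) = d%:A *: f x) ->
  exists h : {linear W -> X}, forall m, h (induced_unit m) = f m.
Proof.
move=> fD fK.
have f0 : f 0 = 0 by apply: (addrI (f 0)); rewrite -fD !addr0.
pose S L (w : W) : X := \sum_(r < L) \sum_(s < L) mon r s *: f (w r s).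
have S_widen N L (w : W) : (N <= L)%N -> (forall r s, (N <= r + s)%N -> w r s = 0) ->
    S L w = S N w.
  move=> NL wN; rewrite /S [RHS](big_ord_widen L
    (fun r => \sum_(s < N) mon r s *: f (w r s)) NL).
  rewrite [LHS](bigID (fun r : 'I_L => (r < N)%N)) /= [X in _ + X]big1 ?addr0.
    apply: eq_bigr => r _; rewrite (big_ord_widen L (fun s => mon r s *: f (w r s)) NL).
    rewrite [LHS](bigID (fun s : 'I_L => (s < N)%N)) /= [X in _ + X]big1 ?addr0 //.
    move=> s; rewrite -leqNgt => Ns.
    by rewrite wN ?f0 ?scaler0 // (leq_trans Ns) ?leq_addl.
  move=> r; rewrite -leqNgt => Nr; rewrite big1 // => s _.
  by rewrite wN ?f0 ?scaler0 // (leq_trans Nr) ?leq_addr.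
have ex (w : W) : exists x, exists N, forall L, (N <= L)%N -> x = S L w.
  have [N wN] := induced_supp w; exists (S N w), N => L NL.
  by rewrite (S_widen N).
have [h hE] := choice ex.
have h_lin : linear h.
  apply: linear_generators => [w w'|d w|w|w].
  - have [N1 h1] := hE w; have [N2 h2] := hE w'; have [N3 h3] := hE (w + w').
    pose L := maxn (maxn N1 N2) N3.
    rewrite (h1 L) ?(h2 L) ?(h3 L) /L ?leq_max ?leqnn ?orbT //.
    rewrite /S -big_split; apply: eq_bigr => r _; rewrite -big_split.
    by apply: eq_bigr => s _; rewrite /= -scalerDr -fD.
  - have [N1 h1] := hE w; have [N2 h2] := hE (d%:A *: w).
    pose L := maxn N1 N2; rewrite (h1 L) ?(h2 L) /L ?leq_max ?leqnn ?orbT //.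
    rewrite /S scaler_sumr; apply: eq_bigr => r _; rewrite scaler_sumr.
    apply: eq_bigr => s _; rewrite induced_KE fK !scalerA.
    by rewrite mulr_algl mulr_algr.
  - have [N1 h1] := hE w; have [N2 h2] := hE (u *: w); have [N wN] := induced_supp w.
    pose L := maxn (maxn N1 N2) N.
    rewrite (h2 L.+1) ?(h1 L.+1) ?leqW /L ?leq_max ?leqnn ?orbT // -/L.
    have wL r s : (L <= r + s)%N -> w r s = 0.
      by move=> Lrs; apply/wN/(leq_trans _ Lrs); rewrite leq_max leqnn orbT.
    rewrite (S_widen L L.+1 w) //.
    rewrite /S big_ord_recl /= [X in X + _]big1 ?add0r => [|s _]; last first.
      by rewrite [induced_act u w _ _]induced_uE f0 scaler0.
    rewrite scaler_sumr; apply: eq_bigr => r _; rewrite scaler_sumr big_ord_recr /=.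
    rewrite [induced_act u w _ _]induced_uE /= wL ?leq_addl // f0 scaler0 addr0.
    by apply: eq_bigr => s _; rewrite [induced_act u w _ _]induced_uE scalerA /mon exprS mulrA.
  - have [N1 h1] := hE w; have [N2 h2] := hE (v *: w); have [N wN] := induced_supp w.
    pose L := maxn (maxn N1 N2) N.
    rewrite (h2 L.+1) ?(h1 L.+1) ?leqW /L ?leq_max ?leqnn ?orbT // -/L.
    have wL r s : (L <= r + s)%N -> w r s = 0.
      by move=> Lrs; apply/wN/(leq_trans _ Lrs); rewrite leq_max leqnn orbT.
    rewrite (S_widen L L.+1 w) //.
    rewrite /S scaler_sumr big_ord_recr /= [X in _ + X]big1 ?addr0 => [|s _]; last first.
      rewrite [induced_act v w _ _]induced_vE; case: (nat_of_ord s) => [|s']; rewrite ?f0 ?scaler0 //.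
      by rewrite wL ?leq_addr // scaler0 f0 scaler0.
    apply: eq_bigr => r _; rewrite scaler_sumr big_ord_recl /= [induced_act v w _ _]induced_vE f0 scaler0 add0r.
    apply: eq_bigr => s _; rewrite [induced_act v w _ _]induced_vE fK !scalerA; congr (_ *: _).
    rewrite mulr_algr /mon mulrA -[in RHS](expr1 v) (skew_comm_exp Acf) mul1n.
    by rewrite expr1 -scalerAl -mulrA -exprS.
have [h' h'E] := linear_ofP h_lin; exists h' => m; rewrite h'E.
have [N hN] := hE (induced_unit m); rewrite (hN N.+1) ?leqW //.
rewrite (S_widen 1%N) //; last by move=> [|r] [|s]; rewrite induced_unitE.
by rewrite /S !big_ord1 induced_unitE /mon !expr0 mulr1 scale1r.
Qed.

End Induced.

Section Restriction.

Variables (K : fieldType) (A : algType K) (X : lmodType A).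

(** Restriction of scalars to the base field. *)
Definition restriction : Type := X.
HB.instance Definition _ := GRing.Zmodule.on restriction.

Definition restriction_scale (d : K) (x : restriction) : restriction :=
  d%:A *: (x : X).

Lemma restriction_scaleA d e x :
  restriction_scale d (restriction_scale e x) = restriction_scale (d * e) x.
Proof. by rewrite /restriction_scale scalerA mulr_algl scalerA. Qed.

Lemma restriction_scale1 : left_id 1 restriction_scale.
Proof. by move=> x; rewrite /restriction_scale !scale1r. Qed.

Lemma restriction_scaleDr : right_distributive restriction_scale +%R.
Proof. by move=> d x y; rewrite /restriction_scale -scalerDr. Qed.

Lemma restriction_scaleDl x : {morph restriction_scale^~ x : d e / d + e}.
Proof. by move=> d e; rewrite /restriction_scale scalerDl scalerDl. Qed.

HB.instance Definition _ := GRing.Zmodule_isLmodule.Build K restriction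
  restriction_scaleA restriction_scale1 restriction_scaleDr restriction_scaleDl.

End Restriction.

Lemma restriction_linear (K : fieldType) (A : algType K) (X Y : lmodType A)
    (g : {linear X -> Y}) : exists g' : {linear restriction X -> restriction Y},
  forall x : X, g' x = g x.
Proof.
have g_lin : linear (g : restriction X -> restriction Y).
  by move=> d x y; rewrite [LHS]linearP.
by have [g' g'E] := linear_ofP g_lin; exists g'.
Qed.

Lemma scalar_section (K : fieldType) (A : algType K) (X Y : lmodType A)
    (g : {linear X -> Y}) : (forall y, exists x, g x = y) ->
  exists s : Y -> X, [/\ forall x y, s (x + y) = s x + s y,
    forall d x, s (d%:A *: x) = d%:A *: s x & cancel s g].
Proof.
move=> g_surj; have [g' g'E] := restriction_linear g.
have [y|s sK] := @linear_section K (restriction X) (restriction Y) g'.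
  by have [x <-] := g_surj y; exists x; apply: g'E.
exists s; split=> [x y|d x|y]; [exact: (linearD s) | exact: (linearZ_LR s d x) |].
by rewrite -g'E; apply: sK.
Qed.

Section GlobalDimension.

Variables (K : fieldType) (A : algType K) (c : K) (u v : A).
Variable cf : A -> nat -> nat -> K.
Hypothesis Acf : skew_polynomial c u v cf.

(** A map out of $A\otimes_\Bbbk M$ is determined by a $\Bbbk$-linear map out of
    $M$, and $\Bbbk$-linear maps lift along surjections. *)
Lemma induced_projective (M : lmodType A) : projective (induced_module M Acf).
Proof.
move=> X Y g f g_surj; have [s [sD sK gs]] := scalar_section g_surj.
have [x y|d x|h hE] := @induced_universal _ _ _ _ _ _ Acf M X
    (fun m => s (f (induced_unit Acf m))).
- rewrite -sD -linearD; congr (s (f _)); apply: inducedP => r' s' /=.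
  by rewrite !induced_unitE; case: ifP; rewrite ?addr0.
- rewrite -sK -linearZ /=; congr (s (f _)); apply: inducedP => r' s'.
  by rewrite induced_KE !induced_unitE; case: ifP; rewrite ?scaler0.
exists h => w.
have gh_lin : linear (fun w => g (h w)).
  by apply: linear_comp; apply: linearP.
have [gh ghE] := linear_ofP gh_lin; rewrite -ghE.
by apply: induced_ext => m; rewrite ghE hE gs.
Qed.

Variable M : lmodType A.
Local Notation W := (induced_module M Acf).

(** Descending induction on the second exponent, from beyond the support. *)
Lemma twisted_shift_inj (a : A) (y : W) :
  (forall r s, y r s - a *: y r s.+1 = 0) -> y = 0.
Proof.
move=> yE; have [N yN] := induced_supp y.
have y0 k r s : (N <= s + k)%N -> y r s = 0.
  elim: k s => [|k IHk] s Nsk.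
    by apply: yN; rewrite addn0 in Nsk; apply/(leq_trans Nsk)/leq_addl.
  have /eqP := yE r s; rewrite subr_eq0 => /eqP ->.
  by rewrite IHk ?scaler0 // addSnnS.
by apply: inducedP => r s; apply: (y0 N); apply: leq_addl.
Qed.

Lemma twisted_shift_inj_u (a : A) (y : W) : (forall r s, y r s.+1 = 0) ->
  (forall r, y r 0%N - a *: y r.+1 0%N = 0) -> y = 0.
Proof.
move=> y_u yE; have [N yN] := induced_supp y.
have y0 k r : (N <= r + k)%N -> y r 0%N = 0.
  elim: k r => [|k IHk] r Nrk; first by apply: yN.
  have /eqP := yE r; rewrite subr_eq0 => /eqP ->.
  by rewrite IHk ?scaler0 // addSnnS.
by apply: inducedP => r [|s]; [apply: (y0 N); apply: leq_addl | apply: y_u].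
Qed.

(** The solution of [y s - a *: y s.+1 = f s.+1] is the geometric sum
    $\sum_k a^k f_{s+1+k}$, which is finite. *)
Lemma geometric_solution (a : A) N (f : nat -> M) :
  (forall s, (N <= s)%N -> f s = 0) ->
  exists y : nat -> M,
    (forall m s, (forall s', (m <= s')%N -> f s' = 0) -> (m <= s)%N -> y s = 0) /\
    forall s, y s - a *: y s.+1 = f s.+1.
Proof.
move=> fN; exists (fun s => \sum_(k < N) a ^+ k *: f (s.+1 + k)%N); split.
  move=> m s fm ms; rewrite big1 // => k _.
  by rewrite fm ?scaler0 // addSn ltnW // ltnS (leq_trans ms) ?leq_addr.
move=> s; apply/eqP; rewrite subr_eq; apply/eqP.
have -> : \sum_(k < N) a ^+ k *: f (s.+1 + k)%N =
    \sum_(k < N.+1) a ^+ k *: f (s.+1 + k)%N.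
  by rewrite big_ord_recr /= [f _]fN ?scaler0 ?addr0 // addSn ltnW // ltnS leq_addl.
rewrite big_ord_recl expr0 scale1r addn0 scaler_sumr; congr (_ + _).
by apply: eq_bigr => k _; rewrite scalerA exprS /= addnS.
Qed.

Lemma twisted_shift_surj (a : A) (w : W) :
  exists y : W, forall r s, y r s - a *: y r s.+1 = w r s.+1.
Proof.
have [N wN] := induced_supp w.
have [y yP] := choice (fun r => @geometric_solution a N (w r)
  (fun s Ns => wN r s (leq_trans Ns (leq_addl _ _)))).
have [r s Nrs|y' y'E] := @induced_build _ _ _ _ _ _ Acf M y N.
  apply: (proj1 (yP r) (N - r)%N); last by rewrite leq_subLR.
  by move=> s'; rewrite leq_subLR; apply: wN.
by exists y' => r s; rewrite !y'E; case: (yP r).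
Qed.

(** The resolution is
    $0\to A\otimes M\to(A\otimes M)^2\to A\otimes M\to M\to0$.  Let $R_a$ be right
    multiplication by $a$ on $A$ and $L_a$ the action of $a$ on $M$.  The maps are
    $w\mapsto(R_vw-cL_vw,\,L_uw-cR_uw)$ and
    $(w,w')\mapsto(R_u-L_u)w+(R_v-L_v)w'$.  For exactness, an element of
    $A\otimes M$ is congruent modulo the image of $R_v-L_v$ to one without $v$,
    which is congruent modulo the image of $R_u-L_u$ to one in $1\otimes M$. *)
Theorem skew_pdim_le2 : pdim_le M 2.
Proof.
have [aug augE] := @induced_universal _ _ _ _ _ _ Acf M M id
  (fun _ _ => erefl) (fun _ _ => erefl).
have [pu puE] := induced_push_u Acf M; have [pv pvE] := induced_push_v Acf M.
have [iu iuE] := induced_inner Acf M u; have [iv ivE] := induced_inner Acf M v.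
have [icv icvE] := induced_inner Acf M (c *: v).
have [ic icE] := induced_inner Acf M c%:A.
have d0_lin : linear (fun p : W * W => (pu p.1 - iu p.1) + (pv p.2 - iv p.2)).
  by apply: linear_add; apply: linear_sub; apply: linear_comp.
have [d0 d0E] := linear_ofP d0_lin.
have d1_lin : linear (fun w : W => (pv w - icv w, iu w - ic (pu w)) : W * W).
  apply: linear_pair; apply: linear_sub; try exact: linearP.
  by apply: linear_comp; apply: linearP.
have [d1 d1E] := linear_ofP d1_lin.
have aug_surj m : exists w, aug w = m.
  by exists (induced_unit Acf m); rewrite augE.
have d1_inj w : d1 w = 0 -> w = 0.
  move=> /(congr1 fst); rewrite d1E /= => w0.
  apply: (@twisted_shift_inj (c *: v)) => r s.
  by have := congr1 (fun w : W => w r s.+1) w0; rewrite inducedB pvE icvE.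
have aug_d0 p : aug (d0 p) = 0.
  have augu w : aug (pu w - iu w) = 0.
    have l_lin : linear (fun w => aug (pu w - iu w)).
      by apply: linear_comp; apply: linear_sub; apply: linearP.
    have [l lE] := linear_ofP l_lin.
    have [z zE] := linear_ofP (@linear_null A W M).
    rewrite -lE -(zE w); apply: induced_ext => m; rewrite lE zE.
    rewrite linearB /=; have -> : pu (induced_unit Acf m) = u *: induced_unit Acf m.
      apply: inducedP => r s; rewrite puE induced_uE; case: r => // r.
      by rewrite !induced_unitE; case: s => [|s]; rewrite ?expr0 ?scale1r // andbF scaler0.
    have -> : iu (induced_unit Acf m) = induced_unit Acf (u *: m).
      by apply: inducedP => r s; rewrite iuE !induced_unitE; case: ifP; rewrite ?scaler0.
    by rewrite linearZ /= !augE subrr.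
  have augv w : aug (pv w - iv w) = 0.
    have l_lin : linear (fun w => aug (pv w - iv w)).
      by apply: linear_comp; apply: linear_sub; apply: linearP.
    have [l lE] := linear_ofP l_lin.
    have [z zE] := linear_ofP (@linear_null A W M).
    rewrite -lE -(zE w); apply: induced_ext => m; rewrite lE zE.
    rewrite linearB /=; have -> : pv (induced_unit Acf m) = v *: induced_unit Acf m.
      apply: inducedP => r s; rewrite pvE induced_vE; case: s => // s.
      by rewrite !induced_unitE; case: r => [|r]; rewrite ?expr0 ?scale1r // scaler0.
    have -> : iv (induced_unit Acf m) = induced_unit Acf (v *: m).
      by apply: inducedP => r s; rewrite ivE !induced_unitE; case: ifP; rewrite ?scaler0.
    by rewrite linearZ /= !augE subrr.
  by rewrite d0E linearD /= augu augv addr0.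
have aug_unit (w : W) : (forall r s, (r != 0%N) || (s != 0%N) -> w r s = 0) ->
    aug w = w 0%N 0%N.
  move=> w0; rewrite -[RHS]augE; congr (aug _); apply: inducedP => r s.
  rewrite induced_unitE; case: ifP => [/andP[/eqP-> /eqP->] //|/negbT].
  by rewrite negb_and => /w0.
have exact0 (w : W) : aug w = 0 <-> exists p, w = d0 p.
  split=> [w0|[p ->]]; last exact: aug_d0.
  have [y yE] := twisted_shift_surj v w.
  have [w1 w1_def] : exists w1, w1 = w - (pv y - iv y) by eexists.
  have w1E r s : w1 r s.+1 = 0 by rewrite w1_def !inducedB pvE ivE yE subrr.
  have [N w1N] := induced_supp w1.
  have [x [x0 xE]] := @geometric_solution u N (fun r => w1 r 0%N)
    (fun r Nr => w1N r 0%N (leq_trans Nr (leq_addr _ _))).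
  have [|x' x'E] := @induced_build _ _ _ _ _ _ Acf M
      (fun r s => if s is 0%N then x r else 0) N.
    move=> r [|s] // Nr; apply: (x0 N); last by rewrite addn0 in Nr.
    by move=> r' Nr'; rewrite w1N ?addn0.
  have [w2 w2_def] : exists w2, w2 = w - d0 (x', y) by eexists.
  have w2E r s : (r != 0%N) || (s != 0%N) -> w2 r s = 0.
    have -> : w2 = w1 - (pu x' - iu x').
      by rewrite w2_def w1_def d0E /= [X in _ - X]addrC opprD addrA.
    rewrite !inducedB puE iuE; case: s => [|s] => [|_].
      by case: r => // r _; rewrite !x'E expr0 !scale1r xE subrr.
    by rewrite w1E; case: r => [|r]; rewrite !x'E !scaler0 !subr0.
  have augw2 : aug w2 = 0.
    by rewrite w2_def linearB /= w0 aug_d0 subrr.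
  exists (x', y); apply/eqP; rewrite -subr_eq0 -w2_def.
  apply/eqP/inducedP => r s; case: (boolP ((r != 0%N) || (s != 0%N))) => [/w2E //|].
  by rewrite negb_or !negbK => /andP[/eqP-> /eqP->]; rewrite -aug_unit.
have d0d1 (w : W) : d0 (d1 w) = 0.
  have e1 : pu (pv w) = pv (ic (pu w)).
    apply: inducedP => r s; rewrite puE pvE; case: s => [|s].
      by case: r => // r; rewrite pvE scaler0.
    rewrite icE puE; case: r => [|r]; first by rewrite scaler0.
    by rewrite pvE scalerA mulr_algl scalerA -exprS.
  have e2 : pu (icv w) = iv (ic (pu w)).
    apply: inducedP => r s; rewrite puE ivE icE puE; case: r => [|r].
      by rewrite !scaler0.
    rewrite icvE [RHS]scalar_comm scalar_comm [RHS]scalar_comm.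
    by rewrite [c%:A *: (v *: _)]scalerA mulr_algl.
  have e3 : iu (pv w) = pv (iu w).
    apply: inducedP => r s; rewrite iuE !pvE.
    by case: s => [|s]; rewrite ?scaler0 ?iuE.
  have e4 : iu (icv w) = iv (iu w).
    apply: inducedP => r s; rewrite iuE icvE ivE iuE !scalerA.
    by rewrite (skew_comm Acf) scalerAr.
  rewrite d1E d0E !linearB /= e1 e2 e3 e4; apply/eqP.
  rewrite !opprK addr_eq0 !opprD !opprK addrACA; apply/eqP.
  by congr (_ + _); apply: addrC.
have exact1 p : d0 p = 0 <-> exists w, p = d1 w.
  split=> [|[w ->]]; last exact: d0d1.
  case: p => x y p0; have [t tE] := twisted_shift_surj (c *: v) x.
  exists t; apply/eqP; rewrite -subr_eq0; apply/eqP.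
  have : d0 ((x, y) - d1 t) = 0 by rewrite linearB /= p0 d0d1 subr0.
  rewrite d1E; set x' := x - (pv t - icv t); set y' := y - (iu t - ic (pu t)).
  rewrite -[(x, y) - _]/((x', y') : W * W) d0E /= => p'0.
  have x'E r s : x' r s.+1 = 0 by rewrite !inducedB pvE icvE tE subrr.
  have y'0 : y' = 0.
    apply: (@twisted_shift_inj v) => r s.
    have := congr1 (fun w : W => w r s.+1) p'0.
    rewrite inducedD !(inducedB (pu _)) (inducedB (pv _)) puE iuE pvE ivE x'E scaler0.
    by case: r => [|r]; rewrite ?x'E ?scaler0 subr0 add0r.
  have x'0 : x' = 0.
    apply: (@twisted_shift_inj_u u) => // r.
    have := congr1 (fun w : W => w r.+1 0%N) p'0.
    by rewrite y'0 !linear0 !addr0 inducedB puE iuE expr0 !scale1r.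
  by rewrite x'0 y'0.
have projW : projective W by apply: induced_projective.
exists (short_resolution projW (projective_prod projW projW) projW aug_surj exact0
  exact1 d1_inj).
by move=> [|[|[|k]]] // _ x; apply: short_mod0.
Qed.

End GlobalDimension.

(** * The Koszul resolution of the trivial module *)

Section TrivialModule.

Variables (K : fieldType) (A : algType K) (c : K) (u v : A).
Variable cf : A -> nat -> nat -> K.
Hypothesis Acf : skew_polynomial c u v cf.

(** The module $\Bbbk=A/A_{\ge1}$. *)
Definition trivial_module (_ : skew_polynomial c u v cf) : Type := K.
Local Notation T := (trivial_module Acf).
HB.instance Definition _ := GRing.Zmodule.on T.

Definition trivial_scale (a : A) (x : T) : T := (cf a 0 0 * x : K).

Lemma trivial_scaleA a b x :
  trivial_scale a (trivial_scale b x) = trivial_scale (a * b) x.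
Proof. by rewrite /trivial_scale (cfM00 Acf) mulrA. Qed.

Lemma trivial_scale1 : left_id 1 trivial_scale.
Proof. by move=> x; rewrite /trivial_scale (cf1 Acf) mul1r. Qed.

Lemma trivial_scaleDr : right_distributive trivial_scale +%R.
Proof. by move=> a x y; rewrite /trivial_scale -mulrDr. Qed.

Lemma trivial_scaleDl x : {morph trivial_scale^~ x : a b / a + b}.
Proof. by move=> a b; rewrite /trivial_scale (cfD Acf) mulrDl. Qed.

HB.instance Definition _ := GRing.Zmodule_isLmodule.Build A T
  trivial_scaleA trivial_scale1 trivial_scaleDr trivial_scaleDl.

Lemma trivial_scaleE (a : A) (x : T) : a *: x = (cf a 0 0 * x : K).
Proof. by []. Qed.

Definition koszul_aug_fun (a : A^o) : T := cf a 0 0.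

Lemma koszul_aug_linear : linear koszul_aug_fun.
Proof. by move=> a x y; rewrite /koszul_aug_fun (cfD Acf) (cfM00 Acf). Qed.

Definition koszul_d0_fun (p : A^o * A^o) : A^o := p.1 * u + p.2 * v.

Lemma koszul_d0_linear : linear koszul_d0_fun.
Proof.
by move=> a p q; rewrite /koszul_d0_fun /= !mulrDl scalerDr addrACA !scalerAl.
Qed.

Definition koszul_d1_fun (w : A^o) : A^o * A^o := (w * v, - (c *: (w * u))).

Lemma koszul_d1_linear : linear koszul_d1_fun.
Proof.
move=> a x y; congr pair; rewrite /= mulrDl; first by rewrite scalerAl.
rewrite scalerDr opprD; congr (_ - _).
rewrite -[RHS]/(a * - (c *: (x * u))) -[a *: x]/(a * x) mulrN -scalerAr.
by rewrite mulrA.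
Qed.

Definition koszul_aug : {linear A^o -> T} := linear_of koszul_aug_linear.
Definition koszul_d0 : {linear (A^o * A^o)%type -> A^o} := linear_of koszul_d0_linear.
Definition koszul_d1 : {linear A^o -> (A^o * A^o)%type} := linear_of koszul_d1_linear.

Lemma koszul_aug_surj (x : T) : exists a, koszul_aug a = x.
Proof.
exists ((x : K)%:A); rewrite [LHS](cfZ Acf) (cf1 Acf) mulr1 //.
Qed.

Lemma augmentation_right a : cf a 0 0 = 0 -> exists x y, a = x * u + y * v.
Proof.
move=> a0; have [N aN] := cf_bound Acf a.
have [|y yE] := @cf_build _ _ _ _ _ _ Acf N (fun r s => cf a r s.+1).
  by move=> r s /orP[Nr|Ns]; apply: aN; rewrite ?Nr // leqW ?orbT.
have [|x xE] := @cf_build _ _ _ _ _ _ Acf N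
    (fun r s => if s is 0%N then cf a r.+1 0%N else 0).
  by move=> r [|s] // /orP[Nr|]; [apply: aN; rewrite leqW | case: N aN => // aN _; apply: aN].
exists x, y; apply: (cf_inj Acf) => r s.
rewrite (cfD Acf) -[u]expr1 -[v]expr1 (cfMu Acf) (cfMv Acf) xE yE.
case: s => [|s] /=; last by rewrite mulr0 if_same subn1 add0r.
by case: r => [|r] /=; rewrite ?a0 ?addr0 // mul0n expr0 mul1r subn1.
Qed.

(** The coefficients of the cofactors are coefficients of [a], so the cofactors
    inherit its homogeneity. *)
Lemma augmentation_left a : cf a 0 0 = 0 -> exists x y, a = u * x + v * y /\
  forall r s, (cf x r s != 0 -> cf a r.+1 s != 0) /\
              (cf y r s != 0 -> cf a r s.+1 != 0).
Proof.
move=> a0; have [N aN] := cf_bound Acf a.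
have [|x xE] := @cf_build _ _ _ _ _ _ Acf N (fun r s => cf a r.+1 s).
  by move=> r s /orP[Nr|Ns]; apply: aN; rewrite ?Ns ?orbT // leqW.
have [|y yE] := @cf_build _ _ _ _ _ _ Acf N
    (fun r s => if r is 0%N then cf a 0%N s.+1 else 0).
  move=> [|r] s // /orP[|Ns]; last by apply: aN; rewrite [X in _ || X]leqW ?orbT.
  by case: N aN => // aN _; apply: aN.
exists x, y; split; last first.
  by move=> r s; rewrite xE yE; split=> //; case: r => //; rewrite eqxx.
apply: (cf_inj Acf) => r s.
rewrite (cfD Acf) -[u]expr1 -[v]expr1 (cf_uM Acf) (cf_vM Acf) xE yE.
case: r => [|r] /=; last by rewrite mulr0 if_same subn1 addr0.
by case: s => [|s] /=; rewrite ?a0 ?addr0 // muln0 expr0 mul1r subn1 add0r.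
Qed.

Lemma koszul_exact0 (a : A^o) : koszul_aug a = 0 <-> exists p, a = koszul_d0 p.
Proof.
split=> [/augmentation_right[x [y ->]]|[p ->]]; first by exists (x, y).
rewrite [LHS](cfD Acf) -[u]expr1 -[v]expr1 (cfMu Acf) (cfMv Acf) /=.
by rewrite addr0.
Qed.

Lemma koszul_exact1 (p : A^o * A^o) : koszul_d0 p = 0 <-> exists w, p = koszul_d1 w.
Proof.
split=> [p0|[w ->]].
  have [] := @left_syzygy _ _ _ _ _ _ Acf 1 1 p.1 p.2; first by rewrite !expr1.
  move=> g; rewrite !expr1 => -[p1 p2]; exists g.
  by case: p p1 p2 {p0} => x y /= -> ->.
have e : (w : A) * v * u + - (c *: (w * u)) * v = 0.
  by rewrite mulNr -mulrA (skew_comm Acf) -scalerAr -scalerAl mulrA subrr.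
exact: e.
Qed.

Lemma koszul_d1_inj (w : A^o) : koszul_d1 w = 0 -> w = 0.
Proof.
move=> /(congr1 fst) w0; apply: (mulIv Acf (l := 1)).
by rewrite expr1 mul0r.
Qed.

Definition koszul : resolution T :=
  short_resolution (@projective_free1 A)
    (projective_prod (@projective_free1 A) (@projective_free1 A))
    (@projective_free1 A) koszul_aug_surj koszul_exact0 koszul_exact1 koszul_d1_inj.

(** A resolution of length one would make the identity of the last Koszul module
    null-homotopic, and hence $1=v\,a-c\,u\,b$ for some $a$ and $b$. *)
Theorem skew_gldim : gldim A 2.
Proof.
split=> [M|d /(_ T)[P P0]]; first exact: (skew_pdim_le2 Acf).
case: leqP => // d2; have [s' [s sE]] := @null_homotopy _ _ koszul P 1 (P0 2 d2).
have {}sE (x : A^o) : x = s (koszul_d1 x).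
  by rewrite {1}[x](sE x) [s' _]short_mod0 linear0 add0r.
have d1E : koszul_d1 1 = v *: (1, 0) - (c *: u) *: (0, 1).
  rewrite [LHS]/(koszul_d1_fun 1) /koszul_d1_fun !mul1r.
  by congr pair; rewrite /= ?[_ *: 1]mulr1 ?[_ *: 0]mulr0 ?subr0 ?sub0r.
have e : 1 = v * (s (1, 0) : A) - (c *: u) * (s (0, 1) : A).
  by rewrite [LHS](sE 1) d1E linearB !linearZ.
have := congr1 (fun a : A => cf a 0 0) e.
rewrite (cf1 Acf) (cfB Acf) !(cfM00 Acf) (cfZ Acf).
rewrite -[u]mulr1 -[v]mulr1 -[u]expr1 -[v]expr1 (cf_uM Acf) (cf_vM Acf) /=.
by rewrite mulr0 !mul0r subrr => /eqP; rewrite oner_eq0.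
Qed.

End TrivialModule.

(** * Gradings *)

Section CoefficientGrading.

Variables (V K : zmodType) (J : choiceType) (I : eqType).
Variables (kappa : V -> J -> K) (wt : J -> I) (G : I -> set V).
Hypothesis kappaB : forall x y j, kappa (x - y) j = kappa x j - kappa y j.
Hypothesis kappa_inj : forall x, (forall j, kappa x j = 0) -> x = 0.
Hypothesis kappa_fin : forall x, exists s : seq J, forall j, kappa x j != 0 -> j \in s.
Hypothesis kappa_trunc : forall x (P : pred J),
  exists y, forall j, kappa y j = if P j then kappa x j else 0.
Hypothesis GE : forall t x, G t x <-> forall j, kappa x j != 0 -> wt j = t.

Let kappa0 j : kappa 0 j = 0.
Proof. by rewrite -(subrr 0) kappaB subrr. Qed.

Let kappaD x y j : kappa (x + y) j = kappa x j + kappa y j.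
Proof. by rewrite -{1}[y]opprK -[- y]sub0r !kappaB kappa0 sub0r opprK. Qed.

Let kappa_sum (T : Type) (l : seq T) (F : T -> V) j :
  kappa (\sum_(i <- l) F i) j = \sum_(i <- l) kappa (F i) j.
Proof. by elim/big_rec2: _ => // i x y _ <-; rewrite kappaD. Qed.

(** The coordinates are indexed by an arbitrary [J], to cover both the algebra and
    its free modules. *)
Lemma coefficient_grading : direct_decomposition G.
Proof.
split.
- move=> t; split=> [|x y /GE xt /GE yt]; apply/GE => j.
    by rewrite kappa0 eqxx.
  by rewrite kappaB; have [->|/xt //] := eqVneq (kappa x j) 0; rewrite sub0r oppr_eq0 => /yt.
- move=> x; have [s sP] := kappa_fin x.
  have [f fE] := choice (fun t => kappa_trunc x (fun j => wt j == t)).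
  exists (undup [seq wt j | j <- s]), f; split=> [t|].
    by apply/GE => j; rewrite fE; case: (wt j =P t) => //; rewrite eqxx.
  apply/eqP; rewrite -subr_eq0; apply/eqP/kappa_inj => j.
  rewrite kappaB kappa_sum; apply/eqP; rewrite subr_eq0; apply/eqP.
  have [x0|xj] := eqVneq (kappa x j) 0.
    by rewrite x0 big1 // => t _; rewrite fE x0 if_same.
  rewrite (bigD1_seq (wt j)) ?undup_uniq ?mem_undup ?map_f ?sP //= fE eqxx.
  by rewrite big1 ?addr0 // => t /negbTE tj; rewrite fE eq_sym tj.
- move=> s f s_uniq fG f0 t ts; apply: kappa_inj => j.
  have [jt|jt] := eqVneq (wt j) t; last first.
    by apply/eqP; apply: contra_neqT jt => /(proj1 (GE _ _) (fG t)).
  have := kappa_sum s f j; rewrite f0 kappa0 (bigD1_seq t) //= big1 ?addr0 //.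
  move=> t' t't; apply/eqP; apply: contra_neqT t't => /(proj1 (GE _ _) (fG t')).
  by rewrite jt.
Qed.

End CoefficientGrading.

Section Homogeneous.

Variables (K : fieldType) (A : algType K) (c : K) (u v : A).
Variable cf : A -> nat -> nat -> K.
Hypothesis Acf : skew_polynomial c u v cf.
Variables w1 w2 : nat.

Local Notation mon := (mon u v).

(** [w1] and [w2] are the degrees of [u] and [v].  Degrees are integers because the
    shifts of free modules lead to negative ones. *)
Definition homog (t : int) (a : A) : Prop :=
  forall r s, cf a r s != 0 -> (w1 * r + w2 * s)%:Z = t.

Lemma homog_cf t a r s : homog t a -> (w1 * r + w2 * s)%:Z != t -> cf a r s = 0.
Proof. by move=> a_t; apply: contraNeq => /a_t ->. Qed.

Lemma homog0 t : homog t 0.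
Proof. by move=> r s; rewrite (cf0 Acf) eqxx. Qed.

Lemma homog_lin t d a b : homog t a -> homog t b -> homog t (d *: a + b).
Proof.
move=> a_t b_t r s; rewrite (cfD Acf) (cfZ Acf).
have [->|/a_t //] := eqVneq (cf a r s) 0; rewrite mulr0 add0r; exact: b_t.
Qed.

Lemma homogZ t d a : homog t a -> homog t (d *: a).
Proof. by move=> a_t; rewrite -[_ *: _]addr0; apply/homog_lin/homog0. Qed.

Lemma homog_mon r s : homog (w1 * r + w2 * s)%:Z (mon r s).
Proof.
move=> r' s'; rewrite (skew_cf_mon Acf).
by case: (r =P r') => [->|_]; case: (s =P s') => [->|_] //=; rewrite eqxx.
Qed.

Lemma homog_ind t (P : A -> Prop) : P 0 ->
  (forall d a b, P a -> P b -> P (d *: a + b)) ->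
  (forall r s, (w1 * r + w2 * s)%:Z = t -> P (mon r s)) ->
  forall a, homog t a -> P a.
Proof.
move=> P0 Plin Pmon a a_t; apply: (support_ind Acf) => // r s /a_t; exact: Pmon.
Qed.

Lemma homogM t t' a b : homog t a -> homog t' b -> homog (t + t') (a * b).
Proof.
move=> a_t b_t; elim/homog_ind: a_t => [|d x y xb yb|r s <-{t}].
- by rewrite mul0r; apply: homog0.
- by rewrite mulrDl -scalerAl; apply: homog_lin.
elim/homog_ind: b_t => [|d x y xb yb|r' s' <-{t'}].
- by rewrite mulr0; apply: homog0.
- by rewrite mulrDr -scalerAr; apply: homog_lin.
rewrite (monM Acf); apply: homogZ.
by rewrite -PoszD addnACA -!mulnDr; apply: homog_mon.
Qed.

Lemma cf_support a :
  exists l : seq (nat * nat), forall r s, cf a r s != 0 -> (r, s) \in l.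
Proof.
have [N aN] := cf_bound Acf a; exists (allpairs pair (iota 0 N) (iota 0 N)).
move=> r s rs; suff /andP[? ?] : (r < N)%N && (s < N)%N.
  by apply: allpairs_f; rewrite mem_iota.
by apply: contraNT rs; rewrite negb_and -!leqNgt => /aN ->.
Qed.

Lemma cf_decomposition (I : eqType) (wt : nat -> nat -> I) (G : I -> set A) :
  (forall t a, G t a <-> forall r s, cf a r s != 0 -> wt r s = t) ->
  direct_decomposition G.
Proof.
move=> GE.
apply: (@coefficient_grading A K (nat * nat)%type I
  (fun a j => cf a j.1 j.2) (fun j => wt j.1 j.2)).
- by move=> x y j; apply: (cfB Acf).
- by move=> x x0; apply: (cf_inj Acf) => r s; rewrite (cf0 Acf); apply: (x0 (r, s)).
- by move=> x; have [l xl] := cf_support x; exists l => -[r s]; apply: xl.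
- move=> x P; have [N xN] := cf_bound Acf x.
  have [r s rs|y yE] := @cf_build _ _ _ _ _ _ Acf N
    (fun r s => if P (r, s) then cf x r s else 0).
    by rewrite xN ?if_same.
  by exists y => -[r s]; rewrite yE.
- move=> t x; rewrite GE.
  by split=> [xt [r s]|xt r s]; [apply: xt | apply: (xt (r, s))].
Qed.

Lemma cf_pair_decomposition (I : eqType) (wt wt' : nat -> nat -> I)
    (G : I -> set (A * A)) :
  (forall t p, G t p <-> (forall r s, cf p.1 r s != 0 -> wt r s = t) /\
                         (forall r s, cf p.2 r s != 0 -> wt' r s = t)) ->
  direct_decomposition G.
Proof.
move=> GE.
apply: (@coefficient_grading (A * A)%type K (bool * (nat * nat))%type I
  (fun p j => cf (if j.1 then p.1 else p.2) j.2.1 j.2.2)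
  (fun j => (if j.1 then wt else wt') j.2.1 j.2.2)).
- by move=> x y [[] j]; apply: (cfB Acf).
- move=> [x y] xy0; congr pair; apply: (cf_inj Acf) => r s; rewrite (cf0 Acf).
    exact: (xy0 (true, (r, s))).
  exact: (xy0 (false, (r, s))).
- move=> [x y]; have [l xl] := cf_support x; have [l' yl] := cf_support y.
  exists ([seq (true, j) | j <- l] ++ [seq (false, j) | j <- l']).
  by move=> [[] [r s]] /= rs; rewrite mem_cat map_f ?orbT //; [apply: xl|apply: yl].
- move=> [x y] P; have [N xN] := cf_bound Acf x; have [N' yN] := cf_bound Acf y.
  have [r s rs|x' x'E] := @cf_build _ _ _ _ _ _ Acf N
    (fun r s => if P (true, (r, s)) then cf x r s else 0).
    by rewrite xN ?if_same.
  have [r s rs|y' y'E] := @cf_build _ _ _ _ _ _ Acf N'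
    (fun r s => if P (false, (r, s)) then cf y r s else 0).
    by rewrite yN ?if_same.
  by exists (x', y') => -[[] [r s]] /=; rewrite ?x'E ?y'E.
- move=> t [x y]; rewrite GE /=; split=> [[xt yt] [[] [r s]]|xyt].
  + exact: xt.
  + exact: yt.
  + by split=> r s; [apply: (xyt (true, (r, s))) | apply: (xyt (false, (r, s)))].
Qed.

End Homogeneous.

Section Regular.

Variable R : realType.
Local Notation C := (complex R).
Variables (A : algType C) (c : C) (u v : A).
Variable cf : A -> nat -> nat -> C.
Hypothesis Acf : skew_polynomial c u v cf.
Variables w1 w2 : nat.
Hypotheses (w1_gt0 : (0 < w1)%N) (w2_gt0 : (0 < w2)%N).
Variable G : nat -> set A.
Hypothesis GE : forall m a, G m a <-> homog cf w1 w2 m a.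

Let c0 := skew_c_neq0 Acf.
Local Notation homog := (homog cf w1 w2).

Lemma int_gradingE t a : int_grading G t a <-> homog t a.
Proof.
case: t => [m|m] /=; first exact: GE.
split=> [->|a_m]; first exact: (homog0 Acf).
apply: (cf_inj Acf) => r s; rewrite (cf0 Acf); apply: homog_cf a_m _.
by [].
Qed.

Lemma homog_1 : homog 0 1.
Proof.
by move=> r s; rewrite (cf1 Acf); case: r s => [|r] [|s] //=; rewrite ?eqxx // !muln0.
Qed.

Lemma homog_constant a : homog 0 a -> a = (cf a 0 0)%:A.
Proof.
move=> a_0; apply: (cf_inj Acf) => r s; rewrite (cfZ Acf) (cf1 Acf).
have [/eqP rs|rs] := boolP ((r, s) == (0, 0)%N); first by case: rs => -> ->; rewrite mulr1.
have -> : ((0%N == r) && (0%N == s)) = false.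
  by apply: contraNF rs => /andP[/eqP<- /eqP<-].
rewrite mulr0; apply: homog_cf a_0 _; apply: contraNneq rs => /eqP.
rewrite eqz_nat addn_eq0 !muln_eq0 (gtn_eqF w1_gt0) (gtn_eqF w2_gt0) => /andP[/eqP-> /eqP->] //.
Qed.

Lemma skew_connected_graded : connected_graded G.
Proof.
split.
- apply: (cf_decomposition Acf (wt := fun r s => (w1 * r + w2 * s)%N)) => t a.
  rewrite GE; split=> a_t r s /a_t; last by move->.
  by move/eqP; rewrite eqz_nat => /eqP.
- by move=> m d a /GE a_m; apply/GE/(homogZ Acf).
- by move=> m m' a b /GE a_m /GE b_m; apply/GE; rewrite PoszD; apply: (homogM Acf).
- move=> a; split=> [/GE a_0|[d ->]]; first by exists (cf a 0 0); apply: homog_constant.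
  by apply/GE/(homogZ Acf)/homog_1.
Qed.

Local Notation T := (trivial_module Acf).
Local Notation P := (koszul Acf).

(** The shifts give all the Koszul maps degree [0].  From degree [3] on the
    modules vanish and the condition is vacuous. *)
Definition koszul_grading k : int -> set (P k) :=
  match k return int -> set (P k) with
  | 0 => fun t a => homog t a
  | 1 => fun t p => homog (t - w1%:Z) p.1 /\ homog (t - w2%:Z) p.2
  | 2 => fun t a => homog (t - w1%:Z - w2%:Z) a
  | _ => fun _ _ => True
  end%N.

Lemma koszul_graded k : graded_module G (@koszul_grading k).
Proof.
split.
- move: k => [|[|[|k]]].
  + apply: (cf_decomposition Acf (wt := fun r s => (w1 * r + w2 * s)%:Z)) => t a.
    by [].
  + apply: (cf_pair_decomposition Acf (wt := fun r s => (w1 * r + w2 * s)%:Z + w1%:Z)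
      (wt' := fun r s => (w1 * r + w2 * s)%:Z + w2%:Z)) => t p.
    split=> -[h1 h2]; split=> r s /=.
    * by move=> /h1 ->; rewrite subrK.
    * by move=> /h2 ->; rewrite subrK.
    * by move=> /h1 <-; rewrite addrK.
    * by move=> /h2 <-; rewrite addrK.
  + apply: (cf_decomposition Acf
      (wt := fun r s => (w1 * r + w2 * s)%:Z + w2%:Z + w1%:Z)) => t a.
    by split=> a_t r s /a_t => [->|<-]; rewrite ?subrK ?addrK.
  + split=> [t|x|s f _ _ _ t _]; first by split.
      exists [::], (fun _ => 0); split=> //.
      by rewrite big_nil; apply: short_mod0.
    exact: short_mod0.
- move=> m t a x /GE a_m; move: k x => [|[|[|k]]] x //.
  + exact: (homogM Acf).
  + by case: x => x y [x_t y_t]; split; rewrite -addrA; apply: (homogM Acf).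
  + by move=> x_t; rewrite /koszul_grading -!addrA [t + _]addrA; apply: (homogM Acf).
Qed.

Lemma homog_u : homog w1 u.
Proof.
by have := @homog_mon _ _ _ _ _ _ Acf w1 w2 1 0; rewrite /mon expr1 expr0 mulr1 muln1 muln0 addn0.
Qed.

Lemma homog_v : homog w2 v.
Proof.
by have := @homog_mon _ _ _ _ _ _ Acf w1 w2 0 1; rewrite /mon expr1 expr0 mul1r muln1 muln0.
Qed.

Lemma homogD t a b : homog t a -> homog t b -> homog t (a + b).
Proof. by move=> a_t b_t; rewrite -[a]scale1r; apply: (homog_lin Acf). Qed.

Lemma koszul_d_graded k t (x : P k.+1) :
  koszul_grading t x -> koszul_grading t (res_d P k x).
Proof.
move: k x => [|[|k]] x.
- case: x => x y [x_t y_t]; apply: (@homogD t (x * u) (y * v)).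
    by rewrite -[t](subrK w1%:Z); apply: (homogM Acf x_t homog_u).
  by rewrite -[t](subrK w2%:Z); apply: (homogM Acf y_t homog_v).
- move=> x_t; split.
    by rewrite -[_ - _](subrK w2%:Z); apply: (homogM Acf x_t homog_v).
  have e : homog (t - w2%:Z) (- (c *: ((x : A) * u))).
    rewrite -scaleNr; apply: (homogZ Acf).
    rewrite -[_ - _](subrK w1%:Z) [_ - _ - _]addrAC.
    exact: (homogM Acf x_t homog_u).
  exact: e.
- move=> _; rewrite [x]short_mod0 linear0; case: k {x} => [|k] //.
  exact: (homog0 Acf).
Qed.

Lemma koszul_aug_graded t (x : P 0%N) :
  koszul_grading t x -> t != 0 -> res_aug P x = 0.
Proof.
move=> x_t t0; apply: (homog_cf (r := 0) (s := 0) x_t).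
by rewrite !muln0 eq_sym.
Qed.

Definition graded_koszul : graded_resolution G T :=
  GradedResolution koszul_graded koszul_d_graded koszul_aug_graded.

Local Notation GP := graded_koszul.

Lemma linear_free1 (f : A^o -> A^o) : linear f -> forall x : A, f x = x * f 1 :> A.
Proof.
move=> f_lin x; have [g gE] := linear_ofP f_lin.
by rewrite -!gE -[in LHS](mulr1 x) -[x * 1]/(x *: (1 : A^o)) linearZ.
Qed.

Lemma ext0_zero t : ext_zero GP t 0.
Proof.
move=> f [[f_lin f_t] f0] x /=.
have fE := linear_free1 (f := f) f_lin.
have f1 : f (1 : A^o) = 0.
  apply: (muluI Acf (k := 1)); rewrite expr1 mulr0 -fE -[RHS](f0 (1, 0)).
  have e : u = 1 * u + 0 * v by rewrite mul1r mul0r addr0.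
  by rewrite {1}e.
by rewrite fE f1 mulr0.
Qed.

Lemma linear_free2 (f : A^o * A^o -> A^o) : linear f ->
  forall x y : A, f (x, y) = x * f (1, 0) + y * f (0, 1) :> A.
Proof.
move=> f_lin x y; have [g gE] := linear_ofP f_lin; rewrite -!gE.
have -> : (x, y) = x *: (1, 0) + y *: (0, 1) :> A^o * A^o.
  by congr pair; rewrite /= ?[_ *: 1]mulr1 ?[_ *: 0]mulr0 ?addr0 ?add0r.
by rewrite linearD !linearZ.
Qed.

(** A cocycle is a pair $(a,b)$ with $va=c\,ub$, so it is right multiplication
    of $(u,v)$ by some $g$. *)
Lemma ext1_zero t : ext_zero GP t 1.
Proof.
move=> f [[f_lin f_t] f0].
have fE := linear_free2 (f := f) f_lin.
have [|g [pE rE]] := @right_syzygy _ _ _ _ _ _ Acf (f (1, 0)) (f (0, 1)).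
  have := f0 (1 : A^o); rewrite [res_d _ _ _]/(koszul_d1_fun c u v 1) fE.
  by rewrite !mul1r mulNr -scalerAl => /eqP; rewrite subr_eq0 => /eqP.
have g_t : homog t g.
  have : int_grading G (w1%:Z + t) (f (1, 0)).
    apply: f_t; split; rewrite /= ?subrr; first exact: homog_1.
    exact: (homog0 Acf).
  rewrite pE => /int_gradingE ug_t r s grs.
  have := ug_t r.+1 s; rewrite -[u]expr1 (cf_uM Acf) /= subn1 => /(_ grs).
  by rewrite mulnS -addnA PoszD => /addrI.
exists (fun x : A^o => x * g); split; last first.
  by move=> [x y]; rewrite fE pE rE !mulrA -mulrDl.
split; first by move=> a x y; rewrite mulrDl /GRing.scale /= mulrA.
by move=> s x x_s; apply/int_gradingE/(homogM Acf).
Qed.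

(** Coboundaries in degree two are the right multiplications by elements of
    $uA+vA$. *)
Lemma ext2_map (g : A) (h : A) t : homog (w2%:Z + t) g -> homog (w1%:Z + t) h ->
  ext_coboundary (P := GP) t (k := 2) (fun x : A^o => x * (u * g + v * h)).
Proof.
move=> g_t h_t; pose p : A^o := h; pose r : A^o := - (c^-1 *: g).
exists (fun x : A^o * A^o => x.1 * p + x.2 * r); split; last first.
  move=> x; have e (y : A) : y * (u * g + v * h) =
      y * v * h + - (c *: (y * u)) * (- (c^-1 *: g)).
    rewrite mulrNN -scalerAl -scalerAr scalerA mulfV // scale1r.
    by rewrite mulrDr !mulrA addrC.
  exact: e.
split.
  by move=> a [x y] [x' y']; rewrite /= /GRing.scale /= !mulrDl mulrDr !mulrA addrACA.
move=> s [x y] [x_s y_s]; apply/int_gradingE/homogD.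
  by rewrite -[s](subrK w1%:Z) -addrA; apply: (homogM Acf).
rewrite -[s](subrK w2%:Z) -addrA; apply: (homogM Acf) => //.
by rewrite /r -scaleNr; apply: (homogZ Acf).
Qed.

Lemma ext2_generator a t : homog (w1%:Z + w2%:Z + t) a -> cf a 0 0 = 0 ->
  ext_coboundary (P := GP) t (k := 2) (fun x : A^o => x * a).
Proof.
move=> a_t /(augmentation_left Acf)[g [h [aE gh]]].
rewrite aE; apply: ext2_map => r s grs.
  have := a_t _ _ (proj1 (gh r s) grs); rewrite mulnS -addnA PoszD -!addrA.
  by move/addrI.
have := a_t _ _ (proj2 (gh r s) grs); rewrite mulnS addnCA PoszD -!addrA.
by rewrite addrCA => /addrI.
Qed.

(** The dual of the Koszul resolution resolves the right trivial module, so
    $\mathrm{Ext}^2=A/(uA+vA)$, placed in the degree of the last shift. *)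
Lemma skew_AS_gorenstein : AS_gorenstein G 2.
Proof.
exists (w1%:Z + w2%:Z), T, (1 : C); split.
  split; first exact: oner_neq0.
    move=> x; exists x; rewrite trivial_scaleE (cfZ Acf) (cf1 Acf) !mulr1 //.
  move=> m a m0 /GE a_m; rewrite trivial_scaleE.
  by rewrite (homog_cf a_m) ?mul0r // !muln0 eq_sym eqz_nat -lt0n.
exists GP => k t; case: k => [|[|[|k]]] /=; [exact: ext0_zero | exact: ext1_zero | |].
  have mapE (f : A^o -> A^o) : ext_cocycle (P := GP) t (k := 2) f ->
      (forall x, f x = x * f 1) /\ homog (w1%:Z + w2%:Z + t) (f 1).
    move=> [[f_lin f_t] _]; split; first exact: linear_free1.
    apply/int_gradingE/f_t; rewrite /= [_ + _ - w1%:Z]addrAC subrr add0r subrr; exact: homog_1.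
  case: eqP => [t_eq|t_l]; last first.
    move=> f /mapE[fE f_t]; have -> : f = (fun x : A => x * f 1) by apply/funext.
    apply: ext2_generator => //; apply: homog_cf f_t _; rewrite !muln0.
    apply/eqP => e; apply: t_l; apply/eqP; rewrite -addr_eq0 addrC -e //.
  exists (fun x : A^o => x); split.
  - split; last by move=> x; rewrite [x]short_mod0 linear0.
    split; first by [].
    by move=> s x x_s; apply/int_gradingE; rewrite t_eq opprD addrA.
  - move=> [g [[g_lin _] gE]]; have gE' := linear_free2 (f := g) g_lin.
    have e : 1 = 1 * v * g (1, 0) + - (c *: (1 * u)) * g (0, 1) :> A.
      by rewrite -gE'; apply: (gE 1).
    have /eqP := congr1 (fun a : A => cf a 0 0) e.
    rewrite (cf1 Acf) (cfD Acf) !mul1r mulNr (cfN Acf) -scalerAl (cfZ Acf).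
    rewrite -[u]expr1 -[v]expr1 (cf_uM Acf) (cf_vM Acf) /= mulr0 subrr.
    by rewrite oner_eq0.
  - move=> f f_cocycle; exists (cf (f 1) 0 0).
    exists (fun _ => 0); split.
      split; first exact: (@linear_null A (A^o * A^o)%type A^o).
      by move=> s x _; apply/int_gradingE/(homog0 Acf).
    have [fE f_t] := mapE f f_cocycle; rewrite t_eq subrr in f_t => x.
    have e : (x : A) * f 1 - cf (f 1) 0 0 *: (x : A) = 0.
      by rewrite {1}(homog_constant f_t) mulr_algr subrr.
    by rewrite fE.
move=> f [[f_lin _] _].
exists (fun _ => 0); split.
  split; first exact: (@linear_null A (P _) A^o).
  by move=> s x _; apply/int_gradingE/(homog0 Acf).
move=> x; have [g gE] := linear_ofP f_lin.
by rewrite -gE [x]short_mod0 linear0.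
Qed.

End Regular.

(** * Growth *)

Lemma limn_esup_le (R : realType) (u : nat -> \bar R) (c : \bar R) M :
  (forall m, (M <= m)%N -> (u m <= c)%E) -> (limn_esup u <= c)%E.
Proof.
move=> uc; apply: (@le_trans _ _ (ereal_sup (u @` [set m | (M <= m)%N]%classic)%classic)).
  apply: ereal_inf_lbound; exists [set m | (M <= m)%N]%classic => //.
  exact: nbhs_infty_ge.
by apply: ge_ereal_sup => _ [m /= Mm <-]; apply: uc.
Qed.

Section Growth.

Variable R : realType.
Local Notation C := (complex R).
Variables (A : algType C) (c : C) (u v : A).
Variable cf : A -> nat -> nat -> C.
Hypothesis Acf : skew_polynomial c u v cf.

Definition degree_le d a := forall r s, cf a r s != 0 -> (r + s <= d)%N.

Lemma degree_leW d d' a : (d <= d')%N -> degree_le d a -> degree_le d' a.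
Proof. by move=> dd' ad r s /ad /leq_trans; apply. Qed.

Lemma degree_le_lin d e a b :
  degree_le d a -> degree_le d b -> degree_le d (e *: a + b).
Proof.
move=> ad bd r s; rewrite (cfD Acf) (cfZ Acf).
have [->|/ad //] := eqVneq (cf a r s) 0; rewrite mulr0 add0r; exact: bd.
Qed.

Lemma degree_le0 d : degree_le d 0.
Proof. by move=> r s; rewrite (cf0 Acf) eqxx. Qed.

Lemma degree_le_mon r s : degree_le (r + s) (mon u v r s).
Proof.
move=> r' s'; rewrite (skew_cf_mon Acf).
by case: (r =P r') => [->|_]; case: (s =P s') => [->|_] //=; rewrite eqxx.
Qed.

Lemma degree_le_exists a : exists d, degree_le d a.
Proof.
have [N aN] := cf_bound Acf a; exists (N + N)%N => r s rs.
suff /andP[/ltnW rN /ltnW sN] : (r < N)%N && (s < N)%N by apply: leq_add.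
by apply: contraNT rs; rewrite negb_and -!leqNgt => /aN ->.
Qed.

Lemma degree_le_ind d (P : A -> Prop) : P 0 ->
  (forall e a b, P a -> P b -> P (e *: a + b)) ->
  (forall r s, (r + s <= d)%N -> P (mon u v r s)) ->
  forall a, degree_le d a -> P a.
Proof.
by move=> P0 Plin Pmon a ad; apply: (support_ind Acf) => // r s /ad; exact: Pmon.
Qed.

Lemma degree_leM d d' a b :
  degree_le d a -> degree_le d' b -> degree_le (d + d') (a * b).
Proof.
move=> ad bd; elim/degree_le_ind: ad => [|e x y xb yb|r s rs].
- by rewrite mul0r; apply: degree_le0.
- by rewrite mulrDl -scalerAl; apply: degree_le_lin.
elim/degree_le_ind: bd => [|e x y xb yb|r' s' rs'].
- by rewrite mulr0; apply: degree_le0.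
- by rewrite mulrDr -scalerAr; apply: degree_le_lin.
rewrite (monM Acf) -[_ *: _]addr0; apply: degree_le_lin; last exact: degree_le0.
apply: degree_leW; last exact: degree_le_mon. by rewrite addnACA leq_add.
Qed.

Lemma degree_le_words (s : seq A) D m : (forall a, a \in s -> degree_le D a) ->
  forall w, w \in words s m -> degree_le (D * m) w.
Proof.
move=> sD; have deg1 d : degree_le d 1.
  move=> r t; rewrite (cf1 Acf).
  by case: r t => [|r] [|t] //=; rewrite eqxx.
elim: m => [|m IHm] w /=; first by rewrite inE => /eqP ->.
rewrite inE => /orP[/eqP-> //|/allpairsP[[a w'] /= [sa mw' ->]]].
by rewrite mulnS; apply: degree_leM; [apply: sD | apply: IHm].
Qed.

Lemma lin_free_size L (s : seq A) : (forall a, a \in s -> degree_le L a) ->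
  lin_free s -> (size s <= L.+1 * L.+1)%N.
Proof.
move=> sL s_free.
pose M := \matrix_(k < size s, l < L.+1 * L.+1)
  cf s`_k (l %/ L.+1) (l %% L.+1).
suff M_free : row_free M by rewrite -(eqP M_free) rank_leq_col.
apply: inj_row_free => w wM; apply/rowP => k; rewrite mxE.
apply: (s_free (fun k => w 0 k)); apply: (cf_inj Acf) => r t; rewrite (cf0 Acf).
rewrite (cf_sum Acf); have [/andP[rL tL]|rt] := boolP ((r < L.+1)%N && (t < L.+1)%N).
  have l_lt : (r * L.+1 + t < L.+1 * L.+1)%N.
    by rewrite -ltn_subRL -mulnBl (leq_trans tL) // leq_pmull // subn_gt0.
  have := congr1 (fun M : 'rV_(L.+1 * L.+1) => M 0 (Ordinal l_lt)) wM.
  rewrite !mxE => e; rewrite -[RHS]e; apply: eq_bigr => k' _.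
  by rewrite (cfZ Acf) mxE /= divnMDl // divn_small // addn0 modnMDl modn_small.
rewrite big1 // => k' _; rewrite (cfZ Acf).
suff -> : cf s`_k' r t = 0 by rewrite mulr0.
apply/eqP; apply: contraNT rt => /(sL _ (mem_nth 0 (ltn_ord k'))) rtL.
by rewrite !ltnS (leq_trans (leq_addr _ _) rtL) (leq_trans (leq_addl _ _) rtL).
Qed.

Lemma span_dim_words (s : seq A) : exists D, forall m,
  (span_dim (words s m) <= (D * m).+1 * (D * m).+1)%N.
Proof.
have [D sD] : exists D, forall a, a \in s -> degree_le D a.
  elim: s => [|a s [D sD]]; first by exists 0%N.
  have [d ad] := degree_le_exists a; exists (maxn d D) => b.
  rewrite inE => /predU1P[->|/sD bD].
    exact: degree_leW (leq_maxl _ _) ad.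
  exact: degree_leW (leq_maxr _ _) bD.
exists D => m; apply/bigmax_leqP => b /asboolP free_b.
apply: lin_free_size free_b => a /mem_mask; exact: degree_le_words.
Qed.

(** Any finite bound will do: the words of length $m$ in elements of degree at most
    $D$ span a space of dimension at most $(Dm+1)^2\le m^4$ for $m\ge D+2$. *)
Theorem skew_GKdim : (GKdim A < +oo)%E.
Proof.
apply: (@le_lt_trans _ _ 4%:E); last exact: ltry.
apply: ge_ereal_sup => _ [s _ <-]; have [D sD] := span_dim_words s.
apply: (@limn_esup_le _ _ _ D.+2) => m Dm; rewrite lee_fin.
have m1 : (1 < m)%N by apply: leq_trans Dm.
have lnm : 0 < ln (m%:R : R) by rewrite ln_gt0 // ltr1n.
rewrite ler_pdivrMr //; have [->|d0] := posnP (span_dim (words s m)).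
  by rewrite ln0 // mulr_ge0 // ltW.
have -> : 4 * ln (m%:R : R) = ln ((m ^ 4)%:R : R).
  by rewrite natrX lnXn ?ltr0n ?(ltn_trans _ m1) // mulr_natl.
rewrite ler_ln ?posrE ?ltr0n ?expn_gt0 ?(ltn_trans _ m1) // ler_nat.
apply: leq_trans (sD m) _; rewrite -[4%N]/(2 + 2)%N expnD.
have Dm2 : ((D * m).+1 <= m ^ 2)%N.
  rewrite expnS expn1 (leq_trans _ (leq_mul Dm (leqnn m))) // -add1n !mulSn.
  exact: leq_add (ltnW m1) (leq_addl _ _).
exact: leq_mul.
Qed.

End Growth.

Theorem skew_AS_regular (R : realType) (A : algType (complex R)) (c : complex R)
    (u v : A) (cf : A -> nat -> nat -> complex R) (w1 w2 : nat) (G : nat -> set A) :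
  skew_polynomial c u v cf -> (0 < w1)%N -> (0 < w2)%N ->
  (forall m a, G m a <-> homog cf w1 w2 m a) -> AS_regular G.
Proof.
move=> Acf w1_gt0 w2_gt0 GE; exists 2; split.
- exact: (skew_connected_graded Acf w1_gt0 w2_gt0 GE).
- exact: (skew_gldim Acf).
- exact: (skew_GKdim Acf).
- exact: (skew_AS_gorenstein Acf w1_gt0 w2_gt0 GE).
Qed.

From mathcomp Require Import -(notations) monalg.

(** * The skew plane *)

Section Words.

Definition letter_u : 'I_2 := ord0.
Definition letter_v : 'I_2 := ord_max.

Lemma letterP k : k = letter_u \/ k = letter_v.
Proof. by case: k => [[|[|]]] // ?; [left | right]; apply/val_inj. Qed.

Fixpoint inversions (s : seq 'I_2) : nat :=
  if s is k :: s' then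
    ((if k == letter_v then count_mem letter_u s' else 0) + inversions s')%N
  else 0%N.

Lemma inversions_swap s t :
  inversions (s ++ [:: letter_v; letter_u] ++ t) =
  (inversions (s ++ [:: letter_u; letter_v] ++ t)).+1.
Proof.
elim: s => [|k s IHs] /=; first by rewrite !add0n add1n addSn.
by rewrite IHs addnS !count_cat.
Qed.

(** Sorting a word by the relation $vu=-c\,uv$ gives an ordered monomial times
    a power of [- c]; the exponent counts the inversions of the word. *)
Definition word_coef (K : fieldType) (c : K) (r s : nat) (w : seq 'I_2) : K :=
  if (count_mem letter_u w == r) && (count_mem letter_v w == s)
  then (- c) ^+ inversions w else 0.

Variables (K : fieldType) (F : algType K) (c : K) (word : seq 'I_2 -> F).
Hypothesis word_cat : forall s t, word s * word t = word (s ++ t).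
Hypothesis word_ind : forall P : F -> Prop, P 0 ->
  (forall d f g, P f -> P g -> P (d *: f + g)) -> (forall s, P (word s)) ->
  forall f, P f.
Variables (r s : nat) (e : F -> K).
Hypothesis e_lin : forall d f g, e (d *: f + g) = d * e f + e g.
Hypothesis e_word : forall w, e (word w) = word_coef c r s w.

Let rel := c *: (word [:: letter_u] * word [:: letter_v]) +
  word [:: letter_v] * word [:: letter_u].

(** Replacing an adjacent $vu$ by $uv$ removes exactly one inversion, so the
    coefficients after sorting vanish on the ideal of the relation.  They descend
    to the quotient, where they make the ordered monomials independent. *)
Lemma word_coef_ideal f : f \in gen_ideal rel -> e f = 0.
Proof.
have e0 : e 0 = 0.
  by have := e_lin (-1) 0 0; rewrite scaler0 addr0 mulN1r addNr.
have erel g h : e (g * rel * h) = 0.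
  elim/word_ind: g => [|d g g' IHg IHg'|w]; first by rewrite !mul0r.
    by rewrite !mulrDl -!scalerAl e_lin IHg IHg' mulr0 addr0.
  elim/word_ind: h => [|d h h' IHh IHh'|w']; first by rewrite mulr0.
    by rewrite mulrDr -scalerAr e_lin IHh IHh' mulr0 addr0.
  rewrite /rel !word_cat mulrDr mulrDl -scalerAr -scalerAl !word_cat -!catA.
  rewrite e_lin !e_word /word_coef inversions_swap !count_cat /=.
  by case: ifP => _; rewrite ?mulr0 ?addr0 // exprS mulNr subrr.
move=> /asboolP[l ->]; elim/big_rec: _ => [|g h _ h0]; first exact: e0.
by rewrite -[_ * _ * _]scale1r e_lin erel h0 mulr0 addr0.
Qed.

End Words.

Section Presentation.

Variables (K : fieldType) (F Q : algType K) (c : K) (word : seq 'I_2 -> F).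
Variables (pr : F -> Q) (coef : Q -> nat -> nat -> K).
Hypothesis c0 : c != 0.
Hypothesis word_cat : forall s t, word s * word t = word (s ++ t).
Hypothesis word0 : word [::] = 1.
Hypothesis word_ind : forall P : F -> Prop, P 0 ->
  (forall d f g, P f -> P g -> P (d *: f + g)) -> (forall s, P (word s)) ->
  forall f, P f.
Hypothesis pr_lin : forall d f g, pr (d *: f + g) = d *: pr f + pr g.
Hypothesis pr_mul : forall f g, pr (f * g) = pr f * pr g.
Hypothesis pr_one : pr 1 = 1.
Hypothesis pr_surj : forall a, exists f, a = pr f.
Hypothesis pr_rel : pr (c *: (word [:: letter_u] * word [:: letter_v]) +
  word [:: letter_v] * word [:: letter_u]) = 0.
Hypothesis coef_lin : forall r s, linear (fun a => coef a r s : K^o).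
Hypothesis coef_word : forall w r s, coef (pr (word w)) r s = word_coef c r s w.

Local Notation u := (pr (word [:: letter_u])).
Local Notation v := (pr (word [:: letter_v])).
Local Notation umon := (mon u v).

Let pr0 : pr 0 = 0.
Proof. by have := pr_lin (-1) 0 0; rewrite scaler0 addr0 scaleN1r addNr. Qed.

Let coefD a b r s : coef (a + b) r s = coef a r s + coef b r s.
Proof. by have := coef_lin r s 1 a b; rewrite !scale1r. Qed.

Let vu : v * u = (- c) *: (u * v).
Proof.
by apply/eqP; rewrite scaleNr -addr_eq0 addrC -!pr_mul -pr_lin pr_rel.
Qed.

Let v_exp r : v * u ^+ r = (- c) ^+ r *: (u ^+ r * v).
Proof.
elim: r => [|r IHr]; first by rewrite !expr0 mulr1 mul1r scale1r.
rewrite exprS mulrA vu -scalerAl -[u * v * _]mulrA IHr.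
by rewrite -scalerAr scalerA mulrA -!exprS.
Qed.

Lemma sorted_word s : exists d,
  pr (word s) = d *: umon (count_mem letter_u s) (count_mem letter_v s).
Proof.
elim: s => [|k s [d IHs]].
  by exists 1; rewrite word0 pr_one /mon !expr0 mulr1 scale1r.
rewrite -cat1s -word_cat pr_mul IHs /=; case: (letterP k) => ->; rewrite eqxx.
  by exists d; rewrite -scalerAr /mon mulrA -exprS.
exists (d * (- c) ^+ count_mem letter_u s).
rewrite /= add0n add1n -scalerAr /mon mulrA v_exp -scalerAl scalerA.
by rewrite -mulrA -exprS.
Qed.

Definition ordered_word r s : seq 'I_2 := nseq r letter_u ++ nseq s letter_v.

Lemma ordered_wordE r s : pr (word (ordered_word r s)) = umon r s.
Proof.
have pow k m : pr (word (nseq m k)) = pr (word [:: k]) ^+ m.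
  elim: m => [|m IHm]; first by rewrite word0 pr_one.
  by rewrite exprS -IHm -pr_mul word_cat.
by rewrite /ordered_word -word_cat pr_mul !pow.
Qed.

Lemma presented_skew_polynomial : skew_polynomial (- c) u v coef.
Proof.
apply: skew_polynomial_of_ind; rewrite ?oppr_eq0 //.
- move=> r s r' s'; rewrite -ordered_wordE coef_word /word_coef !count_cat.
  rewrite !count_nseq /= !mul0n !mul1n addn0 add0n.
  suff -> : inversions (ordered_word r s) = 0%N by case: ifP.
  rewrite /ordered_word; elim: r => [|r IHr] //=.
  by elim: s => [|s IHs] //=; rewrite IHs count_nseq /= mul0n.
- move=> P P0 Plin Pmon a; have [f ->] := pr_surj a.
  elim/word_ind: f => [|d f g Pf Pg|w]; first by rewrite pr0.
    by rewrite pr_lin; apply: Plin.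
  by have [d ->] := sorted_word w; rewrite -[_ *: _]addr0; apply: Plin.
Qed.

(** Words of length [m] map to the monomials of degree [m], so the grading by
    word length descends to the one by exponents. *)
Lemma presented_grading (G : F -> Prop) (m : nat) :
  G 0 -> (forall d f g, G f -> G g -> G (d *: f + g)) ->
  (forall w, size w = m -> G (word w)) ->
  (forall (P : F -> Prop), P 0 ->
    (forall d f g, P f -> P g -> P (d *: f + g)) ->
    (forall w, size w = m -> P (word w)) -> forall f, G f -> P f) ->
  forall a, (exists2 f, G f & pr f = a) <-> homog coef 1 1 m a.
Proof.
have Acf := presented_skew_polynomial.
move=> G0 Glin Gword G_ind a; split=> [[f Gf <-]|a_m].
  elim/G_ind: Gf => [|d g h g_m h_m|w w_m].
  - by rewrite pr0; apply: (homog0 Acf).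
  - by rewrite pr_lin; apply: (homog_lin Acf).
  move=> r s; rewrite coef_word /word_coef; case: ifP => [/andP[/eqP<- /eqP<-] _|_].
    rewrite !mul1n -w_m; congr (Posz _); elim: (w) => //= k l IHl.
    by case: (letterP k) => ->; rewrite /= ?add0n ?add1n -IHl // addnS.
  by rewrite eqxx.
elim/(homog_ind Acf): a_m => [|d x y [f fm <-] [g gm <-]|r s rs_m].
- by exists 0.
- by exists (d *: f + g); rewrite ?pr_lin //; apply: Glin.
exists (word (ordered_word r s)); last exact: ordered_wordE.
apply: Gword; rewrite size_cat !size_nseq.
by move/eqP: rs_m; rewrite !mul1n eqz_nat => /eqP.
Qed.

End Presentation.

Section SkewPlane.

Variables (K : fieldType) (c : K).
Hypothesis c0 : c != 0.

Local Notation F := (free_alg K).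
Local Notation Q := (skew_plane c).
Local Notation word_coef := (word_coef c).

Definition word (s : seq 'I_2) : F := mkmalgU (FMonom s) 1.

Lemma word_cat s t : word s * word t = word (s ++ t).
Proof. by rewrite [LHS]fgmulUU mulr1 [mmul _ _]fmmulE. Qed.

Lemma word0 : word [::] = 1.
Proof. by rewrite [RHS]/(mkmalgU mone 1) [mone]fmoneE. Qed.

Lemma word1 k : word [:: k] = free_gen K k.
Proof. by rewrite /free_gen fmuE. Qed.

Lemma monomial_word k d : mkmalgU k d = d *: word (fmonom_val k) + 0 :> F.
Proof.
rewrite addr0; apply/malgP => k'; rewrite mcoeffZ !mcoeffU; case: k => s.
by case: eqP; rewrite ?mulr1 ?mulr0.
Qed.

Lemma free_ind (P : F -> Prop) : P 0 ->
  (forall d f g, P f -> P g -> P (d *: f + g)) -> (forall s, P (word s)) ->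
  forall f, P f.
Proof.
move=> P0 Plin Pword f; rewrite [f]monalgE.
elim/big_ind: _ => // [g h Pg Ph|k _]; first by rewrite -[g]scale1r; apply: Plin.
by rewrite monomial_word; apply: Plin.
Qed.

Definition free_coef r s (f : F) : K :=
  mmap idfun (fun w : fmonom 'I_2 => word_coef r s (fmonom_val w)) f.

Lemma free_coefD r s f g : free_coef r s (f + g) = free_coef r s f + free_coef r s g.
Proof. exact: raddfD. Qed.

Lemma free_coefZ r s d f : free_coef r s (d *: f) = d * free_coef r s f.
Proof.
rewrite /free_coef (mmapEw (msuppZ_le d f)) mmapE mulr_sumr.
by apply: eq_bigr => w _; rewrite /= mcoeffZ mulrA.
Qed.

Lemma free_coef_word r s w : free_coef r s (word w) = word_coef r s w.
Proof. by rewrite /free_coef mmapU mul1r. Qed.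

Lemma free_coef_ideal r s f : f \in gen_ideal (skew_relator c) -> free_coef r s f = 0.
Proof.
rewrite /skew_relator -!word1; apply: (word_coef_ideal word_cat free_ind).
  by move=> d g h; rewrite free_coefD free_coefZ.
exact: free_coef_word.
Qed.

Definition skew_coef (a : Q) (r s : nat) : K :=
  free_coef r s (repr (a : Quotient.quot (gen_ideal (skew_relator c)))).

Lemma skew_coef_proj f r s : skew_coef (skew_proj c f) r s = free_coef r s f.
Proof.
apply/eqP; rewrite -subr_eq0; apply/eqP.
rewrite -[- _]mulN1r -free_coefZ -free_coefD scaleN1r.
exact/free_coef_ideal/quot_repP.
Qed.

Lemma skew_projD f g : skew_proj c (f + g) = skew_proj c f + skew_proj c g.
Proof. exact: quot_projD. Qed.

Lemma skew_projZ d f : skew_proj c (d *: f) = d *: skew_proj c f.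
Proof. exact: quot_projZ. Qed.

Lemma skew_projM f g : skew_proj c (f * g) = skew_proj c f * skew_proj c g.
Proof. exact: quot_projM. Qed.

Lemma skew_proj1 : skew_proj c 1 = 1.
Proof. by []. Qed.

Lemma skew_proj_surj (a : Q) : exists f, a = skew_proj c f.
Proof. by exists (repr (a : Quotient.quot _)); rewrite /skew_proj quot_projK. Qed.

Lemma skew_coefD a b r s : skew_coef (a + b) r s = skew_coef a r s + skew_coef b r s.
Proof.
have [f ->] := skew_proj_surj a; have [g ->] := skew_proj_surj b.
by rewrite -skew_projD !skew_coef_proj free_coefD.
Qed.

Lemma skew_coefZ d a r s : skew_coef (d *: a) r s = d * skew_coef a r s.
Proof.
have [f ->] := skew_proj_surj a.
by rewrite -skew_projZ !skew_coef_proj free_coefZ.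
Qed.

Lemma skew_coef_linear r s : linear (fun a => skew_coef a r s : K^o).
Proof. by move=> d a b; rewrite skew_coefD skew_coefZ. Qed.

Lemma skew_coef_word w r s : skew_coef (skew_proj c (word w)) r s = word_coef r s w.
Proof. by rewrite skew_coef_proj free_coef_word. Qed.

Lemma skew_proj_lin d f g :
  skew_proj c (d *: f + g) = d *: skew_proj c f + skew_proj c g.
Proof. by rewrite skew_projD skew_projZ. Qed.

Lemma skew_proj_rel : skew_proj c (c *: (word [:: letter_u] * word [:: letter_v]) +
  word [:: letter_v] * word [:: letter_u]) = 0.
Proof.
rewrite !word1; apply: (etrans (y := skew_proj c 0)).
  apply/quot_projP; rewrite subr0; apply/asboolP.
  by exists [:: (1, 1)]; rewrite big_seq1 mul1r mulr1.
by rewrite -[in LHS](scale0r 0) skew_projZ scale0r.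
Qed.

Theorem skew_plane_polynomial :
  skew_polynomial (- c) (skew_u c) (skew_v c) skew_coef.
Proof.
have := presented_skew_polynomial c0 word_cat word0 free_ind skew_proj_lin
  skew_projM skew_proj1 skew_proj_surj skew_proj_rel skew_coef_linear skew_coef_word.
by rewrite !word1.
Qed.

Theorem skew_grading_homog m (a : Q) :
  skew_grading m a <-> homog skew_coef 1 1 m a.
Proof.
apply: (presented_grading c0 word_cat word0 free_ind skew_proj_lin
  skew_projM skew_proj1 skew_proj_surj skew_proj_rel skew_coef_linear skew_coef_word
  (G := free_homogeneous m)).
- by move=> w; rewrite mcoeff0 eqxx.
- move=> d f g f_m g_m w; rewrite mcoeffD mcoeffZ.
  by have [->|/f_m //] := eqVneq (mcoeff w f) 0; rewrite mulr0 add0r => /g_m.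
- move=> w w_m w'; rewrite mcoeffU.
  by case: (FMonom w =P w') => [<- _|]; [exact: w_m | rewrite eqxx].
move=> P P0 Plin Pword f f_m; rewrite [f]monalgE.
rewrite big_seq_cond; elim/big_ind: _ => // [g h Pg Ph|k].
  by rewrite -[g]scale1r; apply: Plin.
rewrite andbT -mcoeff_neq0 => /f_m k_m.
by rewrite monomial_word; apply: Plin => //; apply: Pword.
Qed.

End SkewPlane.

(** * Roots of unity *)

Section RootsOfUnity.

Variable R : realType.
Local Notation C := (complex R).

Lemma cisD (a b : R) : cis (a + b) = cis a * cis b.
Proof.
rewrite /cis cosD sinD; apply/eqP; rewrite eq_complex /= eqxx /=.
by rewrite addrC.
Qed.

Lemma cis0 : cis (0 : R) = 1.
Proof. by rewrite /cis cos0 sin0. Qed.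

Lemma cisX (a : R) k : cis a ^+ k = cis (a *+ k).
Proof.
by elim: k => [|k IHk]; rewrite ?expr0 ?cis0 // exprS IHk -cisD -mulrS.
Qed.

Lemma cis_pi : cis (pi : R) = -1.
Proof. by apply/eqP; rewrite eq_complex /= cospi sinpi oppr0 !eqxx. Qed.

Variable n : nat.
Hypothesis n_ge2 : (2 <= n)%N.

Let n_gt0 : (0 < n)%N := ltnW n_ge2.
Let nR0 : n%:R != 0 :> R. Proof. by rewrite pnatr_eq0 -lt0n. Qed.
Local Notation q := (unity_root R n).
Local Notation p := (neg_half_root R n).

Lemma neg_half_root_sqr : p ^+ 2 = q.
Proof. by rewrite /neg_half_root sqrrN cisX /unity_root -[_ *+ 2]mulr_natl mulrA. Qed.

Lemma neg_half_root_exp : p ^+ n = (-1) ^+ n.+1.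
Proof.
rewrite /neg_half_root [LHS]exprNn cisX -[_ *+ n]mulr_natr divfK // cis_pi.
by rewrite exprSr.
Qed.

Lemma neg_half_root_neq0 : p != 0.
Proof.
apply/eqP => p0; have /eqP := neg_half_root_exp.
by rewrite p0 expr0n gtn_eqF // eq_sym signr_eq0.
Qed.

Lemma unity_root_exp : q ^+ n = 1.
Proof. by rewrite -neg_half_root_sqr exprAC neg_half_root_exp sqrr_sign. Qed.

(** If $q^m=1$ with $0<m<n$, then $e^{\pi\sqrt{-1}\,m/n}$ has square $1$ and is
    real, but its imaginary part $\sin(\pi m/n)$ is positive. *)
Lemma unity_root_prim : n.-primitive_root q.
Proof.
have [m m_prim m_n] := prim_order_exists n_gt0 unity_root_exp.
suff mn_eq : m = n by rewrite mn_eq in m_prim.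
apply/eqP; rewrite eqn_leq dvdn_leq //= leqNgt; apply/negP => mn.
have m_gt0 : (0 < m)%N := prim_order_gt0 m_prim.
pose a : R := pi * m%:R / n%:R.
have : cis a ^+ 2 = 1.
  rewrite cisX -(prim_expr_order m_prim) /unity_root cisX; congr cis.
  by rewrite /a -[LHS]mulr_natl -[RHS]mulr_natr !mulrA [RHS]mulrAC.
move/eqP; rewrite sqrf_eq1 => a_real.
have : 0 < sin a.
  apply: sin_gt0_pi; rewrite /a divr_gt0 ?mulr_gt0 ?pi_gt0 ?ltr0n //=.
  by rewrite ltr_pdivrMr ?ltr0n // ltr_pM2l ?pi_gt0 // ltr_nat.
suff -> : sin a = 0 by rewrite ltxx.
by case/orP: a_real; rewrite eq_complex /= => /andP[_ /eqP] //; rewrite oppr0.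
Qed.

End RootsOfUnity.

(** * The action on the skew plane *)

Section RootSums.

Variables (F : fieldType) (n : nat) (q : F).
Hypothesis q_prim : n.-primitive_root q.

Lemma prim_root_neq0 : q != 0.
Proof.
apply/eqP => q0; have /eqP := prim_expr_order q_prim.
by rewrite q0 expr0n gtn_eqF ?(prim_order_gt0 q_prim) // eq_sym oner_eq0.
Qed.

Lemma sum_powers (w : F) : w ^+ n = 1 ->
  \sum_(r < n) w ^+ r = if w == 1 then n%:R else 0.
Proof.
move=> wn; case: eqP => [->|/eqP w1].
  by rewrite (eq_bigr (fun=> 1)) ?sumr_const ?card_ord // => r _; rewrite expr1n.
apply/eqP; have /eqP := subrX1 w n.
by rewrite wn subrr eq_sym mulf_eq0 subr_eq0 (negbTE w1).
Qed.

Lemma sum_character (k l : nat) :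
  \sum_(r < n) q ^- (r * l) * q ^+ (k * r) =
  if k == l %[mod n] then n%:R else 0.
Proof.
have q0 := prim_root_neq0.
rewrite (eq_bigr (fun r : 'I_n => (q ^+ k / q ^+ l) ^+ r)) => [|r _]; last first.
  by rewrite expr_div_n -!exprM mulrC [(r * l)%N]mulnC.
rewrite sum_powers; last first.
  by rewrite expr_div_n ![q ^+ _ ^+ n]exprAC (prim_expr_order q_prim) !expr1n divr1.
rewrite -(eq_prim_root_expr q_prim) -(inj_eq (mulIf (expf_neq0 l q0))) divfK ?mul1r //.
exact: expf_neq0.
Qed.

(** The discrete Fourier transform of a character, followed by its inverse. *)
Lemma double_sum_character (a b : nat) :
  \sum_(t : 'I_n * 'I_n) q ^- (t.1 * t.2) * q ^+ (a * t.1) * q ^+ (b * t.2) =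
  n%:R * q ^+ (a * b).
Proof.
rewrite -(pair_bigA _ (fun r s : 'I_n =>
  q ^- (r * s) * q ^+ (a * r) * q ^+ (b * s))) /= exchange_big /=.
have an : (a %% n < n)%N by rewrite ltn_mod (prim_order_gt0 q_prim).
rewrite (bigD1 (Ordinal an)) //= [X in _ + X]big1 ?addr0 => [|s sa].
  rewrite -mulr_suml sum_character modn_mod eqxx; congr (_ * _).
  by rewrite /= mulnC exprM (prim_expr_mod q_prim) -exprM.
rewrite -mulr_suml sum_character; case: eqP => [e|]; last by rewrite mul0r.
by case/eqP: sa; apply/val_inj; rewrite /= e modn_small.
Qed.

End RootSums.

Section BilinearSums.

Variable R : realType.
Local Notation C := (complex R).
Variables (H : algType C) (Hs : hopf_algebra H) (A : algType C).
Variable M : module_algebra Hs A.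

Lemma act_linear h : linear (M h : A -> A).
Proof. by case: (act_bilinear M). Qed.

Lemma act_linear_l a : linear (fun h => M h a).
Proof. by case: (act_bilinear M). Qed.

Lemma actD h a b : M h (a + b) = M h a + M h b.
Proof. by have := act_linear h 1 a b; rewrite !scale1r. Qed.

Lemma act0 h : M h 0 = 0.
Proof. by apply: (addrI (M h 0)); rewrite -actD !addr0. Qed.

Lemma actZ h d a : M h (d *: a) = d *: M h a.
Proof. by have := act_linear h d a 0; rewrite !addr0 act0 addr0. Qed.

Lemma actN h a : M h (- a) = - M h a.
Proof. by rewrite -scaleN1r actZ scaleN1r. Qed.

Lemma actDl g h a : M (g + h) a = M g a + M h a.
Proof. by have := act_linear_l a 1 g h; rewrite !scale1r. Qed.

Lemma act0l a : M 0 a = 0.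
Proof. by apply: (addrI (M 0 a)); rewrite -actDl !addr0. Qed.

Lemma actZl d h a : M (d *: h) a = d *: M h a.
Proof. by have := act_linear_l a d h 0; rewrite !addr0 act0l addr0. Qed.

Lemma act_suml (I : Type) (s : seq I) (P : pred I) (F : I -> H) a :
  M (\sum_(t <- s | P t) F t) a = \sum_(t <- s | P t) M (F t) a.
Proof. by elim/big_rec2: _ => [|t b h _ <-]; rewrite ?act0l ?actDl. Qed.

Lemma counitD g h : counit Hs (g + h) = counit Hs g + counit Hs h.
Proof. by have := counit_linear Hs 1 g h; rewrite !scale1r. Qed.

Lemma counit0 : counit Hs 0 = 0.
Proof. by apply: (addrI (counit Hs 0)); rewrite -counitD !addr0. Qed.

Lemma counitZ d h : counit Hs (d *: h) = d * counit Hs h.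
Proof. by have := counit_linear Hs d h 0; rewrite !addr0 counit0 addr0. Qed.

Lemma counit_sum (I : Type) (s : seq I) (P : pred I) (F : I -> H) :
  counit Hs (\sum_(t <- s | P t) F t) = \sum_(t <- s | P t) counit Hs (F t).
Proof. by elim/big_rec2: _ => [|t b h _ <-]; rewrite ?counit0 ?counitD. Qed.

Lemma counitX h k : counit Hs h = 1 -> counit Hs (h ^+ k) = 1.
Proof.
move=> h1; elim: k => [|k IHk]; first by rewrite expr0 counit_one.
by rewrite exprS counit_mul h1 IHk mulr1.
Qed.

Lemma act_mul_tensor h s a b : tensor_eq (comul Hs h) s ->
  M h (a * b) = \sum_(t <- s) M t.1 a * M t.2 b.
Proof.
move=> hs; rewrite act_mul; apply: (hs A (fun g h => M g a * M h b)).
split=> [g|g] d k l.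
  by rewrite act_linear_l mulrDl scalerAl.
by rewrite act_linear_l mulrDr scalerAr.
Qed.

Lemma act_grouplike g a b : tensor_eq (comul Hs g) [:: (g, g)] ->
  M g (a * b) = M g a * M g b.
Proof. by move/act_mul_tensor->; rewrite big_seq1. Qed.

Lemma act_exp g d a k : M g a = d *: a -> M (g ^+ k) a = d ^+ k *: a.
Proof.
move=> ga; elim: k => [|k IHk]; first by rewrite !expr0 act1 scale1r.
by rewrite exprS actM IHk actZ ga scalerA -exprSr.
Qed.

End BilinearSums.

Section Action.

Variables (R : realType) (n i j : nat).
Local Notation C := (complex R).
Hypotheses (n_ge2 : (2 <= n)%N) (co_ijn : coprimez (i%:Z ^+ 2 - j%:Z ^+ 2) n%:Z).
Variables (H : algType C) (Hs : hopf_algebra H) (x y z : H).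
Hypothesis Hn : is_H2n2 n Hs x y z.
Variables (A : algType C) (u v : A) (cf : A -> nat -> nat -> C).
Variable M : module_algebra Hs A.
Hypothesis M_pi : acts_by_pi n i j x y z M u v.

Local Notation q := (unity_root R n).
Local Notation p := (neg_half_root R n).
Local Notation mon := (mon u v).

Let n_gt0 : (0 < n)%N := ltnW n_ge2.
Let nC0 : n%:R != 0 :> C. Proof. by rewrite pnatr_eq0 -lt0n. Qed.
Let q_prim := unity_root_prim R n_ge2.
Let q0 : q != 0 := prim_root_neq0 q_prim.

Local Notation lam := (- p ^ (i%:Z ^+ 2 - j%:Z ^+ 2)).
Hypothesis Acf : skew_polynomial lam u v cf.

Definition weighted (a b : nat) (f : A) : Prop :=
  M x f = q ^+ a *: f /\ M y f = q ^+ b *: f.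

Lemma act_xM a b : M x (a * b) = M x a * M x b.
Proof. exact/act_grouplike/(H2n2_comul_x Hn). Qed.

Lemma act_yM a b : M y (a * b) = M y a * M y b.
Proof. exact/act_grouplike/(H2n2_comul_y Hn). Qed.

Lemma act_unit h : counit Hs h = 1 -> M h 1 = 1.
Proof. by move=> h1; rewrite act_one h1 scale1r. Qed.

Lemma weightedM a b a' b' f g :
  weighted a b f -> weighted a' b' g -> weighted (a + a') (b + b') (f * g).
Proof.
move=> [xf yf] [xg yg]; split.
  by rewrite act_xM xf xg -scalerAl -scalerAr scalerA -exprD.
by rewrite act_yM yf yg -scalerAl -scalerAr scalerA -exprD.
Qed.

Lemma weighted1 : weighted 0 0 1.
Proof.
by split; rewrite expr0 scale1r act_unit ?(H2n2_counit_x Hn) ?(H2n2_counit_y Hn).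
Qed.

Lemma weightedX a b f k : weighted a b f -> weighted (k * a) (k * b) (f ^+ k).
Proof.
move=> wf; elim: k => [|k IHk]; first exact: weighted1.
by rewrite exprS !mulSn; apply: weightedM.
Qed.

Lemma weighted_u : weighted i j u.
Proof. by split; [apply: (pi_xu M_pi) | apply: (pi_yu M_pi)]. Qed.

Lemma weighted_v : weighted j i v.
Proof. by split; [apply: (pi_xv M_pi) | apply: (pi_yv M_pi)]. Qed.

Lemma weighted_mon r s : weighted (r * i + s * j) (r * j + s * i) (mon r s).
Proof.
by apply: weightedM; apply: weightedX; [apply: weighted_u | apply: weighted_v].
Qed.

Lemma act_zx a : M z (M x a) = M y (M z a).
Proof. by rewrite -!actM (H2n2_zx Hn). Qed.

Lemma act_zy a : M z (M y a) = M x (M z a).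
Proof. by rewrite -!actM (H2n2_zy Hn). Qed.

(** The twist $J$ acts on a product of weight vectors by a single root of unity:
    the double sum over $r$ and $s$ is a discrete Fourier transform followed by
    its inverse. *)
Lemma act_zM a b f g : M y f = q ^+ a *: f -> M x g = q ^+ b *: g ->
  M z (f * g) = q ^+ (a * b) *: (M z f * M z g).
Proof.
move=> yf xg; rewrite (act_mul_tensor _ _ _ (H2n2_comul_z Hn)) big_map big_enum /=.
have zf : M x (M z f) = q ^+ a *: M z f by rewrite -act_zy yf actZ.
have zg : M y (M z g) = q ^+ b *: M z g by rewrite -act_zx xg actZ.
under eq_bigr => t _.
  rewrite actZl !actM (act_exp _ zf) (act_exp _ zg) scalerA -scalerAl -scalerAr.
  rewrite scalerA -!exprM -[_ * _ * _]mulrA -[_ * _ * _]mulrA [q ^- _ * _]mulrA.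
  over.
rewrite -scaler_suml -mulr_sumr double_sum_character ?mulrA ?mulVf ?mul1r //.
Qed.

Lemma act_z_u a : M z (u ^+ a) = q ^+ (i * j * 'C(a.+1, 2)) *: v ^+ a.
Proof.
elim: a => [|a IHa].
  by rewrite !expr0 bin_small // muln0 expr0 scale1r act_unit ?(H2n2_counit_z Hn).
rewrite exprS (act_zM (pi_yu M_pi) (weightedX a weighted_u).1) IHa (pi_zu M_pi).
rewrite -scalerAl -scalerAr !scalerA -!exprD -exprS; congr (q ^+ _ *: _).
rewrite [in RHS]binS bin1; nia.
Qed.

Lemma act_z_v b : M z (v ^+ b) = q ^+ (i * j * 'C(b, 2)) *: u ^+ b.
Proof.
elim: b => [|b IHb].
  by rewrite !expr0 muln0 expr0 scale1r act_unit ?(H2n2_counit_z Hn).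
rewrite exprS (act_zM (pi_yv M_pi) (weightedX b weighted_v).1) IHb (pi_zv M_pi).
rewrite -scalerAr !scalerA -!exprD -exprS; congr (q ^+ _ *: _).
rewrite [in RHS]binS bin1; nia.
Qed.

Lemma act_z_mon a b : exists2 d, d != 0 & M z (mon a b) = d *: mon b a.
Proof.
rewrite /mon (act_zM (weightedX a weighted_u).2 (weightedX b weighted_v).1).
rewrite act_z_u act_z_v -scalerAl -scalerAr (skew_comm_exp Acf) !scalerA.
by eexists; last reflexivity; rewrite !mulf_neq0 ?expf_neq0 ?(skew_c_neq0 Acf).
Qed.

(** The determinant $i^2-j^2$ of this system is invertible modulo [n]. *)
Lemma weights_inj (a b : int) : (n%:Z %| a * i%:Z + b * j%:Z)%Z ->
  (n%:Z %| a * j%:Z + b * i%:Z)%Z -> (n%:Z %| a)%Z /\ (n%:Z %| b)%Z.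
Proof.
move=> h1 h2; pose d := i%:Z ^+ 2 - j%:Z ^+ 2.
have co : coprimez n%:Z d by rewrite coprimez_sym.
have ad : a * d = (a * i%:Z + b * j%:Z) * i%:Z - (a * j%:Z + b * i%:Z) * j%:Z.
  by rewrite /d; ring.
have bd : b * d = (a * j%:Z + b * i%:Z) * i%:Z - (a * i%:Z + b * j%:Z) * j%:Z.
  by rewrite /d; ring.
split; rewrite -(Gauss_dvdzl _ co) ?ad ?bd; apply: rpredB; exact: dvdz_mulr.
Qed.

(** If $i$ and $j$ were odd, then $2$ would divide both $i^2-j^2$ and $n$. *)
Lemma parity_ij : ~~ odd n -> ~~ odd (i * j).
Proof.
move=> n_even; apply/negP; rewrite oddM => /andP[i_odd j_odd].
have d2 : (2 %| i%:Z ^+ 2 - j%:Z ^+ 2)%Z.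
  rewrite subr_sqr; apply: dvdz_mull.
  by rewrite -PoszD dvdzE /= dvdn2 oddD i_odd j_odd.
have : (2 %| gcdz (i%:Z ^+ 2 - j%:Z ^+ 2) n%:Z)%Z.
  by rewrite dvdz_gcd d2 dvdzE /= dvdn2.
by move: co_ijn; rewrite /coprimez => /eqP ->.
Qed.

Local Notation X := (u ^+ n).
Local Notation Y := (v ^+ n).

Lemma dvdn_binomial : (n %| i * j * 'C(n, 2))%N.
Proof.
have [n_odd|n_even] := boolP (odd n).
  by rewrite bin2odd // mulnCA dvdn_mulr.
have /even_halfK <- := parity_ij n_even; rewrite -muln2 -mulnA dvdn_mull // bin2.
rewrite mul2n even_halfK ?dvdn_mulr // -subn1.
by rewrite oddM (negbTE n_even).
Qed.

Lemma q_multiple k : (n %| k)%N -> q ^+ k = 1.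
Proof. by rewrite (prim_order_dvd q_prim) => /eqP. Qed.

Lemma act_z_X : M z X = Y.
Proof.
rewrite act_z_u q_multiple ?scale1r // binS bin1 mulnDr dvdn_add //.
  exact: dvdn_binomial.
by rewrite dvdn_mull.
Qed.

Lemma act_z_Y : M z Y = X.
Proof. by rewrite act_z_v q_multiple ?scale1r // dvdn_binomial. Qed.

Lemma lam_exp : lam ^+ (n * n) = (-1) ^+ n.
Proof.
have pz (d : int) (w : C) k : (w ^ d) ^+ k = (w ^+ k) ^ d.
  by rewrite !exprnP exprzAC.
rewrite exprM [lam ^+ n]exprNn exprMn pz (neg_half_root_exp R n_ge2).
have [n_odd|n_even] := boolP (odd n).
  rewrite -[(-1) ^+ n.+1]signr_odd /= n_odd /= expr0 exp1rz expr1n mulr1.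
  by rewrite -[(-1) ^+ n]signr_odd n_odd expr1 -signr_odd n_odd.
rewrite -[(-1) ^+ n]signr_odd (negbTE n_even) expr0 expr1n mul1r.
set w := _ ^ _; have w2 : w ^+ 2 = 1 by rewrite pz sqrr_sign exp1rz.
by rewrite -[X in _ ^+ X](even_halfK n_even) -mul2n exprM w2 expr1n.
Qed.

Lemma XY_skew_comm : Y * X = (-1) ^+ n *: (X * Y).
Proof. by rewrite (skew_comm_exp Acf) lam_exp. Qed.

Definition torus_fixed (f : A) : Prop := M x f = f /\ M y f = f.

Lemma torus_fixed_weighted f : torus_fixed f -> weighted 0 0 f.
Proof. by case=> xf yf; split; rewrite expr0 scale1r. Qed.

Lemma torus_fixedM f g : torus_fixed f -> torus_fixed g -> torus_fixed (f * g).
Proof. by move=> [xf yf] [xg yg]; split; rewrite ?act_xM ?act_yM ?xf ?yf ?xg ?yg. Qed.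

Lemma torus_fixed_lin d f g : torus_fixed f -> torus_fixed g -> torus_fixed (d *: f + g).
Proof. by move=> [xf yf] [xg yg]; split; rewrite actD actZ ?xf ?yf ?xg ?yg. Qed.

Lemma torus_fixed_X : torus_fixed X.
Proof.
have [xX yX] := weightedX n weighted_u.
by split; rewrite ?xX ?yX q_multiple ?scale1r ?dvdn_mulr.
Qed.

Lemma torus_fixed_Y : torus_fixed Y.
Proof.
have [xY yY] := weightedX n weighted_v.
by split; rewrite ?xY ?yY q_multiple ?scale1r ?dvdn_mulr.
Qed.

Lemma act_z_fixedM f g : torus_fixed f -> torus_fixed g ->
  M z (f * g) = M z f * M z g.
Proof.
move=> /torus_fixed_weighted[_ yf] /torus_fixed_weighted[xg _].
by rewrite (act_zM yf xg) expr0 scale1r.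
Qed.

Lemma cf_act_x f r s : cf (M x f) r s = q ^+ (r * i + s * j) * cf f r s.
Proof.
elim/(skew_ind Acf): f => [|d f g IHf IHg|r' s'].
- by rewrite act0 (cf0 Acf) mulr0.
- by rewrite actD actZ !(cfD Acf) !(cfZ Acf) IHf IHg mulrDr mulrCA.
rewrite (weighted_mon r' s').1 (cfZ Acf) (skew_cf_mon Acf).
by case: (r' =P r) => [->|_]; case: (s' =P s) => [->|_] //=; rewrite !mulr0.
Qed.

Lemma cf_act_y f r s : cf (M y f) r s = q ^+ (r * j + s * i) * cf f r s.
Proof.
elim/(skew_ind Acf): f => [|d f g IHf IHg|r' s'].
- by rewrite act0 (cf0 Acf) mulr0.
- by rewrite actD actZ !(cfD Acf) !(cfZ Acf) IHf IHg mulrDr mulrCA.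
rewrite (weighted_mon r' s').2 (cfZ Acf) (skew_cf_mon Acf).
by case: (r' =P r) => [->|_]; case: (s' =P s) => [->|_] //=; rewrite !mulr0.
Qed.

(** By [weights_inj], a monomial fixed by [x] and [y] is one in $u^n$ and
    $v^n$. *)
Lemma torus_fixed_ind (P : A -> Prop) : P 0 ->
  (forall d f g, P f -> P g -> P (d *: f + g)) ->
  (forall r s, P (X ^+ r * Y ^+ s)) -> forall f, torus_fixed f -> P f.
Proof.
move=> P0 Plin PXY f [xf yf]; apply: (support_ind Acf) => // r s frs.
have weight_0 k : q ^+ k * cf f r s = cf f r s -> (n%:Z %| k%:Z)%Z.
  move=> e; rewrite dvdzE /= (prim_order_dvd q_prim) -subr_eq0.
  have /eqP : (q ^+ k - 1) * cf f r s = 0 by rewrite mulrBl e mul1r subrr.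
  by rewrite mulf_eq0 (negbTE frs) orbF.
have [] := @weights_inj r s.
- by rewrite -!PoszM -PoszD; apply: weight_0; rewrite -cf_act_x xf.
- by rewrite -!PoszM -PoszD; apply: weight_0; rewrite -cf_act_y yf.
rewrite !dvdzE /= => /dvdnP[k ->] /dvdnP[l ->].
by rewrite /mon ![(_ * n)%N]mulnC !exprM.
Qed.

Lemma H_basis_sum (h : H) : exists c : 'I_n * 'I_n * 'I_2 -> C,
  h = \sum_t c t *: (x ^+ t.1.1 * y ^+ t.1.2 * z ^+ t.2).
Proof. by have [c [hE _]] := H2n2_basis Hn h; exists c. Qed.

Lemma invariantsP f : f \in invariants M <-> torus_fixed f /\ M z f = f.
Proof.
split=> [/asboolP f_inv|[[xf yf] zf]].
  by do !split; rewrite f_inv ?(H2n2_counit_x Hn) ?(H2n2_counit_y Hn) ?(H2n2_counit_z Hn) scale1r.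
apply/asboolP => h; have [c ->] := H_basis_sum h.
rewrite act_suml counit_sum scaler_suml; apply: eq_bigr => t _.
have fixedX g k : M g f = f -> M (g ^+ k) f = f.
  move=> gf; rewrite (@act_exp _ _ _ _ _ g 1) ?expr1n ?scale1r //.
rewrite actZl !actM !fixedX // counitZ !counit_mul.
by rewrite !counitX ?mulr1 ?(H2n2_counit_x Hn) ?(H2n2_counit_y Hn) ?(H2n2_counit_z Hn).
Qed.

Lemma act_homog h t f : homog cf 1 1 t f -> homog cf 1 1 t (M h f).
Proof.
have [c ->] := H_basis_sum h => f_t; rewrite act_suml.
have hsum (I : Type) (l : seq I) (F : I -> A) :
    (forall k, homog cf 1 1 t (F k)) -> homog cf 1 1 t (\sum_(k <- l) F k).
  move=> F_t; elim/big_rec: _ => [|k g _ g_t]; first exact: (homog0 Acf).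
  by rewrite -[F k]scale1r; apply: (homog_lin Acf).
apply: hsum => -[[r s] k] /=; rewrite actZl !actM; apply: (homogZ Acf).
have powers g m a : (forall b, homog cf 1 1 t b -> homog cf 1 1 t (M g b)) ->
    homog cf 1 1 t a -> homog cf 1 1 t (M (g ^+ m) a).
  move=> g_t; elim: m a => [|m IHm] a a_t; first by rewrite expr0 act1.
  by rewrite exprSr actM; apply/IHm/g_t.
have x_t b : homog cf 1 1 t b -> homog cf 1 1 t (M x b).
  by move=> b_t r' s'; rewrite cf_act_x mulf_eq0 negb_or => /andP[_ /b_t].
have y_t b : homog cf 1 1 t b -> homog cf 1 1 t (M y b).
  by move=> b_t r' s'; rewrite cf_act_y mulf_eq0 negb_or => /andP[_ /b_t].
have z_t b : homog cf 1 1 t b -> homog cf 1 1 t (M z b).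
  move=> b_t; elim/(homog_ind Acf): b_t => [|d a a' a_t a'_t|r' s' rs_t].
  - by rewrite act0; apply: (homog0 Acf).
  - by rewrite actD actZ; apply: (homog_lin Acf).
  have [d _ ->] := act_z_mon r' s'; apply: (homogZ Acf).
  by rewrite -rs_t !mul1n addnC -{1}[s']mul1n -{1}[r']mul1n; apply: (homog_mon Acf).
by do 3!apply: (powers _) => //.
Qed.

(** The characters of $(\mathbb{Z}/n)^2$ in these sums are pairwise distinct by
    [weights_inj], hence linearly independent. *)
Lemma fourier_inversion (e : 'I_n * 'I_n -> C) :
  (forall a b, \sum_t e t * (q ^+ (a * (t.1 * i + t.2 * j)) *
                             q ^+ (b * (t.1 * j + t.2 * i))) = 0) ->
  forall t, e t = 0.
Proof.
move=> e0 t0; pose a0 := (t0.1 * i + t0.2 * j)%N; pose b0 := (t0.1 * j + t0.2 * i)%N.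
have S0 : \sum_(p : 'I_n * 'I_n) \sum_t q ^- (p.1 * a0) * q ^- (p.2 * b0) *
    (e t * (q ^+ (p.1 * (t.1 * i + t.2 * j)) * q ^+ (p.2 * (t.1 * j + t.2 * i)))) = 0.
  by rewrite big1 // => p _; rewrite -mulr_sumr e0 mulr0.
rewrite exchange_big /= (bigD1 t0) //= in S0.
have inner t : \sum_(p : 'I_n * 'I_n) q ^- (p.1 * a0) * q ^- (p.2 * b0) *
      (e t * (q ^+ (p.1 * (t.1 * i + t.2 * j)) * q ^+ (p.2 * (t.1 * j + t.2 * i)))) =
    e t * ((if t.1 * i + t.2 * j == a0 %[mod n] then n%:R else 0) *
           (if t.1 * j + t.2 * i == b0 %[mod n] then n%:R else 0)).
  rewrite -!(sum_character q_prim) big_distrlr pair_bigA mulr_sumr /=.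
  apply: eq_bigr => p _; rewrite [(p.1 * (t.1 * _ + _))%N]mulnC.
  by rewrite [(p.2 * (t.1 * _ + _))%N]mulnC; ring.
move: S0; rewrite inner !eqxx big1 => [/eqP|t t_neq].
  by rewrite addr0 mulf_eq0 (negbTE (mulf_neq0 nC0 nC0)) orbF => /eqP.
rewrite inner; case: eqP => [ta|]; last by rewrite mul0r mulr0.
case: eqP => [tb|]; last by rewrite mulr0 mulr0.
have diff (k l : nat) : k = l %[mod n] -> (n%:Z %| k%:Z - l%:Z)%Z.
  by move=> kl; rewrite -eqz_mod_dvd !modz_nat kl.
have [] := @weights_inj (t.1%:Z - t0.1%:Z) (t.2%:Z - t0.2%:Z).
- by move/diff: ta; rewrite /a0 !PoszD !PoszM; congr (_ %| _)%Z; ring.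
- by move/diff: tb; rewrite /b0 !PoszD !PoszM; congr (_ %| _)%Z; ring.
rewrite -!eqz_mod_dvd !modz_nat !eqz_nat !modn_small ?ltn_ord // => /eqP e1 /eqP e2.
case/eqP: t_neq; case: t e1 e2 {ta tb} => t1 t2; case: t0 {a0 b0 inner} => s1 s2 /= e1 e2.
by congr pair; apply/val_inj.
Qed.

(** An element of [H] acts on [mon a b] by a combination of [mon a b] and its
    image under [z], a multiple of [mon b a].  Each of the two coefficients is a
    Fourier transform of one half of the coordinates of [h]. *)
Theorem act_faithful h : (forall f, M h f = 0) -> h = 0.
Proof.
move=> h0; have [c hE] := H_basis_sum h.
have hmon a b : M h (mon a b) =
    (\sum_t c (t, ord0) * (q ^+ (a * (t.1 * i + t.2 * j)) *
                          q ^+ (b * (t.1 * j + t.2 * i)))) *: mon a b +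
    (\sum_t c (t, ord_max) * (q ^+ (a * (t.1 * j + t.2 * i)) *
                             q ^+ (b * (t.1 * i + t.2 * j)))) *: M z (mon a b).
  have act_xy f d e r t : M x f = d *: f -> M y f = e *: f ->
      M (x ^+ r * y ^+ t) f = (d ^+ r * e ^+ t) *: f.
    by move=> xf yf; rewrite actM (act_exp _ yf) actZ (act_exp _ xf) scalerA mulrC.
  have [xm ym] := weighted_mon a b.
  have xz : M x (M z (mon a b)) = q ^+ (a * j + b * i) *: M z (mon a b).
    by rewrite -act_zy ym actZ.
  have yz : M y (M z (mon a b)) = q ^+ (a * i + b * j) *: M z (mon a b).
    by rewrite -act_zx xm actZ.
  have -> : M h (mon a b) = \sum_(t : 'I_n * 'I_n) \sum_(k < 2)
      M (c (t, k) *: (x ^+ t.1 * y ^+ t.2 * z ^+ k)) (mon a b).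
    by rewrite hE act_suml pair_bigA; apply: eq_bigr => -[[r t] k].
  rewrite !scaler_suml -big_split; apply: eq_bigr => -[r t] _ /=.
  rewrite big_ord_recl big_ord1 !actZl expr0 mulr1 (act_xy _ _ _ _ _ xm ym).
  rewrite [M (_ * z ^+ _) _]actM expr1 (act_xy _ _ _ _ _ xz yz) !scalerA.
  rewrite (_ : lift ord0 ord0 = ord_max); last exact/val_inj.
  by congr (_ *: _ + _ *: _); rewrite -!exprM -!exprD; congr (_ * q ^+ _); nia.
suff c0 t : c t = 0 by rewrite hE big1 // => t _; rewrite c0 scale0r.
have lin2 a b d e : a != b -> d *: mon a b + e *: M z (mon a b) = 0 -> d = 0 /\ e = 0.
  move=> ab; have [w w0 ->] := act_z_mon a b => de.
  have := congr1 (fun f => cf f a b) de; have := congr1 (fun f => cf f b a) de.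
  rewrite /= !(cf0 Acf) !(cfD Acf) !(cfZ Acf) !(skew_cf_mon Acf) !eqxx.
  rewrite (negbTE ab) eq_sym (negbTE ab) /= !mulr0 !mulr1 addr0 add0r => /eqP.
  by rewrite mulf_eq0 (negbTE w0) orbF => /eqP -> ->.
have key a b : (\sum_t c (t, ord0) * (q ^+ (a * (t.1 * i + t.2 * j)) *
                          q ^+ (b * (t.1 * j + t.2 * i))) = 0) /\
    (\sum_t c (t, ord_max) * (q ^+ (a * (t.1 * j + t.2 * i)) *
                             q ^+ (b * (t.1 * i + t.2 * j))) = 0).
  have periodic k l m : q ^+ ((k + n * l) * m) = q ^+ (k * m).
    by rewrite mulnDl exprD [X in _ * X]q_multiple ?mulr1 // -mulnA dvdn_mulr.
  (* A shift of [a] by a multiple of [n] changes no character value and makes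
     the exponents distinct, so that the two monomials are independent. *)
  have ab : (a + n * b.+1 != b)%N by apply/eqP; nia.
  have [] := lin2 _ _ _ _ ab (etrans (esym (hmon _ _)) (h0 _)).
  move=> e1 e2; split.
    by rewrite -[RHS]e1; apply: eq_bigr => t' _; rewrite periodic.
  by rewrite -[RHS]e2; apply: eq_bigr => t' _; rewrite periodic.
case: t => t [[|[|]]] // k_lt.
- rewrite (_ : Ordinal k_lt = ord0); last exact/val_inj.
  by apply: (fourier_inversion (e := fun t => c (t, ord0))) => a b; case: (key a b).
- rewrite (_ : Ordinal k_lt = ord_max); last exact/val_inj.
  apply: (fourier_inversion (e := fun t => c (t, ord_max))) => a b.
  have [_ e] := key b a; rewrite -[RHS]e; apply: eq_bigr => t' _; congr (_ * _).
  by rewrite mulrC.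
Qed.

Theorem action_inner_faithful : inner_faithful M.
Proof. by move=> I _ I0 h Ih; apply: act_faithful => f; apply: I0. Qed.

(** The coproduct formula and the antipode axiom express a one-sided inverse of
    [z] on each side. *)
Lemma z_invertible : exists w, w * z = 1 /\ z * w = 1.
Proof.
have [w wz] : exists w, w * z = 1.
  have := antipodel Hs z; rewrite (H2n2_counit_z Hn) scale1r.
  rewrite (H2n2_comul_z Hn (f := fun g h => antipode Hs g * h)); last first.
    split=> [h|g] d k l; first by rewrite (antipode_linear Hs) mulrDl scalerAl.
    by rewrite mulrDr scalerAr.
  rewrite big_map => <-.
  exists (\sum_(t <- enum {: 'I_n * 'I_n}) antipode Hs
    ((n%:R^-1 * q ^- (nat_of_ord t.1 * nat_of_ord t.2)) *: (x ^+ t.1 * z)) * y ^+ t.2).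
  by rewrite mulr_suml; apply: eq_bigr => t _; rewrite /= mulrA.
have [w' zw'] : exists w', z * w' = 1.
  have := antipoder Hs z; rewrite (H2n2_counit_z Hn) scale1r.
  rewrite (H2n2_comul_z Hn (f := fun g h => g * antipode Hs h)); last first.
    split=> [h|g] d k l; first by rewrite mulrDl scalerAl.
    by rewrite (antipode_linear Hs) mulrDr scalerAr.
  rewrite big_map => <-.
  have xz k : x ^+ k * z = z * y ^+ k.
    elim: k => [|k IHk]; first by rewrite !expr0 mulr1 mul1r.
    by rewrite !exprSr mulrA -IHk -mulrA -(H2n2_zy Hn) -mulrA (H2n2_zy Hn).
  exists (\sum_(t <- enum {: 'I_n * 'I_n})
    (n%:R^-1 * q ^- (nat_of_ord t.1 * nat_of_ord t.2)) *:
    (y ^+ t.1 * antipode Hs (y ^+ t.2 * z))).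
  rewrite mulr_sumr; apply: eq_bigr => t _ /=.
  by rewrite xz -scalerAl -scalerAr mulrA.
have e : w' = w by rewrite -[w']mul1r -wz -mulrA zw' mulr1.
by exists w; split=> //; rewrite -e.
Qed.

Lemma inv_nat_scale m : m%:R != 0 :> C -> (m%:R^-1 : C) *: (m%:R : H) = 1.
Proof. by move=> m0; rewrite -[X in _ *: X]scaler_nat scalerA mulVf // scale1r. Qed.

Section Maschke.

Variables V W : lmodType H.

Definition scalar_linear (r : V -> W) : Prop :=
  (forall a b, r (a + b) = r a + r b) /\
  forall (d : C) a, r (d%:A *: a) = d%:A *: r a.

(** Averaging a retraction over a cyclic group of order [n] keeps the
    equivariance already obtained under elements that commute with it. *)
Lemma cyclic_average (g : H) (r : V -> W) : g ^+ n = 1 -> scalar_linear r ->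
  exists r' : V -> W, [/\ scalar_linear r',
    forall a, r' (g *: a) = g *: r' a,
    forall h, h * g = g * h -> (forall a, r (h *: a) = h *: r a) ->
      forall a, r' (h *: a) = h *: r' a
  & forall (f : {linear W -> V}), cancel f r -> cancel f r'].
Proof.
move=> gn [rD rZ]; pose F a k := g ^+ (n - k) *: r (g ^+ k *: a).
pose r' a := (n%:R^-1 : C)%:A *: \sum_(k < n) F a k.
exists r'; split.
- split=> [a b|d a]; rewrite /r'.
    rewrite -scalerDr -big_split; congr (_ *: _); apply: eq_bigr => k _.
    by rewrite /F scalerDr rD scalerDr.
  rewrite [RHS]scalar_comm [X in _ = _ *: X]scaler_sumr; congr (_ *: _); apply: eq_bigr => k _.
  by rewrite /F scalar_comm rZ scalar_comm.
- move=> a; rewrite /r' [RHS]scalar_comm [X in _ = _ *: X]scaler_sumr; congr (_ *: _).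
  pose E k := g ^+ (n.+1 - k) *: r (g ^+ k *: a).
  have -> : \sum_(k < n) F (g *: a) k = \sum_(k < n) E k.+1.
    by apply: eq_bigr => k _; rewrite /F /E scalerA -exprSr subSS.
  have -> : \sum_(k < n) g *: F a k = \sum_(k < n) E k.
    apply: eq_bigr => k _; rewrite /F /E scalerA -exprS subSn //.
    exact: ltnW (ltn_ord k).
  have EnE0 : E n = E 0%N.
    by rewrite /E subSnn subn0 gn expr1 expr0 exprS gn mulr1.
  apply: (addrI (E 0%N)); rewrite -{2}EnE0 [RHS]addrC.
  by rewrite -(big_ord_recl n (fun k => E k)) big_ord_recr.
- move=> h hg rh a; rewrite /r' [RHS]scalar_comm [X in _ = _ *: X]scaler_sumr; congr (_ *: _).
  have hgk k : h * g ^+ k = g ^+ k * h by apply: commrX.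
  by apply: eq_bigr => k _; rewrite /F !scalerA -hgk -scalerA rh scalerA hgk.
- move=> f fr a; rewrite /r' (eq_bigr (fun=> a)) => [|k _].
    rewrite sumr_const card_ord -[a *+ n]scaler_nat scalerA mulr_algl.
    by rewrite inv_nat_scale // scale1r.
  by rewrite /F -linearZ fr scalerA -exprD subnK ?gn ?scale1r // ltnW.
Qed.

End Maschke.

(** A $\Bbbk$-linear retraction is averaged over $x$, then over $y$, and last over
    $z$ as $(r+z^{-1}rz)/2$.  The last step works because $z^2$ lies in the span of
    the $x^ry^s$, which already commute with $r$. *)
Theorem H2n2_semisimple : semisimple H.
Proof.
move=> V W f f_inj.
have [f' f'E] := restriction_linear f.
have [|r0 r0K] := @linear_retraction _ _ _ f'.
  by move=> a b; rewrite !f'E; apply: f_inj.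
have r0_lin : scalar_linear (r0 : V -> W).
  by split=> [a b|d a]; [apply: linearD | apply: (linearZ_LR r0 d a)].
have r0f : cancel f (r0 : V -> W) by move=> a; rewrite -f'E r0K.
have [r1 [r1_lin r1x _ r1f]] := cyclic_average (H2n2_xn Hn) r0_lin.
have [r2 [[r2D r2Z] r2y r2h r2f]] := cyclic_average (H2n2_yn Hn) r1_lin.
have r2x := r2h x (H2n2_xy Hn) r1x.
have [w [wz zw]] := z_invertible.
pose r a := (2^-1 : C)%:A *: (r2 a + w *: r2 (z *: a)).
have rD a b : r (a + b) = r a + r b.
  by rewrite /r -[RHS]scalerDr [z *: _]scalerDr !r2D [w *: (_ + _)]scalerDr addrACA.
have rZ d a : r (d%:A *: a) = d%:A *: r a.
  by rewrite /r [RHS]scalar_comm [d%:A *: (_ + _)]scalerDr r2Z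
    [z *: (d%:A *: _)]scalar_comm r2Z [w *: (d%:A *: _)]scalar_comm.
have wy : w * y = x * w.
  by rewrite -[w * y]mulr1 -zw mulrA -[w * y * z]mulrA -(H2n2_zx Hn) mulrA wz mul1r.
have wx : w * x = y * w.
  by rewrite -[w * x]mulr1 -zw mulrA -[w * x * z]mulrA -(H2n2_zy Hn) mulrA wz mul1r.
have rx a : r (x *: a) = x *: r a.
  rewrite /r [RHS]scalar_comm r2x [X in _ *: (_ + w *: r2 X)]scalerA (H2n2_zx Hn).
  by rewrite -scalerA r2y [w *: (y *: _)]scalerA wy -scalerA -scalerDr.
have ry a : r (y *: a) = y *: r a.
  rewrite /r [RHS]scalar_comm r2y [X in _ *: (_ + w *: r2 X)]scalerA (H2n2_zy Hn).
  by rewrite -scalerA r2x [w *: (x *: _)]scalerA wx -scalerA -scalerDr.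
have r2_exp g m d : (forall d', r2 (g *: d') = g *: r2 d') ->
    r2 (g ^+ m *: d) = g ^+ m *: r2 d.
  move=> rg; elim: m => [|m IHm]; first by rewrite !scale1r.
  by rewrite exprS -!scalerA rg IHm.
have r2_0 : r2 0 = 0 by rewrite -(scale0r 0) -(scale0r 1) r2Z !scale0r.
have r2_scale (d : C) h a : (forall a, r2 (h *: a) = h *: r2 a) ->
    r2 ((d *: h) *: a) = (d *: h) *: r2 a.
  by move=> rh; rewrite -mulr_algl -!scalerA r2Z rh.
have r2_sum (I : finType) (F : I -> H) : (forall k a, r2 (F k *: a) = F k *: r2 a) ->
    forall a, r2 ((\sum_k F k) *: a) = (\sum_k F k) *: r2 a.
  move=> rF a; rewrite !scaler_suml; elim/big_rec2: _ => [//|k e1 e2 _ <-].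
  by rewrite r2D rF.
have r2_zz a : r2 (z ^+ 2 *: a) = z ^+ 2 *: r2 a.
  rewrite (H2n2_zz Hn); apply: (r2_scale) => {}a.
  apply: (r2_sum) => k {}a; apply: (r2_sum) => l {}a; apply: (r2_scale) => {}a.
  by rewrite -!scalerA r2_exp // r2_exp.
have rz a : r (z *: a) = z *: r a.
  rewrite /r [RHS]scalar_comm [z *: (_ + _)]scalerDr [z *: (w *: _)]scalerA zw scale1r.
  rewrite [z *: (z *: a)]scalerA -expr2 r2_zz scalerA expr2 mulrA wz mul1r.
  by rewrite addrC.
have r_lin : linear r.
  move=> h a b; rewrite rD; congr (_ + _); have [c ->] := H_basis_sum h.
  rewrite !scaler_suml; elim/big_rec2: _ => [|t e1 e2 _ <-].
    by rewrite -[0 in LHS](scale0r (0 : V)) -(scale0r 1) rZ scale0r scale0r.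
  rewrite rD; congr (_ + _); rewrite -mulr_algl -!scalerA rZ; congr (_ *: _).
  have powers g m d : (forall d', r (g *: d') = g *: r d') ->
      r (g ^+ m *: d) = g ^+ m *: r d.
    move=> rg; elim: m => [|m IHm]; first by rewrite !scale1r.
    by rewrite exprS -!scalerA rg IHm.
  by rewrite !powers.
have [r' r'E] := linear_ofP r_lin; exists r' => a; rewrite r'E /r.
rewrite -linearZ /= !(r2f f (r1f f r0f)) scalerA wz scale1r.
by rewrite -mulr2n -[a *+ 2]scaler_nat scalerA mulr_algl inv_nat_scale ?scale1r // pnatr_eq0.
Qed.

End Action.

From mathcomp Require Import -(notations) mpoly.

(** * Even order: the invariant ring is a polynomial ring *)

Section Evaluation.

Variables (K : fieldType) (B : algType K) (a b : B).

Definition eval_point (k : 'I_2) : B := if k == ord0 then a else b.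

(** The value of [f] at the point $(a,b)$.  Commutativity of [B], which makes it
    multiplicative, is an argument on which the morphism structure depends. *)
Definition eval2 (_ : forall f g : B, f * g = g * f) (f : mpoly 2 K) : B :=
  mmap (in_alg B) eval_point f.

Hypothesis B_comm : forall f g : B, f * g = g * f.
Local Notation ev := (eval2 B_comm).

Lemma eval2_linear : linear ev.
Proof.
move=> d f g; rewrite /eval2 mmapD mmapZ; congr (_ + _).
by rewrite /= mulr_algl.
Qed.

Lemma eval2_monoid : monoid_morphism ev.
Proof.
have [evM ev1] := @commr_mmap_is_multiplicative 2 K B eval_point (in_alg B)
  (fun k g => B_comm g (eval_point k)) (fun f m m' => B_comm _ _).
by split.
Qed.

HB.instance Definition _ := GRing.isLinear.Build K (mpoly 2 K) B *:%R ev eval2_linear.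
HB.instance Definition _ := GRing.isMonoidMorphism.Build (mpoly 2 K) B ev eval2_monoid.

Definition eval2_morphism : {lrmorphism mpoly 2 K -> B} := ev.

Lemma eval2_X (m : multinom 2) : ev (mpolyX K m) = a ^+ m ord0 * b ^+ m ord_max.
Proof.
rewrite /eval2 mmapX /mmap1 big_ord_recl big_ord1 /eval_point eqxx.
by rewrite (_ : lift ord0 ord0 = ord_max) //; apply/val_inj.
Qed.

Lemma eval2_X0 : ev (mpolyX K (mnm1 ord0)) = a.
Proof. by rewrite /eval2 mmapX mmap1U /eval_point eqxx. Qed.

Lemma eval2_X1 : ev (mpolyX K (mnm1 ord_max)) = b.
Proof. by rewrite /eval2 mmapX mmap1U. Qed.

End Evaluation.

Section Even.

Variables (R : realType) (n i j : nat).
Local Notation C := (complex R).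
Hypotheses (n_ge2 : (2 <= n)%N) (co_ijn : coprimez (i%:Z ^+ 2 - j%:Z ^+ 2) n%:Z).
Hypothesis n_even : ~~ odd n.
Variables (H : algType C) (Hs : hopf_algebra H) (x y z : H).
Hypothesis Hn : is_H2n2 n Hs x y z.
Variables (A : algType C) (u v : A) (cf : A -> nat -> nat -> C).
Variable M : module_algebra Hs A.
Hypothesis M_pi : acts_by_pi n i j x y z M u v.
Local Notation p := (neg_half_root R n).
Local Notation lam := (- p ^ (i%:Z ^+ 2 - j%:Z ^+ 2)).
Hypothesis Acf : skew_polynomial lam u v cf.

Let n_gt0 : (0 < n)%N := ltnW n_ge2.
Local Notation X := (u ^+ n).
Local Notation Y := (v ^+ n).
Local Notation B := (invariant_ring M).
Local Notation fixed := (torus_fixed x y M).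

Let zX := act_z_X n_ge2 co_ijn Hn M_pi.
Let zY := act_z_Y n_ge2 co_ijn Hn M_pi.
Let fixedX := torus_fixed_X n_ge2 Hn M_pi.
Let fixedY := torus_fixed_Y n_ge2 Hn M_pi.
Let fixedM := torus_fixedM Hn (M := M).
Let zM := act_z_fixedM n_ge2 Hn (M := M).

Lemma XY_comm : X * Y = Y * X.
Proof. by rewrite (XY_skew_comm n_ge2 Acf) -signr_odd (negbTE n_even) scale1r. Qed.

Lemma fixed_comm f g : fixed f -> fixed g -> f * g = g * f.
Proof.
have comm_X f' : f' * X = X * f' -> f' * Y = Y * f' -> fixed g -> f' * g = g * f'.
  move=> fX fY; elim/(torus_fixed_ind n_ge2 co_ijn Hn M_pi Acf)=> [|d a b fa fb|r s].
  - by rewrite mulr0 mul0r.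
  - by rewrite mulrDr mulrDl -scalerAr -scalerAl fa fb.
  by apply: commrM; apply: commrX.
move=> ff gg; apply: comm_X => //;
  elim/(torus_fixed_ind n_ge2 co_ijn Hn M_pi Acf): ff => [|d a b fa fb|r s].
- by rewrite mulr0 mul0r.
- by rewrite mulrDr mulrDl -scalerAr -scalerAl fa fb.
- by apply/esym/commrM; apply: commrX => //; exact: XY_comm.
- by rewrite mulr0 mul0r.
- by rewrite mulrDr mulrDl -scalerAr -scalerAl fa fb.
- by apply/esym/commrM; apply: commrX => //; exact/esym/XY_comm.
Qed.

Lemma invariant_ring_comm (f g : B) : f * g = g * f.
Proof.
apply/val_inj; rewrite !rmorphM /=.
have inv_fixed (h : B) : fixed (val h) by case: (proj1 (invariantsP Hn M (val h)) (valP h)).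
by rewrite (fixed_comm (inv_fixed f) (inv_fixed g)).
Qed.

Lemma invariant_sum : X + Y \in invariants M.
Proof.
apply/(invariantsP Hn); split.
  by rewrite -[X]scale1r; apply: torus_fixed_lin.
by rewrite actD zX zY addrC.
Qed.

Lemma invariant_prod : X * Y \in invariants M.
Proof.
apply/(invariantsP Hn); split; first exact: fixedM.
by rewrite zM // zX zY -XY_comm.
Qed.

Definition inv_s : B := InvariantRing invariant_sum.
Definition inv_p : B := InvariantRing invariant_prod.

Local Notation phi := (eval2_morphism inv_s inv_p invariant_ring_comm).

Lemma evaluation_X0 : phi (mpolyX C (mnm1 ord0)) = inv_s.
Proof. exact: eval2_X0. Qed.

Lemma evaluation_X1 : phi (mpolyX C (mnm1 ord_max)) = inv_p.
Proof. exact: eval2_X1. Qed.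

Definition psi (g : mpoly 2 C) : A := val (phi g).

Lemma psiD g h : psi (g + h) = psi g + psi h.
Proof. by rewrite /psi rmorphD. Qed.

Lemma psiM g h : psi (g * h) = psi g * psi h.
Proof. by rewrite /psi rmorphM. Qed.

Lemma psiZ d g : psi (d *: g) = d *: psi g.
Proof. by rewrite /psi linearZ. Qed.

Lemma psi0 : psi 0 = 0.
Proof. by rewrite /psi rmorph0. Qed.

Lemma psi1 : psi 1 = 1.
Proof. by rewrite /psi rmorph1. Qed.

Lemma psiN g : psi (- g) = - psi g.
Proof. by rewrite -scaleN1r psiZ scaleN1r. Qed.

Lemma psi_fixed g : fixed (psi g).
Proof. by case: (proj1 (invariantsP Hn M _) (valP (phi g))). Qed.

Lemma psi_z g : M z (psi g) = psi g.
Proof. by case: (proj1 (invariantsP Hn M _) (valP (phi g))). Qed.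

Local Notation s0 := (mpolyX C (mnm1 ord0) : mpoly 2 C).
Local Notation s1 := (mpolyX C (mnm1 ord_max) : mpoly 2 C).

Lemma psi_s0 : psi s0 = X + Y.
Proof. by rewrite /psi evaluation_X0. Qed.

Lemma psi_s1 : psi s1 = X * Y.
Proof. by rewrite /psi evaluation_X1. Qed.

(** Over the symmetric polynomials in $X=u^n$ and $Y=v^n$, all polynomials are
    spanned by $1$ and $X$, since $X^2=(X+Y)X-XY$ and $Y=(X+Y)-X$. *)
Lemma fixed_decomposition f : fixed f ->
  exists g0 g1 : mpoly 2 C, f = psi g0 + psi g1 * X.
Proof.
pose Q f := exists g0 g1 : mpoly 2 C, f = psi g0 + psi g1 * X.
have QX a : Q a -> Q (a * X).
  move=> [g0 [g1 ->]]; exists (- (g1 * s1)), (g0 + g1 * s0).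
  rewrite psiN psiD !psiM psi_s0 psi_s1 !mulrDl [RHS]addrCA; congr (_ + _).
  rewrite -[psi g1 * (X + Y) * X]mulrA [(X + Y) * X]mulrDl -XY_comm.
  by rewrite [psi g1 * (_ + _)]mulrDr [psi g1 * (X * X)]mulrA [RHS]addrC addrK.
have QY a : Q a -> Q (a * Y).
  move=> [g0 [g1 ->]]; exists (g0 * s0 + g1 * s1), (- g0).
  rewrite psiN psiD !psiM psi_s0 psi_s1 mulrDl mulrDr mulNr -[psi g1 * X * Y]mulrA.
  by rewrite [RHS]addrAC [psi g0 * X + _]addrC addrK.
elim/(torus_fixed_ind n_ge2 co_ijn Hn M_pi Acf) => [|d a b [a0 [a1 ->]] [b0 [b1 ->]]|r s].
- by exists 0, 0; rewrite psi0 mul0r addr0.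
- exists (d *: a0 + b0), (d *: a1 + b1); rewrite !psiD !psiZ.
  by rewrite scalerDr mulrDl addrACA scalerAl.
elim: s => [|s IHs]; last by rewrite exprSr mulrA; apply: QY.
rewrite mulr1; elim: r => [|r IHr]; last by rewrite exprSr; apply: QX.
by exists 1, 0; rewrite psi1 psi0 mul0r addr0.
Qed.

Lemma evaluation_surj (f : B) : exists g, phi g = f.
Proof.
have /(invariantsP Hn)[f_fixed zf] := valP f.
have [g0 [g1 fE]] := fixed_decomposition f_fixed.
exists (g0 + 2^-1 *: (g1 * s0)); apply/val_inj; rewrite -[LHS]/(psi _).
have fE' : val f = psi g0 + psi g1 * Y.
  by rewrite -[LHS]zf fE actD (zM (psi_fixed g1) fixedX) !psi_z zX.
rewrite psiD psiZ psiM psi_s0.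
apply: (scalerI (a := 2)); first by rewrite pnatr_eq0.
rewrite scalerDr scalerA mulfV ?pnatr_eq0 // scale1r mulrDr.
by rewrite !scaler_nat !mulr2n {1}fE fE' addrACA.
Qed.

(** The only term of $(X+Y)^r$ without $v$ is $X^r$. *)
Lemma cf_sum_exp r a : cf ((X + Y) ^+ r) a 0 = (a == n * r)%N%:R.
Proof.
elim: r a => [|r IHr] a; first by rewrite expr0 muln0 (cf1 Acf) andbT eq_sym.
rewrite exprSr mulrDr (cfD Acf) (cfMv Acf) leqNgt n_gt0 addr0 (cfMu Acf).
rewrite mul0n expr0 mul1r IHr mulnS; case: leqP => [na|an].
  by rewrite -(eqn_add2l n) subnKC.
by rewrite ltn_eqF // ltn_addr.
Qed.

(** Every monomial of $(X+Y)^r(XY)^k$ is divisible by $Y^k$, and the only one with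
    no further factor $Y$ is $X^{r+k}Y^k$. *)
Lemma cf_generators r k a b : (b <= k)%N ->
  cf ((X + Y) ^+ r * (X * Y) ^+ k) (n * (a + b)) (n * b) =
  ((r == a) && (k == b))%:R.
Proof.
move=> bk.
have -> : (X * Y) ^+ k = u ^+ (n * k) * v ^+ (n * k).
  by rewrite !exprM exprMn_comm //; apply: XY_comm.
rewrite mulrA (cfMv Acf) leq_pmul2l // [k == b]eqn_leq bk andbT.
case: leqP => [kb|_]; last by rewrite andbF.
have -> : b = k by apply/eqP; rewrite eqn_leq bk.
rewrite andbT subnn (cfMu Acf) mul0n expr0 mul1r leq_pmul2l // leq_addl.
by rewrite mulnDr addnK cf_sum_exp eqn_pmul2l // eq_sym.
Qed.

Local Notation homogA := (homog cf 1 1).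

Lemma homog_exp (t k : nat) a : homogA t a -> homogA (t * k)%N (a ^+ k).
Proof.
move=> a_t; elim: k => [|k IHk].
  by rewrite muln0 expr0 => r s; rewrite (cf1 Acf); case: r s => [|r] [|s] //=; rewrite eqxx.
by rewrite exprS mulnS PoszD; apply: (homogM Acf).
Qed.

Lemma homog_generators r k :
  homogA (n * r + 2 * n * k)%N ((X + Y) ^+ r * (X * Y) ^+ k).
Proof.
have hX : homogA n X.
  by have := @homog_mon _ _ _ _ _ _ Acf 1 1 n 0; rewrite !mul1n addn0 /mon mulr1.
have hY : homogA n Y.
  by have := @homog_mon _ _ _ _ _ _ Acf 1 1 0 n; rewrite !mul1n add0n /mon mul1r.
rewrite PoszD; apply: (homogM Acf); apply: homog_exp.
  by rewrite -[X]scale1r; apply: (homog_lin Acf).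
by rewrite mul2n -addnn PoszD; apply: (homogM Acf).
Qed.

Lemma psi_mon m : psi (mpolyX C m) = (X + Y) ^+ m ord0 * (X * Y) ^+ m ord_max.
Proof.
have psi_exp g k : psi (g ^+ k) = psi g ^+ k.
  by elim: k => [|k IHk]; rewrite ?expr0 ?psi1 // !exprS psiM IHk.
rewrite mpolyXE_id big_ord_recl big_ord1 (_ : lift ord0 ord0 = ord_max).
  by rewrite psiM !psi_exp psi_s0 psi_s1.
exact/val_inj.
Qed.

Lemma psi_sum f : psi f = \sum_(m <- msupp f)
  mcoeff m f *: ((X + Y) ^+ m ord0 * (X * Y) ^+ m ord_max).
Proof.
rewrite {1}[f]mpolyE; elim/big_rec2: _ => [|m a b _ <-]; first exact: psi0.
by rewrite psiD psiZ psi_mon.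
Qed.

(** A triangularity argument: the coefficient of $X^{r+k}Y^k$ in [psi f] only
    involves the coefficients of [f] at exponents $(r',k')$ with $k'<k$, besides
    the one at $(r,k)$.  This gives both the injectivity of the evaluation and the
    degrees of the two generators. *)
Lemma psi_homog t f : homogA t (psi f) -> forall m : multinom 2,
  (n * m ord0 + 2 * n * m ord_max)%N%:Z != t -> mcoeff m f = 0.
Proof.
move=> f_t m; move: {2}(m ord_max) (erefl (m ord_max)) => k.
elim/ltn_ind: k m => k IHk m mk m_t; apply/eqP; apply: contraTT isT => fm.
have : cf (psi f) (n * (m ord0 + k)) (n * k) = mcoeff m f.
  rewrite psi_sum (cf_sum Acf) (bigD1_seq m) ?msupp_uniq ?mcoeff_msupp //=.
  rewrite (cfZ Acf) mk cf_generators // !eqxx mulr1 big1 ?addr0 // => m' m'm.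
  rewrite (cfZ Acf); have [km'|m'k] := leqP k (m' ord_max).
    rewrite cf_generators // (_ : _ && _ = false) ?mulr0 //.
    apply: contraNF m'm => /andP[/eqP e0 /eqP e1]; apply/eqP/mnmP => l.
    by case: (letterP l) => ->; rewrite ?e0 // /letter_v e1 mk.
  have [m'_t|m'_t] := eqVneq (n * m' ord0 + 2 * n * m' ord_max)%N%:Z t; last first.
    by rewrite (IHk _ m'k) // mul0r.
  rewrite (homog_cf (@homog_generators _ _)) ?mulr0 // m'_t.
  by move: m_t; rewrite mk !mul1n mulnDr -addnA addnn -mul2n mulnA.
rewrite (homog_cf f_t); first by move=> e; rewrite -e eqxx in fm.
by move: m_t; rewrite mk !mul1n mulnDr -addnA addnn -mul2n mulnA.
Qed.

Lemma evaluation_inj : injective phi.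
Proof.
move=> f g fg; apply/eqP; rewrite -subr_eq0; apply/eqP/mpolyP => m.
rewrite mcoeff0.
(* [0] is homogeneous of degree [-1], which is the degree of no exponent. *)
apply: (psi_homog (t := -1)) => //.
rewrite psiD psiN /psi fg subrr; exact: (homog0 Acf).
Qed.

Lemma evaluation_bij : bijective phi.
Proof.
have [g gK] := choice evaluation_surj; exists g => // f; apply: evaluation_inj; exact: gK.
Qed.

Theorem invariants_polynomial : is_polynomial_ring2 inv_s inv_p.
Proof. by exists phi; split; [exact: evaluation_bij | exact: evaluation_X0 | exact: evaluation_X1]. Qed.

(** The polynomial ring is the case $c=1$ of [skew_AS_regular], with generators of
    degrees $n$ and $2n$. *)
Theorem invariants_regular (G : nat -> set A) :
  (forall m a, G m a <-> homogA m a) -> AS_regular (inv_grading (M := M) G).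
Proof.
move=> GE; have [g gK phiK] := evaluation_bij.
pose bi (r s : nat) : multinom 2 := Multinom (mktuple (fun l : 'I_2 => if l == ord0 then r else s)).
have bi0 r s : bi r s ord0 = r by rewrite mnmE.
have bi1 r s : bi r s ord_max = s by rewrite mnmE.
have biE (m : multinom 2) : m = bi (m ord0) (m ord_max).
  by apply/mnmP => l; case: (letterP l) => ->; rewrite ?bi0 ?bi1.
pose cfB (b : B) r s := mcoeff (bi r s) (g b).
have phi_bi r s : phi (mpolyX C (bi r s)) = mon inv_s inv_p r s.
  by rewrite [LHS]eval2_X bi0 bi1.
have g_lin d a b : g (d *: a + b) = d *: g a + g b.
  by apply: evaluation_inj; rewrite phiK linearP /= !phiK.
have cfB_lin r s : linear (fun b => cfB b r s : C^o).
  by move=> d a b; rewrite /cfB g_lin mcoeffD mcoeffZ.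
have Bcf : skew_polynomial 1 inv_s inv_p cfB.
  apply: (skew_polynomial_of_ind (oner_neq0 _)) => //.
  - by rewrite scale1r; apply: invariant_ring_comm.
  - move=> r s r' s'; rewrite /cfB -phi_bi gK mcoeffX.
    congr (nat_of_bool _)%:R; apply/eqP/andP => [e|[/eqP-> /eqP->] //].
    by rewrite -(bi0 r s) -{2}(bi1 r s) e bi0 bi1 !eqxx.
  - move=> P P0 Plin Pmon b; rewrite -(phiK b).
    elim/mpolyind: (g b) => [|d m f _ _ Pf]; first by rewrite rmorph0.
    by rewrite linearP /=; apply: Plin => //; rewrite (biE m) phi_bi.
apply: (skew_AS_regular (w1 := n) (w2 := 2 * n) Bcf) => //; first by rewrite muln_gt0.
move=> m b; rewrite /inv_grading; split=> [/GE b_m r s|b_m].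
  apply: contraNeq => rs; apply/eqP; apply: (psi_homog (t := m)); last by rewrite bi0 bi1.
  by rewrite /psi phiK.
apply/GE; elim/(homog_ind Bcf): b_m => [|d a a' a_m a'_m|r s rs_m].
- exact: (homog0 Acf).
- exact: (homog_lin Acf).
have val_exp (f : B) k : val (f ^+ k) = val f ^+ k :> A.
  by elim: k => [|k IHk]; rewrite ?expr0 // !exprS -IHk.
have -> : inv_val (mon inv_s inv_p r s) = (X + Y) ^+ r * (X * Y) ^+ s.
  by rewrite -[LHS]/(val (inv_s ^+ r) * val (inv_p ^+ s)) !val_exp.
by rewrite -rs_m; apply: homog_generators.
Qed.

End Even.

(** * Odd order: the invariant ring has infinite global dimension *)

Section PeriodicModule.

Variables (B : nzRingType) (W : lmodType B) (d : {linear W -> W}).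
Hypotheses (W_proj : projective W) (d_exact : forall x, d x = 0 <-> exists y, x = d y).

Let ker_pred : {pred W} := fun x => `[< d x = 0 >].

Let ker_closed : submod_closed ker_pred.
Proof.
split; first by apply/asboolP; exact: linear0.
by move=> a x y /asboolP x0 /asboolP y0; apply/asboolP; rewrite linearP x0 y0 scaler0 addr0.
Qed.

(** The kernel of [d] has the periodic resolution with all its terms equal to
    [W] and all its maps equal to [d]. *)
Lemma exact_endomorphism_splits m : gldim_le B m ->
  exists s' s : {linear W -> W}, forall x, x = d (s' x) + s (d x).
Proof.
move=> B_m; have d_ker x : d x \in ker_pred.
  by apply/asboolP; apply/d_exact; exists x.
have aug_lin : linear (fun x => Submodule ker_closed (d_ker x)).
  by move=> a x y; apply/val_inj; rewrite /= linearP.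
have [aug augE] := linear_ofP aug_lin.
have aug_surj w : exists x, aug x = w.
  case: w => w w_ker; have /asboolP/d_exact[x wE] := w_ker.
  by exists x; rewrite augE; apply/val_inj.
have aug_exact x : aug x = 0 <-> exists y, x = d y.
  rewrite augE -d_exact; split=> [/(congr1 val) //|dx]; exact/val_inj.
pose F := @Resolution B _ (fun=> W) (fun=> d) aug (fun=> W_proj) aug_surj
  aug_exact (fun=> d_exact).
have [P P0] := B_m (submodule ker_closed).
by have [|s' [s sE]] := @null_homotopy _ _ F P m; [apply: P0 | exists s', s].
Qed.

End PeriodicModule.

Section GeneratedSubalgebra.

Variables (R : realType) (A : algType (complex R)) (E : set A).
Local Notation gen := (generated_subalg E).

Lemma generated_gen a : E a -> gen a.
Proof. by move=> Ea B _; apply. Qed.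

Lemma generated1 : gen 1.
Proof. by move=> B [B1 _ _]. Qed.

Lemma generated_lin d a b : gen a -> gen b -> gen (d *: a + b).
Proof.
move=> ga gb B B_closed EB; have [_ B_lin _] := B_closed.
by apply: (B_lin); [apply: ga | apply: gb].
Qed.

Lemma generatedM a b : gen a -> gen b -> gen (a * b).
Proof.
move=> ga gb B B_closed EB; have [_ _ B_mul] := B_closed.
by apply: (B_mul); [apply: ga | apply: gb].
Qed.

Lemma generated0 : gen 0.
Proof.
by have := generated_lin (-1) generated1 generated1; rewrite scaleN1r addNr.
Qed.

Lemma generatedD a b : gen a -> gen b -> gen (a + b).
Proof. by move=> ga gb; rewrite -[a]scale1r; apply: generated_lin. Qed.

End GeneratedSubalgebra.

Section Odd.

Variables (R : realType) (n i j : nat).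
Local Notation C := (complex R).
Hypotheses (n_ge2 : (2 <= n)%N) (co_ijn : coprimez (i%:Z ^+ 2 - j%:Z ^+ 2) n%:Z).
Hypothesis n_odd : odd n.
Variables (H : algType C) (Hs : hopf_algebra H) (x y z : H).
Hypothesis Hn : is_H2n2 n Hs x y z.
Variables (A : algType C) (u v : A) (cf : A -> nat -> nat -> C).
Variable M : module_algebra Hs A.
Hypothesis M_pi : acts_by_pi n i j x y z M u v.
Local Notation p := (neg_half_root R n).
Local Notation lam := (- p ^ (i%:Z ^+ 2 - j%:Z ^+ 2)).
Hypothesis Acf : skew_polynomial lam u v cf.

Let n_gt0 : (0 < n)%N := ltnW n_ge2.
Local Notation X := (u ^+ n).
Local Notation Y := (v ^+ n).
Local Notation B := (invariant_ring M).
Local Notation fixed := (torus_fixed x y M).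

Let zX := act_z_X n_ge2 co_ijn Hn M_pi.
Let zY := act_z_Y n_ge2 co_ijn Hn M_pi.
Let fixedX := torus_fixed_X n_ge2 Hn M_pi.
Let fixedY := torus_fixed_Y n_ge2 Hn M_pi.
Let fixedM := torus_fixedM Hn (M := M).
Let zM := act_z_fixedM n_ge2 Hn (M := M).

Local Notation s := (X + Y).
Local Notation D := (X - Y).
Local Notation sigma := (s * s).
Local Notation tau := (D * s * D).

Lemma XY_anticomm : Y * X = - (X * Y).
Proof. by rewrite (XY_skew_comm n_ge2 Acf) -signr_odd n_odd expr1 scaleN1r. Qed.

Lemma sqr_D : D * D = sigma.
Proof.
rewrite mulrBl !mulrBr mulrDl !mulrDr XY_anticomm opprB opprK.
by rewrite [Y * Y + _]addrC !addrA subrK addrK.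
Qed.

Lemma sigma_comm_D : D * sigma = sigma * D.
Proof. by rewrite -sqr_D mulrA. Qed.

Lemma tau_sqr : tau * tau = sigma * sigma * sigma.
Proof.
rewrite -[tau * tau]mulrA [D * (D * s * D)]mulrA [D * (D * s)]mulrA sqr_D.
rewrite -[D * s * _]mulrA [s * (sigma * s * D)]mulrA [s * (sigma * s)]mulrA.
rewrite [s * sigma]mulrA -[s * s * s * s]mulrA mulrA mulrA sigma_comm_D.
by rewrite -[sigma * D * _]mulrA sigma_comm_D mulrA -[_ * D * D]mulrA sqr_D.
Qed.

Lemma sigma_tau : sigma * tau = tau * sigma.
Proof.
have sD : GRing.comm sigma D by exact/esym/sigma_comm_D.
by apply: (commrM _ sD); apply: (commrM sD); rewrite /GRing.comm mulrA.
Qed.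

(** This is how $XYD$ arises: among the products of [s] and [D] that [z] fixes,
    [tau] is the only new generator beside [s]. *)
Lemma tauE : tau = 4 *: (X * Y * D) + s * sigma.
Proof.
pose w := X * Y; pose a := X * X - Y * Y.
have Ds : D * s = a + (w + w).
  rewrite mulrBl !mulrDr XY_anticomm opprD opprK -/w.
  by rewrite [w - _]addrC addrACA.
have sD : s * D = a - (w + w).
  by rewrite mulrDl !mulrBr XY_anticomm -/w [- w - _]addrC addrACA -opprD.
have -> : 4 *: (X * Y * D) = (D * s - s * D) * D.
  rewrite scalerAl -/w Ds sD opprB; congr (_ * D).
  by rewrite [RHS]addrC addrA subrK -mulr2n -[w + w]mulr2n -mulrnA scaler_nat.
by rewrite [(D * s - _) * D]mulrBl -[s * D * D]mulrA sqr_D subrK.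
Qed.

Lemma fixed_s : fixed s.
Proof. by rewrite -[X]scale1r; apply: torus_fixed_lin. Qed.

Lemma fixed_D : fixed D.
Proof. by rewrite addrC -scaleN1r; apply: torus_fixed_lin. Qed.

Lemma act_z_s : M z s = s.
Proof. by rewrite actD zX zY addrC. Qed.

Lemma act_z_D : M z D = - D.
Proof. by rewrite actD actN zX zY opprB. Qed.

Local Notation gen :=
  (generated_subalg [set s; X * Y * D]%classic).

Lemma gen_invariant a : gen a -> a \in invariants M.
Proof.
apply; first exact: invariant_subalg_closed.
have fixedXY : fixed (X * Y) by apply: fixedM.
have fixedt := fixedM fixedXY fixed_D.
move=> b [] ->; apply/(invariantsP Hn); split=> //.
- exact: fixed_s.
- exact: act_z_s.
by rewrite !zM // ?zX ?zY ?act_z_D ?XY_anticomm ?mulrNN //; exact: fixed_D.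
Qed.

Lemma gen_fixed a : gen a -> fixed a.
Proof. by move/gen_invariant/(invariantsP Hn) => []. Qed.

Lemma gen_z a : gen a -> M z a = a.
Proof. by move/gen_invariant/(invariantsP Hn) => []. Qed.

Lemma gen_s : gen s.
Proof. by apply: generated_gen; left. Qed.

Lemma gen_sigma : gen sigma.
Proof. by apply: generatedM; exact: gen_s. Qed.

Lemma gen_tau : gen tau.
Proof.
rewrite tauE; apply: generated_lin; first by apply: generated_gen; right.
by apply: generatedM; [exact: gen_s | exact: gen_sigma].
Qed.

(** The span of $1$, $D$ and $Ds$ over the subalgebra is a right module over
    the algebra generated by $s$ and $D$, by $Ds^2=s^2D$, $D^2=s^2$ and
    $DsD=s^3+4XYD$. *)
Lemma odd_decomposition f : fixed f -> exists b0 b1 b2,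
  [/\ gen b0, gen b1, gen b2 & f = b0 + (b1 * D + b2 * (D * s))].
Proof.
pose Q f := exists b0 b1 b2,
  [/\ gen b0, gen b1, gen b2 & f = b0 + (b1 * D + b2 * (D * s))].
have Q0 : Q 0.
  have g0 : gen 0 := @generated0 _ _ _.
  by exists 0, 0, 0; rewrite !mul0r !addr0.
have Qlin d a b : Q a -> Q b -> Q (d *: a + b).
  move=> [b0 [b1 [b2 [g0 g1 g2 ->]]]] [b0' [b1' [b2' [g0' g1' g2' ->]]]].
  exists (d *: b0 + b0'), (d *: b1 + b1'), (d *: b2 + b2').
  split; try exact: generated_lin.
  by rewrite !mulrDl -!scalerAl !scalerDr addrACA [X in _ + X]addrACA.
have Qs a : Q a -> Q (a * s).
  move=> [b0 [b1 [b2 [g0 g1 g2 ->]]]].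
  exists (b0 * s), (b2 * sigma), b1; split=> //.
  - by apply: generatedM => //; exact: gen_s.
  - by apply: generatedM => //; exact: gen_sigma.
  rewrite [LHS]mulrDl [(b1 * D + _) * s]mulrDl; congr (_ + _); rewrite addrC.
  by rewrite -!mulrA [D * (s * s)]sigma_comm_D -[s * s * D]mulrA.
have QD a : Q a -> Q (a * D).
  move=> [b0 [b1 [b2 [g0 g1 g2 ->]]]].
  exists (b1 * sigma + b2 * tau), b0, 0; split=> //.
  - by apply: generatedD; apply: generatedM => //; [exact: gen_sigma | exact: gen_tau].
  - exact: generated0.
  rewrite [LHS]mulrDl [(b1 * D + _) * D]mulrDl mul0r addr0 addrC; congr (_ + _).
  by rewrite -[b1 * D * D]mulrA sqr_D -[b2 * _ * D]mulrA.
have half (a b : A) : 2%:R *: a = b -> a = 2^-1 *: b.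
  by move=> <-; rewrite scalerA mulVf ?scale1r // pnatr_eq0.
have QX a : Q a -> Q (a * X).
  move=> Qa; rewrite [a * X](half _ (1 *: (a * s) + a * D)).
    by have := Qlin 2^-1 _ _ (Qlin 1 _ _ (Qs _ Qa) (QD _ Qa)) Q0; rewrite addr0.
  by rewrite scale1r -mulrDr addrACA subrr addr0 -mulr2n mulrnAr [LHS]scaler_nat.
have QY a : Q a -> Q (a * Y).
  move=> Qa; rewrite [a * Y](half _ ((-1) *: (a * D) + a * s)).
    by have := Qlin 2^-1 _ _ (Qlin (-1) _ _ (QD _ Qa) (Qs _ Qa)) Q0; rewrite addr0.
  by rewrite scaleN1r -mulrN -mulrDr opprB addrA subrK -mulr2n mulrnAr [LHS]scaler_nat.
elim/(torus_fixed_ind n_ge2 co_ijn Hn M_pi Acf) => [//|d a b Qa Qb|r k]; first exact: Qlin.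
elim: k => [|k IHk]; last by rewrite exprSr mulrA; apply: QY.
rewrite mulr1; elim: r => [|r IHr]; last by rewrite exprSr; apply: QX.
have g0 : gen 0 := @generated0 _ _ _.
by exists 1, 0, 0; rewrite !mul0r !addr0; split=> //; exact: generated1.
Qed.

Lemma act_z_tail b1 b2 : gen b1 -> gen b2 ->
  M z (b1 * D + b2 * (D * s)) = - (b1 * D + b2 * (D * s)).
Proof.
move=> g1 g2; have [f1 f2] := (gen_fixed g1, gen_fixed g2).
have fDs := fixedM fixed_D fixed_s.
rewrite actD (zM f1 fixed_D) (zM f2 fDs) (zM fixed_D fixed_s) (gen_z g1) (gen_z g2).
by rewrite act_z_s act_z_D mulrN mulNr mulrN -opprD.
Qed.

Lemma double_eq0 (a : A) : a + a = 0 -> a = 0.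
Proof.
move=> aa; apply: (@scalerI _ _ (2%:R : C)); first by rewrite pnatr_eq0.
by rewrite scaler_nat mulr2n aa scaler0.
Qed.

Lemma invariants_generated a : a \in invariants M <-> gen a.
Proof.
split=> [/(invariantsP Hn)[fa za]|]; last exact: gen_invariant.
have [b0 [b1 [b2 [g0 g1 g2 aE]]]] := odd_decomposition fa.
move: za; rewrite aE actD act_z_tail // gen_z // => /addrI/eqP.
rewrite eq_sym -addr_eq0 => /eqP/double_eq0 ->.
by rewrite addr0.
Qed.

Lemma antiinvariantsP a : fixed a -> M z a = - a ->
  exists b1 b2, [/\ b1 \in invariants M, b2 \in invariants M
    & a = b1 * D + b2 * (D * s)].
Proof.
move=> fa za; have [b0 [b1 [b2 [g0 g1 g2 aE]]]] := odd_decomposition fa.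
exists b1, b2; split; try exact: gen_invariant.
move: za; rewrite aE actD act_z_tail // gen_z // [RHS]opprD => /addIr/eqP.
by rewrite -addr_eq0 => /eqP/double_eq0 ->; rewrite add0r.
Qed.

Lemma mul_D_inj : injective (fun a => a * D).
Proof.
move=> a b ab; apply/eqP; rewrite -subr_eq0; apply/eqP.
apply: (mulI_add Acf (d := -1) (k := n) (l := n) n_gt0).
by rewrite scaleN1r [- X + _]addrC -[Y - X]opprB mulrN mulrBl ab subrr oppr0.
Qed.

(** Rewritten as $(e-f)X+(e+f)Y=0$, the hypothesis is a syzygy of $X$ and $Y$. *)
Lemma common_multiple e f : e * s = f * D -> exists g, e = g * s /\ f = g * D.
Proof.
move=> /eqP; rewrite -subr_eq0 => /eqP ef.
have [|g [efY feX]] := left_syzygy Acf (k := n) (l := n) (a := e - f) (b := e + f).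
  rewrite -[RHS]ef [(e - f) * X]mulrBl [(e + f) * Y]mulrDl [e * s]mulrDr.
  by rewrite [f * D]mulrBr opprB addrACA [- _ + _]addrC.
have {}feX : e + f = g * X.
  by rewrite feX (lam_exp R i j n_ge2) -signr_odd n_odd expr1 scaleN1r opprK.
have half (a b : A) : a + a = b -> a = 2^-1 *: b.
  move=> <-; apply: (@scalerI _ _ (2%:R : C)); first by rewrite pnatr_eq0.
  by rewrite scalerA mulfV ?scale1r ?pnatr_eq0 // scaler_nat mulr2n.
exists (2^-1 *: g); rewrite -!scalerAl; split; apply: half.
  by rewrite mulrDr -feX -efY addrACA subrr addr0.
by rewrite mulrBr -feX -efY opprB [e + f]addrC [f - e]addrC addrA addrK.
Qed.

(** Cancelling $D$ leaves $(bD)s=(-a)D$, and [common_multiple] applied twice gives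
    $a=-hsD$ and $b=hD$.  Since [z] fixes $b$ and negates $D$, it negates $h$, which
    is therefore a combination of $D$ and $Ds$ over the invariants. *)
Lemma periodic_exact a b : a \in invariants M -> b \in invariants M ->
  a * sigma + b * tau = 0 -> exists a' b',
  [/\ a' \in invariants M, b' \in invariants M,
      a = a' * tau + b' * (sigma * sigma) & b = - (a' * sigma) - b' * tau].
Proof.
move=> /(invariantsP Hn)[fa za] /(invariantsP Hn)[fb zb] ab0.
have [g [bDE aE]] : exists g, b * D = g * s /\ - a = g * D.
  apply: common_multiple; apply: mul_D_inj; apply/eqP.
  rewrite mulNr mulNr -[a * D * D]mulrA sqr_D -addr_eq0 addrC.
  by rewrite -[b * D * s]mulrA -[b * (D * s) * D]mulrA ab0.
have [h [gE bE]] := common_multiple (esym bDE).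
have fh : fixed h.
  have [xb yb] := fb; have [xD yD] := fixed_D.
  split; apply: mul_D_inj; rewrite /= -bE.
    by rewrite -[RHS]xb bE (act_xM Hn) xD.
  by rewrite -[RHS]yb bE (act_yM Hn) yD.
have zh : M z h = - h.
  apply: mul_D_inj; rewrite /= mulNr -bE -zb bE (zM fh fixed_D) act_z_D mulrN.
  by rewrite opprK.
have [h1 [h2 [i1 i2 hE]]] := antiinvariantsP fh zh.
have invN c : c \in invariants M -> - c \in invariants M by move=> ?; rewrite rpredN.
exists (- h1), (- h2); split; try exact: invN.
  rewrite -[a]opprK aE gE hE !mulNr -opprD; congr (- _).
  rewrite [(h1 * D + _) * s]mulrDl [(h1 * D * s + _) * D]mulrDl.
  rewrite -[h1 * D * s]mulrA -[h1 * (D * s) * D]mulrA; congr (_ + _).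
  rewrite -[h2 * (D * s) * s]mulrA -[D * s * s]mulrA -[h2 * _ * D]mulrA.
  by rewrite sigma_comm_D -[sigma * D * D]mulrA sqr_D.
rewrite !mulNr !opprK bE hE mulrDl -[h1 * D * D]mulrA sqr_D.
by rewrite -[h2 * _ * D]mulrA.
Qed.

(** The entries of the differential have no constant term, so its identity is not
    null-homotopic: the first coordinate of $(1,0)$ would have none either. *)
Lemma invariant_ring_inf_gldim m : ~ gldim_le B m.
Proof.
move=> B_m.
have sB : sigma \in invariants M by exact/gen_invariant/gen_sigma.
have tB : tau \in invariants M by exact/gen_invariant/gen_tau.
pose sg : B := InvariantRing sB; pose ta : B := InvariantRing tB.
have st : sg * ta = ta * sg by apply/val_inj; rewrite !rmorphM /= sigma_tau.
have tt : ta * ta = sg * sg * sg by apply/val_inj; rewrite !rmorphM /= tau_sqr.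
pose W : lmodType B := (B^o * B^o)%type.
pose pr (b b' : B) (w : W) : B := w.1 * b + w.2 * b'.
have pr_lin b b' : linear (pr b b' : W -> B^o).
  have lin (a a1 a2 c1 c2 : B) : (a * a1 + c1) * b + (a * a2 + c2) * b' =
      a * (a1 * b + a2 * b') + (c1 * b + c2 * b').
    by rewrite !mulrDl mulrDr !mulrA addrACA.
  by move=> a w w'; exact: lin.
have d_sqr1 a b : (a * ta + b * (sg * sg)) * ta + (a * - sg + b * - ta) * (sg * sg) = 0.
  rewrite !mulrDl !mulrN !mulNr -!mulrA [ta * (sg * sg)]mulrA -st -[sg * ta * sg]mulrA -st.
  by rewrite tt -[sg * sg * sg]mulrA -opprD subrr.
have d_sqr2 a b : (a * ta + b * (sg * sg)) * - sg + (a * - sg + b * - ta) * - ta = 0.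
  rewrite !mulrN -[- (a * sg) - _]opprD mulNr opprK !mulrDl -!mulrA -st tt.
  by rewrite -[sg * sg * sg]mulrA addNr.
have [d dE] := linear_ofP (linear_pair (pr_lin ta (sg * sg)) (pr_lin (- sg) (- ta))).
have d_exact w : d w = 0 <-> exists w', w = d w'.
  split=> [|[w' ->]].
    move/(congr1 (fun w : W => val (w.2 : B))); rewrite dE /pr /= !mulrN -opprD.
    move/eqP.
    rewrite oppr_eq0 => /eqP w0.
    have [a' [b' [ia ib aE bE]]] := periodic_exact (valP w.1) (valP w.2) w0.
    exists (InvariantRing ia, InvariantRing ib); rewrite dE /pr.
    case: w w0 aE bE => a b _ aE bE.
    by congr (_, _); apply/val_inj; rewrite /= ?aE ?bE ?mulrN.
  by rewrite !dE /pr /=; congr (_, _); rewrite ?d_sqr1 ?d_sqr2.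
have W_proj : projective W by apply: projective_prod; apply: projective_free1.
have [s' [k hE]] := exact_endomorphism_splits W_proj d_exact B_m.
pose eps (b : B) := cf (val b) 0 0.
have epsD a b : eps (a + b) = eps a + eps b by exact: (cfD Acf).
have epsM a b : eps (a * b) = eps a * eps b by exact: (cfM00 Acf).
have epsN a : eps (- a) = - eps a by exact: (cfN Acf).
have eps_s : cf s 0 0 = 0.
  have eX := skew_cf_mon Acf n 0 0 0; have eY := skew_cf_mon Acf 0 n 0 0.
  rewrite /mon expr0 mulr1 mul1r (gtn_eqF n_gt0) ?andbF in eX eY.
  by rewrite (cfD Acf) eX eY addr0.
have eps_sg : eps sg = 0 by rewrite /eps /= (cfM00 Acf) eps_s mulr0.
have eps_ta : eps ta = 0 by rewrite /eps /= !(cfM00 Acf) eps_s mulr0 mul0r.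
have kd : (k (d (1, 0))).1 = ta * ((k (1, 0)).1 : B) - sg * ((k (0, 1)).1 : B).
  have -> : d (1, 0) = ta *: ((1, 0) : W) - sg *: ((0, 1) : W).
    have e1 : 1 * ta + 0 * (sg * sg) = ta * 1 - sg * 0.
      by rewrite mul1r mul0r mulr0 mulr1 addr0 subr0.
    have e2 : 1 * - sg + 0 * - ta = ta * 0 - sg * 1.
      by rewrite mul1r mul0r mulr0 mulr1 addr0 sub0r.
    by rewrite dE /pr /= e1 e2.
  rewrite linearB linearZ_LR linearZ_LR; reflexivity.
have /(congr1 (fun w : W => eps w.1)) := hE (1, 0).
rewrite /= dE /pr /= kd !epsD epsN !epsM eps_sg eps_ta !mul0r !mulr0 oppr0 !addr0.
by rewrite /eps (cf1 Acf) => /eqP; rewrite oner_eq0.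
Qed.

End Odd.

Theorem theorem3p12 (R : realType) (n i j : nat)
  (n_ge2 : (2 <= n)%N) (lt_ij : (i < j)%N) (le_jn : (j <= n - 1)%N)
  (co_ijn : coprimez (i%:Z ^+ 2 - j%:Z ^+ 2) n%:Z)
  (H : algType (complex R)) (Hs : hopf_algebra H) (x y z : H)
  (H_is_H2n2 : is_H2n2 n Hs x y z)
  (M : module_algebra Hs (Aplus R n i j))
  (M_by_pi : acts_by_pi n i j x y z M (Aplus_u R n i j) (Aplus_v R n i j)) :
  let u := Aplus_u R n i j in
  let v := Aplus_v R n i j in
  let G := @Aplus_grading R n i j in
  inner_faithful M /\
  (~~ odd n ->
     (exists a b : invariant_ring M,
        [/\ inv_val a = u ^+ n + (-1) ^+ (i * j) * v ^+ n,
            inv_val b = u ^+ n * v ^+ n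
          & is_polynomial_ring2 a b]) /\
     reflection_hopf_algebra M G) /\
  (odd n ->
     (forall a : Aplus R n i j, a \in invariants M <->
        generated_subalg
          [set u ^+ n + v ^+ n; u ^+ n * v ^+ n * (u ^+ n - v ^+ n)]%classic a)
     /\ ~ AS_regular (inv_grading (M := M) G)).
Proof.
have c0 : neg_half_root R n ^ (i%:Z ^+ 2 - j%:Z ^+ 2) != 0.
  by rewrite expfz_neq0 // neg_half_root_neq0.
have Acf := skew_plane_polynomial c0.
have GE := skew_grading_homog c0.
move=> u v G; split; [|split].
- exact: (action_inner_faithful n_ge2 co_ijn H_is_H2n2 M_by_pi Acf).
- move=> n_even; split; [|split].
  + exists (inv_s n_ge2 co_ijn H_is_H2n2 M_by_pi).
    exists (inv_p n_ge2 co_ijn n_even H_is_H2n2 M_by_pi Acf); split.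
    * by rewrite -signr_odd (negbTE (parity_ij co_ijn n_even)) mul1r.
    * by [].
    * exact: invariants_polynomial.
  + exact: (H2n2_semisimple n_ge2 H_is_H2n2).
  + exact: (skew_AS_regular Acf (w1 := 1) (w2 := 1)).
  + exact: (action_inner_faithful n_ge2 co_ijn H_is_H2n2 M_by_pi Acf).
  + move=> h m a /GE a_m; apply/GE.
    exact: (act_homog n_ge2 co_ijn H_is_H2n2 M_by_pi Acf).
  + exact: (invariants_regular n_ge2 co_ijn n_even H_is_H2n2 M_by_pi Acf GE).
- move=> n_odd; split.
  + exact: (invariants_generated n_ge2 co_ijn n_odd H_is_H2n2 M_by_pi Acf).
  + move=> [d [_ [B_d _] _ _]].
    exact: (invariant_ring_inf_gldim n_ge2 co_ijn n_odd H_is_H2n2 M_by_pi Acf B_d).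
Qed.
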